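(* Let $Y=\mathrm{Y}_p(\mathfrak{gl}_2)$ and let $\Gamma\subseteq Y$ be the commutative subalgebra generated by $t_{22}^{(1)},\dots,t_{22}^{(p)},d_1,\dots,d_{2p}$. Then: (1) $Y$ is free as a left (respectively, right) module over $\Gamma$. Moreover, $\Gamma$ is a direct summand of $Y$ (as a left, respectively right, $\Gamma$-module). (2) Every maximal ideal $\mathbf m$ of $\Gamma$ extends to an irreducible $Y$-module, i.e. there exists an irreducible Harish-Chandra $Y$-module $M$ (with respect to $\Gamma$) with $M(\mathbf m)\neq 0$.
   Context: $\Bbbk$ is an algebraically closed field of characteristic $0$ and $p\ge 1$ is an integer. The level $p$ Yangian $\mathrm{Y}_p(\mathfrak{gl}_2)$ is the associative unital $\Bbbk$-algebra with generators $t_{ij}^{(r)}$ ($i,j\in\{1,2\}$, $1\le r\le p$) and relations $$[t^{(r)}_{ij}, t^{(s)}_{kl}] =\sum_{a=1}^{\min(r,s)}\big(t^{(a-1)}_{kj} t^{(r+s-a)}_{il}-t^{(r+s-a)}_{kj} t^{(a-1)}_{il}\big),$$ where $t^{(0)}_{ij}=\delta_{ij}$ and $t_{ij}^{(r)}=0$ for $r\geq p+1$. Put $T_{ij}(u)=\delta_{ij}u^p+\sum_{k=1}^p t_{ij}^{(k)}u^{p-k}$. The quantum determinant is $D(u)=T_{11}(u)T_{22}(u-1)-T_{21}(u)T_{12}(u-1)=u^{2p}+d_1u^{2p-1}+\cdots+d_{2p}$; its coefficients $d_1,\dots,d_{2p}$ are central, and the $t_{22}^{(k)}$ commute with each other.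 A Harish-Chandra module (with respect to $\Gamma$) is a finitely generated left $Y$-module $M$ with $M=\bigoplus_{\mathbf m}M(\mathbf m)$, the sum being over maximal ideals $\mathbf m$ of $\Gamma$ and $M(\mathbf m)=\{x\in M : \mathbf m^k x=0 \text{ for some } k\ge 0\}$. *)

(* Defs.v *)
From HB Require Import structures.
From mathcomp Require Import all_boot all_order all_algebra.
From mathcomp Require Import finmap boolp classical_sets.
From mathcomp.multinomials Require Import monalg.

Set Implicit Arguments.
Unset Strict Implicit.
Unset Printing Implicit Defensive.

Import GRing.Theory.

Local Open Scope classical_set_scope.
Local Open Scope ring_scope.
Local Open Scope quotient_scope.

(* ring_quotient.v only has quotients of commutative rings by proper ideals,
   hence the construction of the quotient by a two-sided ideal below. *)

Definition two_sided_ideal (R : nzRingType) (I : {pred R}) : Prop :=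
  zmod_closed I /\ forall a b : R, {in I, forall x, a * x * b \in I}.

Definition ideal_gen (R : nzRingType) (S : set R) : {pred R} := fun x =>
  `[< forall I : {pred R}, two_sided_ideal I ->
        (forall s, S s -> s \in I) -> x \in I >].

Section IdealGen.
Variables (R : nzRingType) (S : set R).

Lemma sub_ideal_gen s : S s -> s \in ideal_gen S.
Proof. by move=> Ss; apply/asboolP => I _; exact. Qed.

Lemma ideal_gen_zmod_closed : zmod_closed (ideal_gen S).
Proof.
split; first by apply/asboolP => I [[]].
move=> x y /asboolP hx /asboolP hy; apply/asboolP => I idI SI.
by have [[_ subI] _] := idI; apply: subI; [apply: hx | apply: hy].
Qed.

HB.instance Definition _ :=
  GRing.isZmodClosed.Build R (ideal_gen S) ideal_gen_zmod_closed.

Lemma ideal_genM a b x : x \in ideal_gen S -> a * x * b \in ideal_gen S.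
Proof.
move=> /asboolP hx; apply/asboolP => I idI SI.
by case: (idI) => _; apply; apply: hx.
Qed.

End IdealGen.

(* The free algebra on X is the algebra of the free monoid {fmonom X}. *)
Notation "{ 'free' k [ X ] }" := {malg k[{fmonom X}]}
  (at level 0, k, X at level 2, format "{ 'free'  k [ X ] }") : type_scope.

Section Presented.
Variables (k : comNzRingType) (X : choiceType) (S : set {free k[X]}).

Definition presented : Type := Quotient.quot (ideal_gen S).

HB.instance Definition _ := Choice.on presented.
HB.instance Definition _ := GRing.Zmodule.on presented.
HB.instance Definition _ := EqQuotient.on presented.

Definition presented_pi (x : {free k[X]}) : presented := \pi_presented x.

Lemma presented_eq x y :
  presented_pi x = presented_pi y <-> x - y \in ideal_gen S.
Proof.
rewrite (Quotient.idealrBE (ideal_gen S)) /presented_pi.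
by split => [/eqP|/eqP].
Qed.

Lemma presented_repr (x : presented) : exists y, x = presented_pi y.
Proof. by exists (repr x); rewrite /presented_pi reprK. Qed.

Lemma presented_piB x y :
  presented_pi (x - y) = presented_pi x - presented_pi y.
Proof. exact: (raddfB (\pi_(Quotient.quot (ideal_gen S)))). Qed.

HB.instance Definition _ :=
  GRing.isZmodMorphism.Build _ _ presented_pi presented_piB.

(* locked keeps conversion from unfolding the choice of representatives. *)
Definition presented_one : presented := presented_pi 1.
Definition presented_mul (x y : presented) : presented :=
  locked (presented_pi (repr x * repr y)).
Definition presented_scale (a : k) (x : presented) : presented :=
  locked (presented_pi (a *: repr x)).

Lemma presented_piK x : repr (presented_pi x) - x \in ideal_gen S.
Proof. by apply/presented_eq; rewrite /presented_pi reprK. Qed.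

Lemma presented_mulE x y :
  presented_mul (presented_pi x) (presented_pi y) = presented_pi (x * y).
Proof.
rewrite /presented_mul -lock.
apply/presented_eq; set x' := repr _; set y' := repr _.
have -> : x' * y' - x * y = 1 * (x' - x) * y' + x * (y' - y) * 1.
  by rewrite mul1r mulr1 mulrBl mulrBr addrA subrK.
by rewrite rpredD ?ideal_genM ?presented_piK.
Qed.

Lemma presented_scaleE a x :
  presented_scale a (presented_pi x) = presented_pi (a *: x).
Proof.
rewrite /presented_scale -lock.
apply/presented_eq; set x' := repr _.
have -> : a *: x' - a *: x = a%:MP * (x' - x) * 1.
  by rewrite mulr1 mul_malgC scalerBr.
by rewrite ideal_genM ?presented_piK.
Qed.

Fact presented_mulA : associative presented_mul.
Proof.
move=> x y z; have [x' ->] := presented_repr x; have [y' ->] := presented_repr y.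
by have [z' ->] := presented_repr z; rewrite !presented_mulE mulrA.
Qed.

Fact presented_mul1 : left_id presented_one presented_mul.
Proof.
by move=> x; have [x' ->] := presented_repr x; rewrite presented_mulE mul1r.
Qed.

Fact presented_mulr1 : right_id presented_one presented_mul.
Proof.
by move=> x; have [x' ->] := presented_repr x; rewrite presented_mulE mulr1.
Qed.

Fact presented_mulDl : left_distributive presented_mul +%R.
Proof.
move=> x y z; have [x' ->] := presented_repr x; have [y' ->] := presented_repr y.
have [z' ->] := presented_repr z.
by rewrite -raddfD !presented_mulE mulrDl raddfD.
Qed.

Fact presented_mulDr : right_distributive presented_mul +%R.
Proof.
move=> x y z; have [x' ->] := presented_repr x; have [y' ->] := presented_repr y.
have [z' ->] := presented_repr z.
by rewrite -raddfD !presented_mulE mulrDr raddfD.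
Qed.

HB.instance Definition _ := GRing.Zmodule_isPzRing.Build presented
  presented_mulA presented_mul1 presented_mulr1
  presented_mulDl presented_mulDr.

Fact presented_pi_monoid_morphism : monoid_morphism presented_pi.
Proof. by split => [|x y]; [|apply/esym/presented_mulE]. Qed.

HB.instance Definition _ := GRing.isMonoidMorphism.Build _ _ presented_pi
  presented_pi_monoid_morphism.

Fact presented_scaleA a b x :
  presented_scale a (presented_scale b x) = presented_scale (a * b) x.
Proof.
by have [x' ->] := presented_repr x; rewrite !presented_scaleE scalerA.
Qed.

Fact presented_scale1 : left_id 1 presented_scale.
Proof.
by move=> x; have [x' ->] := presented_repr x; rewrite presented_scaleE scale1r.
Qed.

Fact presented_scaleDr : right_distributive presented_scale +%R.
Proof.
move=> a x y; have [x' ->] := presented_repr x.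
have [y' ->] := presented_repr y.
by rewrite -raddfD !presented_scaleE scalerDr raddfD.
Qed.

Fact presented_scaleDl x :
  {morph presented_scale^~ x : a b / a + b}.
Proof.
move=> a b; have [x' ->] := presented_repr x.
by rewrite !presented_scaleE scalerDl raddfD.
Qed.

HB.instance Definition _ := GRing.Zmodule_isLmodule.Build k presented
  presented_scaleA presented_scale1 presented_scaleDr presented_scaleDl.

Fact presented_scaleAl (a : k) (x y : presented) :
  a *: (x * y) = (a *: x) * y.
Proof.
have [x' ->] := presented_repr x; have [y' ->] := presented_repr y.
rewrite -rmorphM [LHS]presented_scaleE [a *: _ in RHS]presented_scaleE.
by rewrite -rmorphM scalerAl.
Qed.

Fact presented_scaleAr (a : k) (x y : presented) :
  a *: (x * y) = x * (a *: y).
Proof.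
have [x' ->] := presented_repr x; have [y' ->] := presented_repr y.
rewrite -rmorphM [LHS]presented_scaleE [a *: _ in RHS]presented_scaleE.
rewrite -rmorphM; congr (presented_pi _).
rewrite -2!mul_malgC [LHS]mulrA [RHS]mulrA; congr (_ * y').
rewrite !malgM_def fgmulUg fgmulgU; apply: eq_bigr => m _.
by rewrite mul1m mulm1 mulrC.
Qed.

End Presented.

Notation ix1 := (ord0 : 'I_2).
Notation ix2 := (ord_max : 'I_2).

Section Yangian.
Variables (k : fieldType) (p : nat).

(* (i, j, s) stands for t_ij^(s+1), where s < p. *)
Definition yangian_gen : Type := 'I_2 * 'I_2 * 'I_p.
HB.instance Definition _ := Finite.on yangian_gen.

Definition ft (i j : 'I_2) (r : nat) : {free k[yangian_gen]} :=
  if r is s.+1 then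
    if insub s is Some s' then << fmu (i, j, s' : 'I_p) >> else 0
  else (i == j)%:R.

Definition yangian_relator (i j l m : 'I_2) (r s : nat) :
    {free k[yangian_gen]} :=
  ft i j r * ft l m s - ft l m s * ft i j r
  - \sum_(1 <= a < (minn r s).+1)
      (ft l j a.-1 * ft i m (r + s - a) - ft l j (r + s - a) * ft i m a.-1).

Definition yangian_relators : set {free k[yangian_gen]} :=
  [set x | exists i j l m : 'I_2, exists r s : nat,
     [/\ (1 <= r <= p)%N, (1 <= s <= p)%N & x = yangian_relator i j l m r s]].

Definition yangian : Type := presented yangian_relators.

HB.instance Definition _ := GRing.PzRing.on yangian.
HB.instance Definition _ := GRing.Lmodule.on yangian.

Local Notation aug := (mcoeff mone : {free k[yangian_gen]} -> k).

Lemma mcoeff1_ft i j r : (ft i j r)@_mone = ((r == 0%N) && (i == j))%:R.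
Proof.
case: r => [|r] /=; first by rewrite (rmorph_nat aug).
case: insubP => [s _ _|_]; last exact: raddf0.
by rewrite mcoeffU1 fm1_eq1.
Qed.

Fact yangian_nontrivial : (1 : yangian) != 0.
Proof.
apply/negP => /eqP; change (1 : yangian) with (presented_pi yangian_relators 1).
rewrite -[0](raddf0 (presented_pi yangian_relators)) => /presented_eq.
rewrite subr0 => /asboolP/(_ [pred x | x@_mone == 0]).
rewrite inE /= (rmorph1 aug) oner_eq0 => h.
suff: false by []; apply: h => [|x].
  split; [split=> [|x' y] | move=> a b x']; rewrite !inE /= ?raddf0 //.
    by move=> /eqP x0 /eqP y0; rewrite raddfB /= x0 y0 subrr.
  by move=> /eqP x0; rewrite 2!(rmorphM aug) /= x0 mulr0 mul0r.
move=> [i [j [l [m [r [s [/andP[r0 _] /andP[s0 _] ->]]]]]]]; rewrite inE /=.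
have rn0 : (r == 0%N) = false by case: r r0.
rewrite !raddfB /= 2!(rmorphM aug) /= !mcoeff1_ft rn0 /=.
rewrite mul0r mulr0 subrr sub0r oppr_eq0 raddf_sum /= big_nat big1 // => a.
move=> /andP[a0]; rewrite ltnS leq_min => /andP[ar _].
rewrite raddfB /= 2!(rmorphM aug) /= !mcoeff1_ft.
have -> : (r + s - a == 0)%N = false.
  by rewrite subn_eq0 leqNgt (leq_ltn_trans ar) // -[ltnLHS]addn0 ltn_add2l.
by rewrite mulr0 mul0r subrr.
Qed.

HB.instance Definition _ :=
  GRing.PzSemiRing_isNonZero.Build yangian yangian_nontrivial.
HB.instance Definition _ :=
  GRing.Lmodule_isLalgebra.Build k yangian
    (@presented_scaleAl _ _ yangian_relators).
HB.instance Definition _ :=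
  GRing.Lalgebra_isAlgebra.Build k yangian
    (@presented_scaleAr _ _ yangian_relators).

Definition yt (i j : 'I_2) (r : nat) : yangian :=
  presented_pi yangian_relators (ft i j r).

(* The formal variable u is central in {poly yangian}. *)
Definition yT (i j : 'I_2) : {poly yangian} :=
  (i == j)%:R *: 'X^p + \sum_(1 <= r < p.+1) yt i j r *: 'X^(p - r).

Definition qdet : {poly yangian} :=
  yT ix1 ix1 * (yT ix2 ix2 \Po ('X - 1)) - yT ix2 ix1 * (yT ix1 ix2 \Po ('X - 1)).

Definition qdet_coef (m : nat) : yangian := qdet`_(2 * p - m).

End Yangian.

Section SubalgGen.
Variables (k : nzRingType) (A : lalgType k) (S : set A).

Definition subalg_gen : {pred A} := fun x =>
  `[< forall B : {pred A}, GRing.subalg_closed B ->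
        (forall s, S s -> s \in B) -> x \in B >].

Fact subalg_gen_closed : GRing.subsemialg_closed subalg_gen.
Proof.
split; first by apply/asboolP => B [].
- split; first by apply/asboolP => B /GRing.subalg_closedZ[].
  move=> x y /asboolP hx /asboolP hy; apply/asboolP => B algB SB.
  have /GRing.subalg_closed_semi[_ [_ addB] _ _] := algB.
  by apply: addB; [apply: hx | apply: hy].
- move=> a x /asboolP hx; apply/asboolP => B algB SB.
  have /GRing.subalg_closed_semi[_ _ scaleB _] := algB.
  by apply: scaleB; apply: hx.
- move=> x y /asboolP hx /asboolP hy; apply/asboolP => B algB SB.
  by have [_ _ mulB] := algB; apply: mulB; [apply: hx | apply: hy].
Qed.

HB.instance Definition _ :=
  GRing.isSubalgClosed.Build k A subalg_gen subalg_gen_closed.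
End SubalgGen.

Section Gamma.
Variables (k : fieldType) (p : nat).

Definition Gamma_gens : set (yangian k p) :=
  [set x | (exists2 r, (1 <= r <= p)%N & x = yt k p ix2 ix2 r) \/
           (exists2 m, (1 <= m <= 2 * p)%N & x = qdet_coef k p m)].

Record Gamma : Type :=
  MkGamma { Gval : yangian k p; _ : Gval \in subalg_gen Gamma_gens }.

HB.instance Definition _ := [isSub for Gval].
HB.instance Definition _ := [Choice of Gamma by <:].
HB.instance Definition _ := [SubChoice_isSubAlgebra of Gamma by <:].
HB.instance Definition _ := GRing.RMorphism.copy Gval (val : Gamma -> _).

End Gamma.

(* A as a left, resp. right, R-module along f; right R-modules are represented
   as left modules over the converse ring R^c. *)
Definition left_reg (R A : nzRingType) (f : {rmorphism R -> A}) : Type := A.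
Definition right_reg (R A : nzRingType) (f : {rmorphism R -> A}) : Type := A.

Section RestrictionOfScalars.
Variables (R A : nzRingType) (f : {rmorphism R -> A}).
Local Notation left_reg := (left_reg f).
Local Notation right_reg := (right_reg f).

HB.instance Definition _ := GRing.Zmodule.on left_reg.
HB.instance Definition _ := GRing.Zmodule.on right_reg.

Definition left_reg_scale (r : R) (x : left_reg) : left_reg := f r * (x : A).
Definition right_reg_scale (r : R^c) (x : right_reg) : right_reg :=
  (x : A) * f r.

Fact left_reg_scaleA a b x :
  left_reg_scale a (left_reg_scale b x) = left_reg_scale (a * b) x.
Proof. by rewrite /left_reg_scale rmorphM mulrA. Qed.
Fact left_reg_scale1 : left_id 1 left_reg_scale.
Proof. by move=> x; rewrite /left_reg_scale rmorph1 mul1r. Qed.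
Fact left_reg_scaleDr : right_distributive left_reg_scale +%R.
Proof. by move=> a x y; apply: mulrDr. Qed.
Fact left_reg_scaleDl x : {morph left_reg_scale^~ x : a b / a + b}.
Proof. by move=> a b; rewrite /left_reg_scale rmorphD mulrDl. Qed.

HB.instance Definition _ := GRing.Zmodule_isLmodule.Build R left_reg
  left_reg_scaleA left_reg_scale1 left_reg_scaleDr left_reg_scaleDl.

Fact right_reg_scaleA (a b : R^c) x :
  right_reg_scale a (right_reg_scale b x) = right_reg_scale (a * b) x.
Proof. by rewrite /right_reg_scale -mulrA -rmorphM. Qed.
Fact right_reg_scale1 : left_id (1 : R^c) right_reg_scale.
Proof. by move=> x; rewrite /right_reg_scale (rmorph1 f) mulr1. Qed.
Fact right_reg_scaleDr : right_distributive right_reg_scale +%R.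
Proof. by move=> a x y; apply: mulrDl. Qed.
Fact right_reg_scaleDl x :
  {morph right_reg_scale^~ x : a b / (a + b : R^c) >-> a + b}.
Proof. by move=> a b; rewrite /right_reg_scale (rmorphD f) mulrDr. Qed.

HB.instance Definition _ := GRing.Zmodule_isLmodule.Build R^c right_reg
  right_reg_scaleA right_reg_scale1 right_reg_scaleDr right_reg_scaleDl.

End RestrictionOfScalars.

Section Modules.
Variables (R : nzRingType) (M : lmodType R).

(* {malg R[I]} is the R-module of finitely supported functions I -> R. *)
Definition free_module : Prop :=
  exists (I : choiceType) (b : I -> M),
    bijective (fun c : {malg R[I]} => \sum_(i <- msupp c) c@_i *: b i).

Definition submodule (N : set M) : Prop := GRing.submod_closed [in N].

Definition direct_summand (U : set M) : Prop :=
  submodule U /\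
  exists N : set M, [/\ submodule N, U `&` N = [set 0] &
    forall x, exists u v, [/\ U u, N v & x = u + v]].

Definition finitely_generated : Prop :=
  exists (n : nat) (g : 'I_n -> M),
    forall x, exists a : 'I_n -> R, x = \sum_i a i *: g i.

Definition irreducible_module : Prop :=
  (exists x : M, x != 0) /\
  forall N : set M, submodule N -> N = [set 0] \/ N = setT.

End Modules.

(* {malg V[I]} is the group of finitely supported functions I -> V. *)
Definition internal_direct_sum (V : zmodType) (I : choiceType) (D : set I)
    (U : I -> set V) : Prop :=
  forall x : V, exists! f : {malg V[I]},
    (forall i, i \in msupp f -> D i /\ U i f@_i) /\
    x = \sum_(i <- msupp f) f@_i.

Section Ideals.
Variable R : nzRingType.

(* idealr_closed requires properness and closure under left multiplication;
   these notions are only applied to the commutative ring Gamma. *)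
Definition maximal_ideal (I : set R) : Prop :=
  idealr_closed [in I] /\
  forall J : set R, idealr_closed [in J] -> I `<=` J -> J = I.

Definition ideal_mul (I J : set R) : set R :=
  [set x | exists (n : nat) (a b : 'I_n -> R),
     (forall i, I (a i) /\ J (b i)) /\ x = \sum_i a i * b i].

Definition ideal_exp (I : set R) (e : nat) : set R :=
  iter e (ideal_mul I) setT.

End Ideals.

Section HarishChandra.
Variables (k : fieldType) (p : nat) (M : lmodType (yangian k p)).

Definition weight_space (m : set (Gamma k p)) : set M :=
  [set x | exists e : nat, forall g, ideal_exp m e g -> Gval g *: x = 0].

Definition harish_chandra : Prop :=
  finitely_generated M /\
  internal_direct_sum (@maximal_ideal (Gamma k p)) weight_space.

End HarishChandra.

(* Main.v *)
(* Filter Y by giving t_ij^(r) degree r. The defining relations make the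
   associated graded algebra a quotient of the polynomial ring in the t_ij^(r).
   It is the polynomial ring itself (PBW): a product of p linear factors
   u + E(m), where the E(m) are commuting copies of gl_2 acting by difference
   operators, satisfies the RTT relation, hence defines a representation of Y;
   its leading symbols are the coefficients of a product of p factors u + N(m),
   and such products are dense among monic matrix polynomials of degree p.
   Comparing the action on these faithful modules, the quantum determinant is
   multiplicative and scalar on each factor, so its coefficients are central.

   Modulo the t_22^(r) the symbol of d_m is t_11^(m) minus the convolution of
   the t_21^(a) and t_12^(b), so an induction splitting the product t_21 t_12
   into its two factors shows that the polynomial ring is free, with a basis
   containing 1, over the symbols of the generators of Gamma. Lifting the basis
   to Y on either side proves (1).

   For (2), the complement of Gamma in Y as a right module shows that Y m is a
   proper left ideal. Let M be the quotient of Y by a maximal left ideal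
   containing Y m. By the Nullstellensatz the generators of Gamma act on the
   class of 1 by scalars; the commutators of t_22^(r) with the t_ij^(s) then
   show that every vector of M lies in a finite-dimensional subspace stable
   under these generators, so M is the direct sum of its weight spaces. *)

From HB Require Import structures.
Require Import Defs.
From mathcomp Require Import all_boot all_order all_algebra.
From mathcomp Require Import finmap boolp classical_sets functions.
From mathcomp.multinomials Require Import monalg.
From mathcomp Require Import ring zify.
Set Implicit Arguments.
Unset Strict Implicit.
Unset Printing Implicit Defensive.
Import GRing.Theory.
Local Open Scope classical_set_scope.
Local Open Scope ring_scope.

(** * Polynomial functions *)

(** Polynomials are functions on [G -> k]: over an infinite field nothing is lost, equality becomes
    extensional and substitution becomes composition. Symbols are a relation [sym], not a function,
    because their being well defined is PBW itself: normal ordering ([sym_eq0]) follows from the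
    commutation relations alone, uniqueness ([yangian_pbw]) needs the representations. The latter
    carry an extra indeterminate ['X], of degree one in each matrix unit, so that the top
    coefficient in ['X] of the image of the constant function 1 is the symbol evaluated at a point.
    The delicate part of freeness is the upper half of the determinant coefficients, where t_11 no
    longer occurs. Read downward from d_2p and modulo t_22 they are, up to sign, [b_0 c_0],
    [b_0 c_1 + b_1 c_0], and so on; the first is a product of two variables and cannot be solved for
    either one, so bases modulo [b_0] and modulo [c_0] have to be glued. The Nullstellensatz is
    proved in a form that passes from a ring to its polynomial ring, and gives residue field [k] at
    every maximal ideal of Gamma. *)

Inductive lspan (k : pzRingType) (V : lmodType k) (P : V -> Prop) : V -> Prop :=
| lspan0 : lspan P 0
| lspanC a x y : P x -> lspan P y -> lspan P (a *: x + y).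

Section LinearSpan.
Variables (k : pzRingType) (V : lmodType k).
Implicit Types (P Q : V -> Prop) (x y : V).

Lemma lspan_gen P x : P x -> lspan P x.
Proof. by move=> Px; rewrite -[x]addr0 -[x]scale1r; apply: lspanC (lspan0 _). Qed.

Lemma lspanD P x y : lspan P x -> lspan P y -> lspan P (x + y).
Proof. by elim=> [|a z t Pz _ IH] sy; rewrite ?add0r // -addrA; apply/lspanC/IH. Qed.

Lemma lspanZ P a x : lspan P x -> lspan P (a *: x).
Proof.
elim=> [|b z t Pz _ IH]; first by rewrite scaler0; apply: lspan0.
by rewrite scalerDr scalerA; apply: lspanC.
Qed.

Lemma lspanN P x : lspan P x -> lspan P (- x).
Proof. by rewrite -scaleN1r; apply: lspanZ. Qed.

Lemma lspanB P x y : lspan P x -> lspan P y -> lspan P (x - y).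
Proof. by move=> sx /lspanN; apply: lspanD. Qed.

Lemma lspan_sum P (I : Type) (r : seq I) (p : pred I) (f : I -> V) :
  (forall i, p i -> lspan P (f i)) -> lspan P (\sum_(i <- r | p i) f i).
Proof. by move=> Pf; elim/big_ind: _ => //; [apply: lspan0 | apply: lspanD]. Qed.

Lemma lspan_bind P Q x : (forall y, P y -> lspan Q y) -> lspan P x -> lspan Q x.
Proof.
move=> PQ; elim=> [|a y z /PQ sy _ sz]; first exact: lspan0.
by apply: lspanD => //; apply: lspanZ.
Qed.

Lemma lspan_sub P Q x : (forall y, P y -> Q y) -> lspan P x -> lspan Q x.
Proof. by move=> PQ; apply: lspan_bind => y /PQ/lspan_gen. Qed.

(** Repeated indices are merged, because the independence statements below quantify over
    duplicate-free sequences. *)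
Lemma lspan_uniq (I : eqType) (e : I -> V) (P : I -> Prop) x :
    lspan (fun y => exists2 i, P i & y = e i) x ->
  exists s : seq I, exists c : I -> k,
    [/\ uniq s, forall i, i \in s -> P i & x = \sum_(i <- s) c i *: e i].
Proof.
elim=> [|a y z [i Pi ->] _ [s [c [us sP ->]]]].
  by exists [::], (fun=> 0); rewrite big_nil.
have [si|nsi] := boolP (i \in s).
  exists s, (fun j => if j == i then a + c i else c j); split=> //.
  rewrite [in RHS](bigD1_seq i) //= [in LHS](bigD1_seq i) //= eqxx addrA scalerDl.
  by congr (_ + _); apply: eq_bigr => j /negPf ->.
exists (i :: s), (fun j => if j == i then a else c j); split=> /=; first by rewrite nsi.
  by move=> j; rewrite inE => /orP[/eqP-> //|/sP].
rewrite big_cons eqxx; congr (_ + _); apply: eq_big_seq => j sj.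
by case: eqP sj nsi => // -> ->.
Qed.

End LinearSpan.

Lemma lspan_img (k : pzRingType) (U V : lmodType k) (f : U -> V)
    (P : U -> Prop) (Q : V -> Prop) y :
    f 0 = 0 -> (forall a u v, f (a *: u + v) = a *: f u + f v) ->
    (forall y, Q y -> exists2 x, P x & f x = y) ->
  lspan Q y -> exists2 x, lspan P x & f x = y.
Proof.
move=> f0 fD QP; elim=> [|a z t /QP[x Px fx] _ [x' sx fx']].
  by exists 0 => //; apply: lspan0.
by exists (a *: x + x'); rewrite ?fD ?fx ?fx' //; apply: lspanC.
Qed.

Lemma lspan_map (k : pzRingType) (U V : lmodType k) (f : U -> V)
    (P : U -> Prop) (Q : V -> Prop) x :
    f 0 = 0 -> (forall a u v, f (a *: u + v) = a *: f u + f v) ->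
  (forall x, P x -> lspan Q (f x)) -> lspan P x -> lspan Q (f x).
Proof.
move=> f0 fD PQ; elim=> [|a z t /PQ sz _ st]; first by rewrite f0; apply: lspan0.
by rewrite fD; apply: lspanD => //; apply: lspanZ.
Qed.

(** Serves for commuting symbols and for elements of noncommutative algebras; the factors stand in
    the order of [s]. *)
Fixpoint mexp (R : pzRingType) (s : seq R) (a : seq nat) : R :=
  if s is x :: s' then if a is i :: a' then x ^+ i * mexp s' a' else 1 else 1.

Fixpoint wdeg (w a : seq nat) : nat :=
  if w is x :: w' then if a is i :: a' then i * x + wdeg w' a' else 0 else 0.

Section PolyFun.
Variables (k : closedFieldType) (G : eqType) (wt : G -> nat).

Definition pfun : Type := (G -> k) -> k^o.
HB.instance Definition _ := GRing.Lmodule.on pfun.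
HB.instance Definition _ := GRing.ComPzRing.on pfun.

Implicit Types (W : pred G) (f g h : pfun).

Definition pvar (v : G) : pfun := fun t => t v.

Inductive hpol W : nat -> pfun -> Prop :=
| hpol0 n : hpol W n 0
| hpol1 : hpol W 0 1
| hpolD n f g : hpol W n f -> hpol W n g -> hpol W n (f + g)
| hpolZ n a f : hpol W n f -> hpol W n (a *: f)
| hpolX n v f : W v -> hpol W n f -> hpol W (wt v + n) (pvar v * f).

Lemma pfunP f g : (forall t, f t = g t) -> f = g.
Proof. by move=> fg; apply/funext. Qed.
Lemma pfunD f g t : (f + g) t = f t + g t. Proof. by []. Qed.
Lemma pfunZ a f t : (a *: f) t = a * f t. Proof. by []. Qed.
Lemma pfunM f g t : (f * g) t = f t * g t. Proof. by []. Qed.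
Lemma pfunN f t : (- f) t = - f t. Proof. by []. Qed.

Lemma pfunZl a f g : a *: f * g = a *: (f * g).
Proof. by apply: pfunP => t; rewrite !(pfunM, pfunZ) mulrA. Qed.
Lemma pfunZr a f g : f * (a *: g) = a *: (f * g).
Proof. by rewrite mulrC pfunZl mulrC. Qed.

Lemma hpol_var W v : W v -> hpol W (wt v) (pvar v).
Proof. by move=> Wv; rewrite -[pvar v]mulr1 -[wt v]addn0; apply/hpolX/hpol1. Qed.

Lemma hpolM W n m f g : hpol W n f -> hpol W m g -> hpol W (n + m) (f * g).
Proof.
move=> hf hg; elim: hf => {n f} [n||n f f' _ hf _ hf'|n a f _ hf|n v f Wv _ hf].
- by rewrite mul0r; apply: hpol0.
- by rewrite mul1r.
- by rewrite mulrDl; apply: hpolD.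
- by rewrite pfunZl; apply: hpolZ.
- by rewrite -mulrA -addnA; apply: hpolX.
Qed.

Lemma hpolN W n f : hpol W n f -> hpol W n (- f).
Proof. by rewrite -scaleN1r; apply: hpolZ. Qed.

Lemma hpolB W n f g : hpol W n f -> hpol W n g -> hpol W n (f - g).
Proof. by move=> hf /hpolN; apply: hpolD. Qed.

Lemma hpol_exp W n i f : hpol W n f -> hpol W (i * n) (f ^+ i).
Proof.
move=> hf; elim: i => [|i IH]; first by rewrite mul0n expr0; apply: hpol1.
by rewrite mulSn exprS; apply: hpolM.
Qed.

Lemma hpol_sub W W' n f : {subset W <= W'} -> hpol W n f -> hpol W' n f.
Proof.
move=> WW'; elim=> {n f} [n||n f f' _ hf _ hf'|n a f _ hf|n v f Wv _ hf].
- exact: hpol0.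
- exact: hpol1.
- exact: hpolD.
- exact: hpolZ.
- by apply: hpolX => //; apply: WW'.
Qed.

Lemma hpol_span W n f : lspan (hpol W n) f -> hpol W n f.
Proof. by elim=> [|a x y hx _ hy]; [apply: hpol0 | apply/hpolD/hy/hpolZ]. Qed.

Lemma hpol_ext W n f t t' : hpol W n f -> {in W, t =1 t'} -> f t = f t'.
Proof.
move=> hf tt'; elim: hf => {n f} [n||n f f' _ hf _ hf'|n a f _ hf|n v f Wv _ hf] //.
- by rewrite !pfunD hf hf'.
- by rewrite !pfunZ hf.
- by rewrite !pfunM hf /pvar tt'.
Qed.

Definition pol W f := lspan (fun g => exists n, hpol W n g) f.

Lemma hpol_pol W n f : hpol W n f -> pol W f.
Proof. by move=> hf; apply: lspan_gen; exists n. Qed.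

Lemma polM W f g : pol W f -> pol W g -> pol W (f * g).
Proof.
move=> pf pg; elim: pf => [|a f1 f2 [n hf1] _ IH]; first by rewrite mul0r; apply: lspan0.
rewrite mulrDl pfunZl; apply: lspanD => //; apply: lspanZ.
elim: pg {IH} => [|b g1 g2 [m hg1] _ IH]; first by rewrite mulr0; apply: lspan0.
by rewrite mulrDr pfunZr; apply: lspanC => //; exists (n + m)%N; apply: hpolM.
Qed.

Lemma pol_line W f t t' : pol W f ->
  exists P : {poly k}, forall z, f (fun v => t v + z * t' v) = P.[z].
Proof.
elim=> [|a g h [n hg] _ [P hP]]; first by exists 0 => z; rewrite horner0.
have [Q hQ] : exists Q : {poly k}, forall z, g (fun v => t v + z * t' v) = Q.[z].
  elim: hg => {n g} [n||n f1 f2 _ [P1 h1] _ [P2 h2]|n b f1 _ [P1 h1]|n v f1 _ _ [P1 h1]].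
  - by exists 0 => z; rewrite horner0.
  - by exists 1 => z; rewrite hornerE.
  - by exists (P1 + P2) => z; rewrite hornerD pfunD h1 h2.
  - by exists (b *: P1) => z; rewrite hornerZ pfunZ h1.
  - by exists (((t v)%:P + 'X * (t' v)%:P) * P1) => z; rewrite pfunM h1 /pvar !hornerE.
by exists (a *: Q + P) => z; rewrite hornerD hornerZ pfunD pfunZ hQ hP.
Qed.

(** Restriction to the line through a point where [f] does not vanish and one where [g] does not
    gives two nonzero polynomials in one variable; their product has a nonroot because [k] is
    infinite. *)
Lemma pol_domain W f g : pol W f -> pol W g -> f * g = 0 -> f <> 0 -> g = 0.
Proof.
move=> pf pg fg0 fN0; apply: contrapT => gN0.
have [t ft] : exists t, f t != 0.
  by apply: contrapT => /forallNP f0; apply/fN0/pfunP => t; apply/eqP; have /negP := f0 t; rewrite negbK.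
have [t' gt] : exists t, g t != 0.
  by apply: contrapT => /forallNP f0; apply/gN0/pfunP => u; apply/eqP; have /negP := f0 u; rewrite negbK.
have [P hP] := pol_line t (fun v => t' v - t v) pf.
have [Q hQ] := pol_line t (fun v => t' v - t v) pg.
have P0 : P.[0] != 0.
  by rewrite -hP; move: ft; congr (f _ != 0); apply: funext => v; rewrite mul0r addr0.
have Q1 : Q.[1] != 0.
  by rewrite -hQ; move: gt; congr (g _ != 0); apply: funext => v; rewrite mul1r addrC subrK.
have : P * Q != 0.
  rewrite mulf_neq0 //; first by apply: contraNneq P0 => ->; rewrite horner0.
  by apply: contraNneq Q1 => ->; rewrite horner0.
move/closed_nonrootP => [z]; rewrite /root hornerM -hP -hQ.
by rewrite -[X in X != 0]/((f * g) _) fg0 eqxx.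
Qed.

Definition upd (t : G -> k) v (a : k) : G -> k := fun u => if u == v then a else t u.
Definition psub v g f : pfun := fun t => f (upd t v (g t)).

Lemma psub0 v g : psub v g 0 = 0. Proof. by []. Qed.
Lemma psubD v g f h : psub v g (f + h) = psub v g f + psub v g h. Proof. by []. Qed.
Lemma psubZ v g a f : psub v g (a *: f) = a *: psub v g f. Proof. by []. Qed.
Lemma psubN v g f : psub v g (- f) = - psub v g f. Proof. by []. Qed.
Lemma psubM v g f h : psub v g (f * h) = psub v g f * psub v g h. Proof. by []. Qed.
Lemma psubX v g f n : psub v g (f ^+ n) = psub v g f ^+ n.
Proof. by elim: n => // n IH; rewrite !exprS psubM IH. Qed.
Lemma psub_var v g : psub v g (pvar v) = g.
Proof. by apply: pfunP => t; rewrite /psub /pvar /upd eqxx. Qed.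
Lemma psub_varN v g u : u != v -> psub v g (pvar u) = pvar u.
Proof. by move=> /negPf uv; apply: pfunP => t; rewrite /psub /pvar /upd uv. Qed.
Lemma psub_sum v g (I : Type) (r : seq I) (p : pred I) (f : I -> pfun) :
  psub v g (\sum_(i <- r | p i) f i) = \sum_(i <- r | p i) psub v g (f i).
Proof. exact: (big_morph (psub v g) (psubD v g) (psub0 v g)). Qed.
Lemma psub_mexp v g s a : psub v g (mexp s a) = mexp (map (psub v g) s) a.
Proof. by elim: s a => [|x s IH] [|i a] //=; rewrite psubM psubX IH. Qed.

Lemma hpol_psub W W' v g n f : hpol W' (wt v) g ->
  (forall u, W u -> u != v -> W' u) -> hpol W n f -> hpol W' n (psub v g f).
Proof.
move=> hg WW'; elim=> {n f} [n||n f f' _ hf _ hf'|n a f _ hf|n u f Wu _ hf].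
- exact: hpol0.
- exact: hpol1.
- by rewrite psubD; apply: hpolD.
- by rewrite psubZ; apply: hpolZ.
- rewrite psubM; have [->|uv] := eqVneq u v; first by rewrite psub_var; apply: hpolM.
  by rewrite psub_varN //; apply: hpolX => //; apply: WW'.
Qed.

Lemma psub_id W v g n f : hpol W n f -> ~~ W v -> psub v g f = f.
Proof.
move=> hf Wv; apply: pfunP => t; apply: hpol_ext hf _ => u Wu.
by rewrite /upd; case: eqP => // uv; rewrite -uv -[W u]/(u \in W) Wu in Wv.
Qed.

(* [hdiv w n h] : [h] is homogeneous of degree [n - w], and zero if [n < w]. *)
Definition hdiv W w n h := h = 0 \/ exists2 m, n = (w + m)%N & hpol W m h.

Lemma hdivD W w n h h' : hdiv W w n h -> hdiv W w n h' -> hdiv W w n (h + h').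
Proof.
move=> [->|[m -> hm]] [->|[m' /eqP e hm']]; rewrite ?add0r ?addr0.
- by left.
- by right; exists m' => //; apply/eqP.
- by right; exists m.
- right; exists m => //; apply: hpolD => //.
  by move: e; rewrite eqn_add2l => /eqP ->.
Qed.

Lemma hdivM W w n m h f : hdiv W w n h -> hpol W m f -> hdiv W w (n + m) (h * f).
Proof.
move=> [->|[i -> hi]] hf; first by rewrite mul0r; left.
by right; exists (i + m)%N; rewrite ?addnA //; apply: hpolM.
Qed.

(** Division by a polynomial of degree one in [v], with the substitution of [g] for [v] as
    remainder. The degree of the quotient is recorded because [gbasis_step] descends on it. *)
Lemma hpol_div W v g n f : W v -> hpol W (wt v) g -> hpol W n f ->
  exists2 h, f = psub v g f + (pvar v - g) * h & hdiv W (wt v) n h.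
Proof.
move=> Wv hg; elim=> {n f} [n||n f f' _ [h e hh] _ [h' e' hh']|n a f hf [h e hh]|n u f Wu hf [h e hh]].
- by exists 0; [rewrite mulr0 addr0 | left].
- by exists 0; [rewrite mulr0 addr0 | left].
- exists (h + h'); last exact: hdivD.
  by rewrite psubD {1}e {1}e' mulrDr; ring.
- exists (a *: h); first by rewrite psubZ {1}e scalerDr pfunZr.
  case: hh => [->|[m -> hm]]; first by left; rewrite scaler0.
  by right; exists m => //; apply: hpolZ.
- have [uv|uv] := eqVneq u v; last first.
    exists (pvar u * h); first by rewrite psubM psub_varN // {1}e; ring.
    by rewrite mulrC addnC; apply: hdivM => //; apply: hpol_var.
  rewrite {}uv in Wu *; exists (f + g * h).
    by rewrite psubM psub_var; move: (psub v g f) e => s' ->; ring.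
  apply: hdivD; first by right; exists n.
  by rewrite mulrC addnC; apply: hdivM.
Qed.

End PolyFun.

(** * Free graded extensions *)

Lemma eq_bigr_seq (V : nmodType) (I : eqType) (r : seq I) (p : pred I) (F1 F2 : I -> V) :
    (forall i, i \in r -> p i -> F1 i = F2 i) ->
  \sum_(i <- r | p i) F1 i = \sum_(i <- r | p i) F2 i.
Proof.
move=> F12; rewrite big_seq_cond [RHS]big_seq_cond.
by apply: eq_bigr => i /andP[ri pi]; apply: F12.
Qed.

Section GradedFree.
Variables (k : closedFieldType) (G : eqType) (wt : G -> nat).
Local Notation pfun := (pfun k G).
Local Notation hpol := (@hpol k G wt).
Implicit Types (W : pred G) (f g h : pfun) (s : seq pfun) (w : seq nat).

Fixpoint homs W s w : Prop :=
  match s, w with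
  | x :: s', d :: w' => hpol W d x /\ homs W s' w'
  | [::], [::] => True
  | _, _ => False
  end.

Lemma hpol_mexp W s w a : homs W s w -> hpol W (wdeg w a) (mexp s a).
Proof.
elim: s w a => [|x s IH] [|d w] [|i a] //=; try by move=> _; apply: hpol1.
by move=> [hx hs]; apply: hpolM; [apply: hpol_exp | apply: IH].
Qed.

Lemma homs_sub W W' s w : {subset W <= W'} -> homs W s w -> homs W' s w.
Proof.
move=> WW'; elim: s w => [|x s IH] [|d w] //= [hx hs].
by split; [apply: hpol_sub hx | apply: IH].
Qed.

Definition gmono s w (J : Type) (b : J -> pfun) (d : J -> nat) n (x : pfun) : Prop :=
  exists a j, [/\ size a = size s, (wdeg w a + d j)%N = n & x = mexp s a * b j].

Definition gindep s (J : eqType) (b : J -> pfun) : Prop :=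
  forall (r : seq (seq nat * J)) (c : seq nat * J -> k), uniq r ->
    (forall i, i \in r -> size i.1 = size s) ->
    \sum_(i <- r) c i *: (mexp s i.1 * b i.2) = 0 ->
  forall i, i \in r -> c i = 0.

(* The polynomials in the variables [W] are free over the subalgebra generated
   by the algebraically independent [s], with homogeneous basis [b]. *)
Definition gbasis W s w (J : choiceType) (b : J -> pfun) (d : J -> nat) : Prop :=
  [/\ exists2 j, b j = 1 & d j = 0%N,
      forall j, hpol W (d j) (b j),
      forall n f, hpol W n f -> lspan (gmono s w b d n) f
    & gindep s b].

Definition gfree W s w : Prop :=
  exists (J : choiceType) (b : J -> pfun) (d : J -> nat), gbasis W s w b d.

Lemma hpol_gmono W s w (J : Type) (b : J -> pfun) d n x : homs W s w ->
  (forall j, hpol W (d j) (b j)) -> gmono s w b d n x -> hpol W n x.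
Proof.
by move=> hs hb [a [j [_ <- ->]]]; apply: hpolM => //; apply: hpol_mexp.
Qed.

(** The last two hypotheses say that [b] is a basis over [s] modulo [x]. Spanning descends on the
    degree, since the cofactor of [x] has smaller degree; independence descends on the exponent of
    [x], which can be cancelled in a domain. *)
Lemma gbasis_step W x dx s w (J : choiceType) (b : J -> pfun) (d : J -> nat) :
    hpol W dx x -> (0 < dx)%N -> x <> 0 -> homs W s w ->
    (exists2 j, b j = 1 & d j = 0%N) -> (forall j, hpol W (d j) (b j)) ->
    (forall n f, hpol W n f ->
       exists f' h, [/\ lspan (gmono s w b d n) f', f = f' + x * h & hdiv wt W dx n h]) ->
    (forall r c h, uniq r -> (forall i, i \in r -> size i.1 = size s) -> pol wt W h ->
       \sum_(i <- r) c i *: (mexp s i.1 * b i.2) = x * h ->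
       forall i : seq nat * J, i \in r -> c i = 0) ->
  gbasis W (x :: s) (dx :: w) b d.
Proof.
move=> hx dx0 x0 hs b1 hb sp ind; split=> //.
  elim/ltn_ind=> n IH f /sp[f' [h [sf' -> hh]]]; apply: lspanD.
    apply: lspan_sub sf' => _ [a [j [sa wa ->]]]; exists (0%N :: a), j.
    by split; rewrite /= ?sa ?mul0n ?expr0 ?mul1r.
  case: hh => [->|[m nE hm]]; first by rewrite mulr0; apply: lspan0.
  apply: (@lspan_map _ _ _ (fun y : pfun => x * y)) (IH m _ h hm); first exact: mulr0.
  - by move=> a u v; rewrite mulrDr pfunZr.
  - move=> _ [[|i a] [j [// sa wa ->]]]; apply: lspan_gen; exists (i.+1 :: a), j.
    by split=> //=; rewrite ?exprS ?mulrA //; move: wa => /= wa; rewrite nE -wa; lia.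
  - by rewrite nE; lia.
(* Induction on a bound for the exponents of [x]. *)
move=> r c ur sr; suff: forall N, (forall i, i \in r -> (head 0%N i.1 < N)%N) ->
    \sum_(i <- r) c i *: (mexp (x :: s) i.1 * b i.2) = 0 -> forall i, i \in r -> c i = 0.
  move=> /(_ (\max_(i <- r) head 0%N i.1).+1); apply => i ri.
  by rewrite ltnS; apply: (@leq_bigmax_seq _ _ xpredT (fun i : seq nat * J => head 0%N i.1)).
move=> N; elim: N r c ur sr => [|N IH] r c ur sr hN S0 i ri; first by have := hN i ri.
(* [z] selects the terms without [x]; [T] is the rest divided by [x], its exponents being lowered by
   [dn]. *)
pose z (i : seq nat * J) := head 0%N i.1 == 0%N.
pose dn (i : seq nat * J) := ((head 0%N i.1).-1 :: behead i.1, i.2).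
pose T := \sum_(i <- r | ~~ z i) c i *: (mexp (x :: s) (dn i).1 * b i.2).
have hT : pol wt W T.
  apply: lspan_sum => j _; apply: lspanZ; apply: polM; last exact: hpol_pol (hb _).
  by apply: hpol_pol; apply: (@hpol_mexp W (x :: s) (dx :: w)).
have eS : \sum_(i <- r | z i) c i *: (mexp s (behead i.1) * b i.2) = - (x * T).
  apply/eqP; rewrite -addr_eq0 -[X in _ == X]S0 [X in _ == X](bigID z) /=; apply/eqP; congr (_ + _).
    apply: eq_bigr_seq =>  [[[|e a] j]] /sr //= _; rewrite /z /= => /eqP ->.
    by rewrite expr0 mul1r.
  rewrite mulr_sumr; apply: eq_bigr_seq =>  [[[|e a] j]] /sr //= _; rewrite /z /= => e0.
  by rewrite pfunZr !mulrA -exprS prednK // lt0n.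
have c0 : forall i, i \in r -> z i -> c i = 0.
  move=> [[|e a] j] rj zj; first by have := sr _ rj.
  move: zj; rewrite /z /= => /eqP e0; rewrite {}e0 in rj *.
  pose r0 := [seq (behead i.1, i.2) | i <- r & z i].
  apply: (ind r0 (fun i => c (0%N :: i.1, i.2)) (- T) _ _ _ _ (a, j)).
  - rewrite map_inj_in_uniq ?filter_uniq // => i1 i2.
    rewrite !mem_filter => /andP[z1 /sr s1] /andP[z2 /sr s2].
    case: i1 i2 z1 z2 s1 s2 => [[|e1 a1] j1] [[|e2 a2] j2] //.
    by rewrite /z /= => /eqP -> /eqP -> _ _ [-> ->].
  - move=> _ /mapP[i' + ->]; rewrite mem_filter => /andP[_ /sr] /=.
    by rewrite size_behead => ->.
  - exact: lspanN.
  - rewrite big_map big_filter mulrN -eS.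
    apply: eq_bigr_seq =>  [[[|e1 a1] j1]] /sr //= _; rewrite /z /= => /eqP ->.
    by [].
  - by apply/mapP; exists (0%N :: a, j) => //; rewrite mem_filter.
have [|zi] := boolP (z i); first exact: c0.
(* The terms without [x] have vanished, so the relation reads [x * T = 0]. *)
have T0 : T = 0.
  apply: (pol_domain (hpol_pol hx) hT _ x0).
  apply/eqP; rewrite -oppr_eq0 -eS; apply/eqP.
  by rewrite big_seq_cond big1 // => j /andP[rj zj]; rewrite c0 // scale0r.
pose r1 := [seq dn i | i <- r & ~~ z i].
have := IH r1 (fun i => c ((head 0%N i.1).+1 :: behead i.1, i.2)) _ _ _ _ (dn i).
rewrite {3}/dn /=; case: i ri zi => [[|[|e] a] j] ri zi //=.
apply.
- rewrite map_inj_in_uniq ?filter_uniq // => i1 i2.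
  rewrite !mem_filter => /andP[z1 /sr s1] /andP[z2 /sr s2].
  case: i1 i2 z1 z2 s1 s2 => [[|[|e1] a1] j1] [[|[|e2] a2] j2] //.
  by rewrite /z /= => _ _ _ _ [-> -> ->].
- move=> _ /mapP[i' + ->]; rewrite mem_filter => /andP[_ /sr] /=.
  by rewrite size_behead => ->.
- move=> _ /mapP[i' + ->]; rewrite mem_filter /z => /andP[zi' /hN] /=.
  by move: zi'; case: (head _ _).
- rewrite big_map big_filter -[RHS]T0; apply: eq_bigr_seq =>  [[[|[|e1] a1] j1]] /sr //=.
- by apply/mapP; exists (e.+1 :: a, j) => //; rewrite mem_filter.
Qed.

End GradedFree.

(** * Eliminating a variable, and gluing along a product of two variables *)

Section Steps.
Variables (k : closedFieldType) (G : eqType) (wt : G -> nat).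
Hypothesis wt_gt0 : forall v, (0 < wt v)%N.
Local Notation pfun := (pfun k G).
Local Notation hpol := (@hpol k G wt).
Local Notation pvar := (@pvar k G).
Local Notation gfree := (@gfree k G wt).
Local Notation homs := (@homs k G wt).
Implicit Types (W : pred G) (f g h : pfun) (s : seq pfun) (w : seq nat).

Definition wdel W v : pred G := fun u => W u && (u != v).

Lemma wdel_sub W v : {subset wdel W v <= W}.
Proof. by move=> u /andP[]. Qed.

Lemma wdelN W v : ~~ wdel W v v.
Proof. by rewrite /wdel eqxx andbF. Qed.

Lemma gmono_psub v g s w (J : Type) (b : J -> pfun) d n f :
    (forall j, psub v g (b j) = b j) ->
    lspan (gmono (map (psub v g) s) w b d n) (psub v g f) ->
  exists2 f', lspan (gmono s w b d n) f' & psub v g f' = psub v g f.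
Proof.
move=> hb; apply: lspan_img => // _ [a [j [sa wa ->]]].
exists (mexp s a * b j); last by rewrite psubM psub_mexp hb.
by exists a, j; rewrite sa size_map.
Qed.

(** Setting [v] to [g] identifies the quotient by [pvar v - g] with the polynomials in the other
    variables, where [b] already lives. *)
Lemma gbasis_var W v g s w (J : choiceType) (b : J -> pfun) d :
    W v -> hpol (wdel W v) (wt v) g -> homs W s w ->
    gbasis wt (wdel W v) (map (psub v g) s) w b d ->
  gbasis wt W (pvar v - g :: s) (wt v :: w) b d.
Proof.
move=> Wv hg hs [b1 hb sp ind].
have hgW : hpol W (wt v) g by apply: hpol_sub hg; apply: wdel_sub.
have bsub j : psub v g (b j) = b j by apply: (psub_id g (hb j)); apply: wdelN.
have hbW j : hpol W (d j) (b j) by apply: hpol_sub (hb j); apply: wdel_sub.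
have gsub : psub v g g = g by apply: (psub_id g hg); apply: wdelN.
have xsub : psub v g (pvar v - g) = 0 by rewrite psubD psub_var psubN gsub subrr.
apply: (@gbasis_step _ _ _ W) => //.
- by apply: hpolB => //; apply: hpol_var.
(* [pvar v - g] is nonzero: it becomes 1 when [g + 1] is substituted for [v]. *)
- move=> /(congr1 (fun f : pfun => psub v (g + 1) f (fun=> 0))).
  rewrite psubD psub_var psubN (psub_id _ hg) ?wdelN // => /eqP.
  by rewrite addrC addKr /= oner_eq0.
- move=> n f hf; have := hpol_psub hg _ hf; have WW u : W u -> u != v -> wdel W v u.
    by rewrite /wdel => -> ->.
  move=> /(_ WW) /sp /(gmono_psub bsub)[f' sf' ef'].
  have hf' : hpol W n f'.
    by apply: hpol_span; apply: lspan_sub sf' => y; apply: hpol_gmono.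
  have [h e hh] := hpol_div Wv hgW (hpolB hf hf').
  exists f', h; split=> //.
  by move: e; rewrite psubD psubN ef' subrr add0r => <-; rewrite addrC subrK.
- move=> r c h ur sr _ /(congr1 (psub v g)); rewrite psubM xsub mul0r psub_sum => S0.
  apply: ind => //; first by move=> i /sr; rewrite size_map.
  by rewrite -[RHS]S0; apply: eq_bigr => i _; rewrite psubZ psubM psub_mexp bsub.
Qed.

Lemma gfree_var W v g s w : W v -> hpol (wdel W v) (wt v) g -> homs W s w ->
  gfree (wdel W v) (map (psub v g) s) w -> gfree W (pvar v - g :: s) (wt v :: w).
Proof.
move=> Wv hg hs [J [b [d B]]]; exists J, b, d; exact: gbasis_var B.
Qed.

Lemma pvar_neq0 v : pvar v <> 0.
Proof. by move=> /(congr1 (fun f : pfun => f (fun=> 1)))/eqP; rewrite oner_eq0. Qed.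

(* Exactness of [0 -> S/c -> S/bc -> S/b -> 0], the first map being
   multiplication by [b], glues bases of [S/b] and [S/c] into one of [S/bc]. *)
Lemma gfree_node W b c s w : W b -> W c -> homs W s w ->
    gfree (wdel W b) (map (psub b 0) s) w -> gfree (wdel W c) (map (psub c 0) s) w ->
  gfree W (- (pvar b * pvar c) :: s) ((wt b + wt c)%N :: w).
Proof.
move=> Wb Wc hs [J1 [b1 [d1 [[j0 b1j0 d1j0] hb1 sp1 ind1]]]] [J2 [b2 [d2 [_ hb2 sp2 ind2]]]].
have hb1W j : hpol W (d1 j) (b1 j) by apply: hpol_sub (hb1 j); apply: wdel_sub.
have hb2W j : hpol W (d2 j) (b2 j) by apply: hpol_sub (hb2 j); apply: wdel_sub.
have sub1 j : psub b 0 (b1 j) = b1 j by apply: (psub_id 0 (hb1 j)); apply: wdelN.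
have sub2 j : psub c 0 (b2 j) = b2 j by apply: (psub_id 0 (hb2 j)); apply: wdelN.
have WW v u : W u -> u != v -> wdel W v u by rewrite /wdel => -> ->.
have divide v n f (J : choiceType) (e : J -> pfun) (d : J -> nat) : W v ->
    (forall j, psub v 0 (e j) = e j) -> (forall j, hpol W (d j) (e j)) ->
    (forall n f, hpol (wdel W v) n f -> lspan (gmono (map (psub v 0) s) w e d n) f) ->
    hpol W n f ->
    exists f' h, [/\ lspan (gmono s w e d n) f', f = f' + pvar v * h & hdiv wt W (wt v) n h].
  move=> Wv sub he sp hf; have := hpol_psub (@hpol0 k G wt (wdel W v) (wt v)) (@WW v) hf.
  move=> /sp /(gmono_psub sub)[f' sf' ef'].
  have hf' : hpol W n f'.
    by apply: hpol_span; apply: lspan_sub sf' => y; apply: hpol_gmono.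
  have [h eh hh] := hpol_div Wv (@hpol0 k G wt W (wt v)) (hpolB hf hf').
  exists f', h; split=> //.
  by move: eh; rewrite psubD psubN ef' subrr add0r subr0 => <-; rewrite addrC subrK.
pose e (j : J1 + J2) := match j with inl j => b1 j | inr j => pvar b * b2 j end.
pose d (j : J1 + J2) := match j with inl j => d1 j | inr j => (wt b + d2 j)%N end.
have he j : hpol W (d j) (e j).
  by case: j => j //=; apply: hpolX.
exists (J1 + J2)%type, e, d; apply: (@gbasis_step _ _ _ W) => //.
- by apply: hpolN; apply: hpolM; apply: hpol_var.
- by rewrite addn_gt0 wt_gt0.
- move/eqP; rewrite oppr_eq0 => /eqP.
  by move=> /(congr1 (fun f : pfun => f (fun=> 1)))/eqP; rewrite pfunM /pvar mulr1 oner_eq0.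
- by exists (inl j0).
- move=> n f /(divide b n f _ _ _ Wb sub1 hb1W sp1)[f1 [h [sf1 -> hh]]].
  have {}sf1 : lspan (gmono s w e d n) f1.
    by apply: lspan_sub sf1 => _ [a [j [? ? ->]]]; exists a, (inl j).
  case: hh => [->|[m nE /(divide c m h _ _ _ Wc sub2 hb2W sp2)[f2 [h2 [sf2 -> hh2]]]]].
    by exists f1, 0; split; rewrite ?mulr0 //; left.
  exists (f1 + pvar b * f2), (- h2); split.
  + apply: lspanD => //; apply: (lspan_map _ _ _ sf2); first exact: mulr0.
      by move=> a u v; rewrite mulrDr pfunZr.
    move=> _ [a [j [sa wa ->]]]; apply: lspan_gen; exists a, (inr j); split=> //=; last by ring.
    by rewrite nE -wa; lia.
  + by ring.
  + case: hh2 => [->|[m' mE hm']]; first by left; rewrite oppr0.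
    by right; exists m'; [rewrite nE mE addnA | apply: hpolN].
move=> r a h ur sr ph.
pose p (i : seq nat * (J1 + J2)) := if i.2 is inl _ then true else false.
rewrite (bigID p) /= => S0.
(* Setting [b] to 0 kills the right-hand side and the basis elements of the second kind, which are
   multiples of [pvar b]. *)
have a1 : forall i, i \in r -> p i -> a i = 0.
  move=> [x [j|//]] rj _.
  pose fL (i : seq nat * (J1 + J2)) := if i.2 is inl j then Some (i.1, j) else None.
  pose gL (i : seq nat * J1) : seq nat * (J1 + J2) := (i.1, inl i.2).
  have fgL : ocancel fL gL by case=> y [].
  have gfL : pcancel gL fL by case.
  apply: (ind1 (pmap fL r) (fun i => a (gL i)) _ _ _ (x, j)).
  - exact: (pmap_uniq fgL ur).
  - move=> [y i]; rewrite -(mem_map (pcan_inj gfL)) (pmap_filter fgL) mem_filter.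
    by move=> /andP[_ /sr]; rewrite size_map.
  - move: S0 => /(congr1 (psub b 0)); rewrite psubD !psubM psubN psubM psub_var.
    rewrite mul0r oppr0 mul0r !psub_sum [X in _ + X]big1 ?addr0 => [S0|[y [//|i]] _]; last first.
      by rewrite /e /= psubZ !psubM psub_var mul0r mulr0 scaler0.
    rewrite -[RHS]S0 -(big_map gL xpredT (fun i => a i *: (mexp (map (psub b 0) s) i.1 * e i.2))).
    rewrite (pmap_filter fgL) big_filter.
    rewrite (eq_bigl p); last by case=> y [].
    apply: eq_bigr => [[y [i|//]]] _ /=.
    by rewrite psubZ psubM psub_mexp sub1.
  - by rewrite -(mem_map (pcan_inj gfL)) (pmap_filter fgL) mem_filter.
(* What survives is [pvar b * T = 0]; after cancelling [pvar b], setting [c] to 0 leaves a relation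
   over the second basis. *)
pose T := \sum_(i <- r | ~~ p i)
   a i *: (mexp s i.1 * (if i.2 is inr j then b2 j else 0)) + pvar c * h.
have T0 : T = 0.
  apply: (@pol_domain k G wt W (pvar b) T (hpol_pol (hpol_var _ _ Wb)) _ _ (@pvar_neq0 b)).
  + apply: lspanD.
      apply: lspan_sum => [[x [//|j]] _]; apply: lspanZ; apply: polM.
        exact: hpol_pol (hpol_mexp _ hs).
      exact: hpol_pol (hb2W j).
    by apply: polM ph; apply: (@hpol_pol k G wt W (wt c)); apply: hpol_var.
  + rewrite mulrDr mulr_sumr mulrA; apply/eqP; rewrite addr_eq0 -mulNr -S0; apply/eqP.
    rewrite [X in _ = X + _]big_seq_cond [X in _ = X + _]big1 ?add0r; last first.
      by move=> i /andP[ri pi]; rewrite a1 // scale0r.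
    by apply: eq_bigr => [[x [//|j]] _] /=; rewrite pfunZr; congr (_ *: _); ring.
move=> [x [j|j]] ri; first exact: a1.
pose fR (i : seq nat * (J1 + J2)) := if i.2 is inr j then Some (i.1, j) else None.
pose gR (i : seq nat * J2) : seq nat * (J1 + J2) := (i.1, inr i.2).
have fgR : ocancel fR gR by case=> y [].
have gfR : pcancel gR fR by case.
apply: (ind2 (pmap fR r) (fun i => a (gR i)) _ _ _ (x, j)).
- exact: (pmap_uniq fgR ur).
- move=> [y i]; rewrite -(mem_map (pcan_inj gfR)) (pmap_filter fgR) mem_filter.
  by move=> /andP[_ /sr]; rewrite size_map.
- move: T0 => /(congr1 (psub c 0)); rewrite psubD psubM psub_var mul0r addr0 psub_sum => T0.
  rewrite -[RHS]T0 -(big_map gR xpredT (fun i => a i *: (mexp (map (psub c 0) s) i.1 *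
     (if i.2 is inr j then b2 j else 0)))).
  rewrite (pmap_filter fgR) big_filter.
  rewrite (eq_bigl (predC p)); last by case=> y [].
  apply: eq_bigr => [[y [//|i]]] _ /=.
  by rewrite psubZ psubM psub_mexp sub2.
- by rewrite -(mem_map (pcan_inj gfR)) (pmap_filter fgR) mem_filter.
Qed.

(** The new basis consists of the products of monomials in [s] with the old basis. Exponent vectors
    have length exactly [size s], since [mexp] ignores any excess. *)
Lemma gfree_forget W s w : homs W s w -> gfree W s w -> gfree W [::] [::].
Proof.
move=> hs [J [b [d [[j0 bj0 dj0] hb sp ind]]]].
pose K : choiceType := {x : seq nat * J | size x.1 == size s}.
exists K, (fun x : K => mexp s (val x).1 * b (val x).2).
exists (fun x : K => wdeg w (val x).1 + d (val x).2)%N.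
have sz0 : size (nseq (size s) 0%N) = size s by rewrite size_nseq.
split.
- exists (exist (fun x : seq nat * J => size x.1 == size s) (nseq (size s) 0%N, j0) (introT eqP sz0)) => /=.
    by rewrite bj0 mulr1; elim: s {hs sp ind sz0 K} => //= x s ->; rewrite expr0 mulr1.
  by rewrite dj0 addn0; elim: s w hs {sp ind sz0 K} => [|x s IH] [|e w] //= [_ /IH ->].
- by move=> x; apply: hpolM => //; apply: hpol_mexp.
- move=> n f /sp; apply: lspan_sub => _ [a [j [sa wa ->]]].
  exists [::], (exist (fun x : seq nat * J => size x.1 == size s) (a, j) (introT eqP sa)).
  by split=> //=; rewrite ?mul1r.
- move=> r c ur sr S0 [[|? ?] y] ri; last by have := sr _ ri.
  pose r' := [seq val i.2 | i <- r].
  pose c' (i : seq nat * J) := if insub i is Some x then c ([::], x) else 0.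
  have := ind r' c' _ _ _ (val y); rewrite /c' valK; apply.
  + rewrite map_inj_in_uniq // => [[a x] [a' x']] /sr/size0nil /= -> /sr/size0nil /= ->.
    by move=> /val_inj ->.
  + by move=> _ /mapP[[a x] _ ->]; apply/eqP; exact: (valP x).
  + rewrite big_map -[RHS]S0; apply: eq_bigr_seq => [[a x]] /sr/size0nil /= -> _.
    by rewrite valK mul1r.
  + by apply/mapP; exists ([::], y).
Qed.

Lemma gbasis_const W : (forall v, ~ W v) ->
  gbasis wt W [::] [::] (fun _ : unit => 1 : pfun) (fun=> 0%N).
Proof.
move=> W0.
split; [by exists tt | by move=> _; apply: hpol1 | move=> n f | move=> r c ur sr].
  elim=> {n f} [n||n f f' _ hf _ hf'|n a f _ hf|n v f Wv _ hf].
  + exact: lspan0.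
  + by apply: lspan_gen; exists [::], tt; rewrite mul1r.
  + exact: lspanD.
  + exact: lspanZ.
  + by case: (W0 v).
rewrite (eq_bigr_seq (F2 := fun i => c i *: (1 : pfun))); last first.
  by move=> [a x] /sr/size0nil /= -> _; rewrite mul1r.
rewrite -scaler_suml => /(congr1 (fun f : pfun => f (fun=> 0))); rewrite pfunZ mulr1 => S0.
have sub : {subset r <= [:: ([::], tt)]} by move=> [a []] /sr/size0nil /= ->; rewrite inE.
move=> i ri; have h : perm_eq r [:: i].
  apply: uniq_perm => // j; rewrite inE; apply/idP/eqP => [rj|-> //].
  by move: (sub _ ri) (sub _ rj); rewrite !inE => /eqP -> /eqP ->.
by move: S0; rewrite (perm_big _ h) big_seq1.
Qed.

Lemma gbasis_mono (l : seq G) : uniq l ->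
  gbasis wt [in l] (map pvar l) (map wt l) (fun _ : unit => 1 : pfun) (fun=> 0%N).
Proof.
elim: l => [_|v l IH /= /andP[vl ul]]; first by apply: gbasis_const => v.
rewrite -[pvar v]subr0; apply: gbasis_var.
- exact: mem_head.
- exact: hpol0.
- elim: l vl {IH ul} => //= u l IH; rewrite inE negb_or => /andP[_ vl]; split.
    by apply: hpol_var; rewrite !inE eqxx orbT.
  apply: homs_sub (IH vl) => x; rewrite !inE => /orP[->|->] //.
  by rewrite !orbT.
- rewrite (_ : wdel _ _ = [in l]); last first.
    apply/funext => u; rewrite /wdel inE; case: eqP => [->|] //=; last by rewrite andbT.
    by rewrite (negPf vl).
  rewrite -map_comp (_ : map _ l = map pvar l); first exact: IH.
  by apply/eq_in_map => u lu /=; rewrite psub_varN //; apply: contraNneq vl => <-.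
Qed.

(** Base of the later inductions: a homogeneous basis over [k] containing 1, obtained by adjoining
    each variable as a generator and then forgetting it. *)
Lemma gfree_nil (l : seq G) W : {subset W <= l} -> gfree W [::] [::].
Proof.
elim: l W => [|v l IH] W Wl; last first.
  have [Wv|Wv] := boolP (W v); last first.
    apply: IH => u Wu; move: (Wl _ Wu); rewrite inE => /orP[/eqP uv|//].
    by move: Wu Wv; rewrite uv unfold_in => ->.
  have Wd : gfree (wdel W v) [::] [::].
    by apply: IH => u /andP[/Wl]; rewrite inE => /orP[->|].
  apply: (@gfree_forget W [:: pvar v - 0] [:: wt v]) => /=.
    by split=> //; rewrite subr0; apply: hpol_var.
  by apply: gfree_var => //; apply: hpol0.
by exists unit, (fun=> 1), (fun=> 0%N); apply: gbasis_const => v /Wl.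
Qed.

(** Coefficient of index [m] in the product of the generating series of [b] and [c], with the sign
    it has in the determinant. *)
Definition convol (b c : nat -> G) (m : nat) : pfun :=
  - \sum_(i < m.+1) pvar (b i) * pvar (c (m - i)%N).

Lemma homs_map W (I : eqType) (l : seq I) (F : I -> pfun) (D : I -> nat) :
  (forall i, i \in l -> hpol W (D i) (F i)) -> homs W (map F l) (map D l).
Proof.
elim: l => [|i l IH] //= hF; split; first by apply: hF; rewrite mem_head.
by apply: IH => j lj; apply: hF; rewrite inE lj orbT.
Qed.

(** The first convolution is [- b_0 c_0]. Modulo [b_0], the one of index [m + 1] is the one of index
    [m] for the shifted sequence [b_1, b_2, ...] and [c]; modulo [c_0] the roles are exchanged. Both
    cases fall under the induction hypothesis and [gfree_node] glues them. The condition on [om]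
    makes the convolutions homogeneous. *)
Lemma gfree_convol n (l : seq G) W (b c : nat -> G) (om : nat -> nat) :
    {subset W <= l} ->
    (forall i, (i < n)%N -> W (b i) && W (c i)) ->
    (forall i j, (i < n)%N -> (j < n)%N -> b i = b j -> i = j) ->
    (forall i j, (i < n)%N -> (j < n)%N -> c i = c j -> i = j) ->
    (forall i j, (i < n)%N -> (j < n)%N -> b i != c j) ->
    (forall i j, (i + j < n)%N -> (wt (b i) + wt (c j))%N = om (i + j)%N) ->
  gfree W (map (convol b c) (iota 0 n)) (map om (iota 0 n)).
Proof.
elim: n W b c om => [|n IH] W b c om Wl Wbc ib ic bc hom; first exact: gfree_nil Wl.
have /andP[Wb Wc] := Wbc 0%N isT.
rewrite /= (iotaDl 1 0 n) -!map_comp.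
have -> : convol b c 0 = - (pvar (b 0%N) * pvar (c 0%N)).
  by rewrite /convol big_ord_recl big_ord0 addr0.
rewrite -(hom 0%N 0%N) //; apply: gfree_node => //.
- apply: homs_map => m; rewrite mem_iota /= => mn; apply: hpolN.
  elim/big_ind: _ => [||i _]; [exact: hpol0 | exact: hpolD|].
  have -> : om (1 + m)%N = (wt (b i) + wt (c (1 + m - i)%N))%N.
    by have im := ltn_ord i; rewrite hom; [congr om|]; lia.
  have im := ltn_ord i.
  have /andP[? _] := Wbc i ltac:(lia); have /andP[_ ?] := Wbc (1 + m - i)%N ltac:(lia).
  by apply: hpolM; apply: hpol_var.
- rewrite -map_comp.
  have -> : map (psub (b 0%N) 0 \o (convol b c \o addn 1)) (iota 0 n) =
            map (convol (fun i => b i.+1) c) (iota 0 n).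
    apply/eq_in_map => m; rewrite mem_iota /= => mn.
    rewrite /convol psubN psub_sum big_ord_recl psubM psub_var mul0r add0r; congr (- _).
    apply: eq_bigr => i _; have im := ltn_ord i; rewrite psubM !psub_varN //; last first.
    - by apply/eqP => /ib; rewrite lift0; lia.
    - by rewrite eq_sym; apply: bc; lia.
  apply: (IH _ _ _ (om \o addn 1)).
  + by move=> u /andP[/Wl].
  + move=> i i_n; have /andP[Wi _] := Wbc i.+1 i_n; have /andP[_ Wi'] := Wbc i (ltnW i_n).
    rewrite /wdel Wi Wi' /=; apply/andP; split; first by apply/eqP => /ib; lia.
    by rewrite eq_sym; apply: bc; lia.
  + by move=> i j ? ? /ib; lia.
  + by move=> i j ? ? /ic; lia.
  + by move=> i j ? ?; apply: bc; lia.
  + by move=> i j ij; rewrite hom //=; congr om; lia.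
- rewrite -map_comp.
  have -> : map (psub (c 0%N) 0 \o (convol b c \o addn 1)) (iota 0 n) =
            map (convol b (fun i => c i.+1)) (iota 0 n).
    apply/eq_in_map => m; rewrite mem_iota /= => mn.
    rewrite /convol psubN psub_sum big_ord_recr /= psubM.
    rewrite add1n subnn psub_var mulr0 addr0; congr (- _).
    apply: eq_bigr => i _; have im := ltn_ord i; rewrite psubM !psub_varN ?subSn //=; last first.
    - by apply: bc; lia.
    - by apply/eqP => /ic; lia.
  apply: (IH _ _ _ (om \o addn 1)).
  + by move=> u /andP[/Wl].
  + move=> i i_n; have /andP[_ Wi] := Wbc i.+1 i_n; have /andP[Wi' _] := Wbc i (ltnW i_n).
    rewrite /wdel Wi Wi' /=; apply/andP; split; first by apply: bc; lia.
    by apply/eqP => /ic; lia.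
  + by move=> i j ? ? /ib; lia.
  + by move=> i j ? ? /ic; lia.
  + by move=> i j ? ?; apply: bc; lia.
  + by move=> i j ij; rewrite hom /=; [congr om|]; lia.
Qed.

End Steps.

(** * Symbols in a filtered algebra *)

Section Symbols.
Variables (k : closedFieldType) (G : finType) (wt : G -> nat).
Hypothesis wt_gt0 : forall v, (0 < wt v)%N.
Variables (A : algType k) (t : G -> A).
Local Notation pfun := (pfun k G).
Local Notation hpol := (@hpol k G wt).
Local Notation pvar := (@pvar k G).

(* [sym n y f]: [y] lies in degree [<= n] of the filtration in which the
   generator [t g] has degree [wt g], with symbol of degree [n] equal to [f]. *)
Inductive sym : nat -> A -> pfun -> Prop :=
| sym0 n : sym n 0 0
| sym1 : sym 0 1 1
| symD n y z f g : sym n y f -> sym n z g -> sym n (y + z) (f + g)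
| symZ n a y f : sym n y f -> sym n (a *: y) (a *: f)
| symX n v y f : sym n y f -> sym (wt v + n) (t v * y) (pvar v * f)
| symW n y f : sym n y f -> sym n.+1 y 0.

(** Degree strictly below [n]; the filtration is zero in negative degrees. *)
Definition low n y := if n is m.+1 then exists f, sym m y f else y = 0.

Lemma sym_low n y : low n y -> sym n y 0.
Proof. by case: n => [->|n [f]]; [apply: sym0 | apply: symW]. Qed.

Lemma low0 n : low n 0.
Proof. by case: n => //= n; exists 0; apply: sym0. Qed.

Lemma lowD n y z : low n y -> low n z -> low n (y + z).
Proof.
case: n => /= [-> ->|n [f hf] [g hg]]; first by rewrite addr0.
by exists (f + g); apply: symD.
Qed.

Lemma lowZ n a y : low n y -> low n (a *: y).
Proof.
case: n => /= [->|n [f hf]]; first by rewrite scaler0.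
by exists (a *: f); apply: symZ.
Qed.

Lemma symN n y f : sym n y f -> sym n (- y) (- f).
Proof. by rewrite -scaleN1r -[- f]scaleN1r; apply: symZ. Qed.

Lemma symB n y z f g : sym n y f -> sym n z g -> sym n (y - z) (f - g).
Proof. by move=> hy /symN; apply: symD. Qed.

Lemma sym_sum n (I : Type) (r : seq I) (p : pred I) (y : I -> A) (f : I -> pfun) :
    (forall i, p i -> sym n (y i) (f i)) ->
  sym n (\sum_(i <- r | p i) y i) (\sum_(i <- r | p i) f i).
Proof.
move=> h; elim/big_ind2: _ => [|? ? ? ?|i pi]; [exact: sym0 | exact: symD | exact: h].
Qed.

Lemma sym_hpol n y f : sym n y f -> hpol predT n f.
Proof.
elim=> {n y f} [n||n y z f g _ hf _ hg|n a y f _ hf|n v y f _ hf|n y f _ _].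
- exact: hpol0.
- exact: hpol1.
- exact: hpolD.
- exact: hpolZ.
- exact: hpolX.
- exact: hpol0.
Qed.

Lemma symM n m y z f g : sym n y f -> sym m z g -> sym (n + m) (y * z) (f * g).
Proof.
move=> hy hz; elim: hy => {n y f} [n||n y y' f f' _ hf _ hf'|n a y f _ hf|n v y f _ hf|n y f _ hf].
- by rewrite !mul0r; apply: sym0.
- by rewrite !mul1r.
- by rewrite !mulrDl; apply: symD.
- by rewrite -scalerAl pfunZl; apply: symZ.
- by rewrite -!mulrA -addnA; apply: symX.
- by rewrite mul0r addSn; apply: symW hf.
Qed.

Lemma sym_raise n m y f : sym n y f -> sym (n + m.+1) y 0.
Proof.
elim: m f => [|m IH] f hy; first by rewrite addn1; apply: symW hy.
by rewrite addnS; apply: symW (IH _ hy).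
Qed.

Lemma low_lt n m y f : (n < m)%N -> sym n y f -> low m y.
Proof.
case: m => // m; rewrite ltnS leq_eqVlt => /orP[/eqP<-|nm] hy; first by exists f.
exists 0; have -> : m = (n + (m - n).-1.+1)%N by lia.
exact: sym_raise hy.
Qed.

Lemma lowMl n m y z f : low n y -> sym m z f -> low (n + m) (y * z).
Proof.
case: n => /= [->|n [g hg]] hz; first by rewrite mul0r; apply: low0.
by exists (g * f); apply: symM.
Qed.

Lemma lowMr n m y z f : low n y -> sym m z f -> low (m + n) (z * y).
Proof.
case: n => /= [->|n [g hg]] hz; first by rewrite mulr0; apply: low0.
by rewrite addnS; exists (f * g); apply: symM.
Qed.

Lemma sym_gen v : sym (wt v) (t v) (pvar v).
Proof. by rewrite -[t v]mulr1 -[pvar v]mulr1 -[wt v]addn0; apply/symX/sym1. Qed.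

Lemma sym_exp n i y f : sym n y f -> sym (i * n) (y ^+ i) (f ^+ i).
Proof.
move=> hf; elim: i => [|i IH]; first by rewrite mul0n !expr0; apply: sym1.
by rewrite mulSn !exprS; apply: symM.
Qed.

Lemma hpol_sym W n f : hpol W n f -> exists y, sym n y f.
Proof.
elim=> {n f} [n||n f f' _ [y hy] _ [y' hy']|n a f _ [y hy]|n v f Wv _ [y hy]].
- by exists 0; apply: sym0.
- by exists 1; apply: sym1.
- by exists (y + y'); apply: symD.
- by exists (a *: y); apply: symZ.
- by exists (t v * y); apply: symX.
Qed.

Hypothesis comm_low : forall u v, low (wt u + wt v) (t u * t v - t v * t u).

Lemma low_comm_gen u n y f : sym n y f -> low (wt u + n) (t u * y - y * t u).
Proof.
elim=> {n y f} [n||n y z f g _ hf _ hg|n a y f _ hf|n v y f hy hf|n y f hy hf].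
- by rewrite mulr0 mul0r subrr; apply: low0.
- by rewrite mulr1 mul1r subrr; apply: low0.
- have -> : t u * (y + z) - (y + z) * t u = (t u * y - y * t u) + (t u * z - z * t u).
    by rewrite mulrDr mulrDl opprD addrACA.
  exact: lowD.
- by rewrite -scalerAl -scalerAr -scalerBr; apply: lowZ.
- have -> : t u * (t v * y) - t v * y * t u =
            (t u * t v - t v * t u) * y + t v * (t u * y - y * t u).
    by rewrite mulrBl mulrBr !mulrA addrA subrK.
  apply: lowD; first by rewrite addnA; apply: lowMl (comm_low _ _) hy.
  by rewrite addnCA; apply: lowMr hf (sym_gen _).
- by rewrite addnS; exists 0; apply: sym_low.
Qed.

Lemma incr_mexp (R : comPzRingType) (x : G -> R) (l : seq G) u (a : seq nat) :
    u \in l -> size a = size l ->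
  x u * mexp (map x l) a = mexp (map x l) (incr_nth a (index u l)).
Proof.
elim: l a => //= v l IH [|i a] //=; rewrite inE => ul [sa].
have [->|vu] := eqVneq v u; first by rewrite /= exprS mulrA.
rewrite /= -IH //; first by rewrite mulrCA.
by move: ul; rewrite eq_sym (negPf vu).
Qed.

Lemma incr_wdeg (l : seq G) u (a : seq nat) :
    u \in l -> size a = size l ->
  (wt u + wdeg (map wt l) a = wdeg (map wt l) (incr_nth a (index u l)))%N.
Proof.
elim: l a => //= v l IH [|i a] //=; rewrite inE => ul [sa].
have [->|vu] := eqVneq v u; first by rewrite /= mulSn addnA.
rewrite /= -IH //; first by rewrite addnCA.
by move: ul; rewrite eq_sym (negPf vu).
Qed.

Fixpoint syms (s : seq A) (q : seq pfun) (w : seq nat) : Prop :=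
  match s, q, w with
  | x :: s', f :: q', d :: w' => sym d x f /\ syms s' q' w'
  | [::], [::], [::] => True
  | _, _, _ => False
  end.

Lemma syms_cat s1 q1 w1 s2 q2 w2 :
  syms s1 q1 w1 -> syms s2 q2 w2 -> syms (s1 ++ s2) (q1 ++ q2) (w1 ++ w2).
Proof.
elim: s1 q1 w1 => [|x s1 IH] [|f q1] [|d w1] //= [hx h1] h2.
by split=> //; apply: IH.
Qed.

Lemma syms_map (I : eqType) (l : seq I) (x : I -> A) (f : I -> pfun) (d : I -> nat) :
  (forall i, i \in l -> sym (d i) (x i) (f i)) -> syms (map x l) (map f l) (map d l).
Proof.
elim: l => [|i l IH] //= h; split; first by apply: h; rewrite mem_head.
by apply: IH => j lj; apply: h; rewrite inE lj orbT.
Qed.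

Lemma sym_mexp (s : seq A) (q : seq pfun) (w a : seq nat) :
  syms s q w -> sym (wdeg w a) (mexp s a) (mexp q a).
Proof.
elim: s q w a => [|x s IH] [|f q] [|d w] [|i a] //=; try by move=> _; apply: sym1.
by move=> [hx hs]; apply: symM; [apply: sym_exp | apply: IH].
Qed.

Lemma sym_mono (l : seq G) a :
  sym (wdeg (map wt l) a) (mexp (map t l) a) (mexp (map pvar l) a).
Proof. by apply: sym_mexp; apply: syms_map => v _; apply: sym_gen. Qed.

(** Straightening: [t u] is carried past the powers of the generators that precede it, each exchange
    costing only terms of lower degree. *)
Lemma low_incr (l : seq G) u (a : seq nat) : u \in l -> size a = size l ->
  low (wt u + wdeg (map wt l) a)
    (t u * mexp (map t l) a - mexp (map t l) (incr_nth a (index u l))).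
Proof.
elim: l a => //= v l IH [|i a] //=; rewrite inE => ul [sa].
have [->|vu] := eqVneq v u; first by rewrite /= exprS mulrA subrr; apply: low0.
have {}ul : u \in l by move: ul; rewrite eq_sym (negPf vu).
rewrite /=; set M := mexp _ _; set M' := mexp _ _.
have -> : t u * (t v ^+ i * M) - t v ^+ i * M' =
   (t u * t v ^+ i - t v ^+ i * t u) * M + t v ^+ i * (t u * M - M').
  by rewrite mulrBl mulrBr !mulrA addrA subrK.
apply: lowD.
  rewrite addnA; apply: lowMl (sym_mono _ _).
  exact: low_comm_gen (sym_exp _ (sym_gen _)).
by rewrite addnCA; apply: lowMr (IH _ ul sa) (sym_exp _ (sym_gen _)).
Qed.

(** An ordered monomial paired with its symbol, so that one linear combination has the same
    coefficients in [A] and among the symbols. *)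
Definition ordmono n (z : A * pfun) : Prop :=
  exists2 a, size a = #|G| /\ wdeg (map wt (enum G)) a = n &
    z = (mexp (map t (enum G)) a, mexp (map pvar (enum G)) a).

Lemma ordmono_gen n v zf : lspan (ordmono n) zf ->
  exists2 z, lspan (ordmono (wt v + n)) (z, pvar v * zf.2) & low (wt v + n) (t v * zf.1 - z).
Proof.
elim=> {zf} [|a _ [z f] [e [se we] ->] _ [z' sz' lz']].
  by exists 0; rewrite /= ?mulr0 ?subrr; [apply: lspan0 | apply: low0].
pose e' := incr_nth e (index v (enum G)).
have vG : v \in enum G by rewrite mem_enum.
have se' : size e = size (enum G) by rewrite -cardE.
have se2 : size e' = #|G|.
  by rewrite size_incr_nth se cardE index_mem vG.
exists (a *: mexp (map t (enum G)) e' + z') => /=.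
  rewrite mulrDr pfunZr incr_mexp //.
  apply: (@lspanC _ _ _ a (_, _) (_, _)) sz'; exists e' => //; split=> //.
  by rewrite -incr_wdeg // we.
rewrite mulrDr opprD addrACA; apply: lowD => //.
by rewrite -scalerAr -scalerBr; apply: lowZ; rewrite -we; apply: low_incr.
Qed.

Lemma sym_normal n y f : sym n y f ->
  exists2 z, lspan (ordmono n) (z, f) & low n (y - z).
Proof.
elim=> {n y f} [n||n y y' f f' _ [z sz lz] _ [z' sz' lz']|n a y f _ [z sz lz]|n v y f hy [z sz lz]|n y f hy _].
- by exists 0; [apply: lspan0 | rewrite subrr; apply: low0].
- exists 1; last by rewrite subrr; apply: low0.
  apply: lspan_gen; exists (nseq #|G| 0%N); first rewrite size_nseq; first split=> //.
    by rewrite cardE; elim: (enum G) => //= ? ? ->.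
  rewrite cardE; congr (_, _).
    by elim: (enum G) => //= u l <-; rewrite expr0 mulr1.
  by elim: (enum G) => //= u l <-; rewrite expr0 mulr1.
- by exists (z + z'); [apply: (lspanD sz sz') | rewrite opprD addrACA; apply: lowD].
- by exists (a *: z); [apply: (lspanZ a sz) | rewrite -scalerBr; apply: lowZ].
- have [z' sz' lz'] := ordmono_gen v sz.
  exists z' => //; have -> : t v * y - z' = t v * (y - z) + (t v * z - z').
    by rewrite mulrBr addrA subrK.
  by apply: lowD => //; apply: lowMr lz (sym_gen _).
- by exists 0; [apply: lspan0 | rewrite subr0; exists f].
Qed.

(* The associated graded algebra is the polynomial algebra: an element with
   zero symbol has smaller degree. *)
Lemma sym_eq0 n y : sym n y 0 -> low n y.
Proof.
move=> /sym_normal[z sz]; suff -> : z = 0 by rewrite subr0.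
pose P (a : seq nat) := size a = #|G| /\ wdeg (map wt (enum G)) a = n.
pose e a : A * pfun := (mexp (map t (enum G)) a, mexp (map pvar (enum G)) a).
have [s [c [us sP zE]]] := @lspan_uniq _ _ _ e P (z, 0) sz.
have [_ _ _ ind] := gbasis_mono k wt_gt0 (enum_uniq G).
(* The second components form a vanishing combination of commutative monomials, which are
   independent; the first components have the same coefficients. *)
have c0 a : a \in s -> c a = 0.
  move=> sa; apply: (ind [seq (a, tt) | a <- s] (fun i => c i.1) _ _ _ (a, tt)).
  - by rewrite map_inj_uniq // => a1 a2 [].
  - by move=> _ /mapP[b /sP[sb _] ->]; rewrite size_map /= sb cardE.
  - rewrite big_map; have := congr1 snd zE; rewrite raddf_sum /= => E.
    by rewrite [RHS]E; apply: eq_bigr => i _; rewrite mulr1.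
  - by rewrite mem_map // => a1 a2 [].
have -> : z = (\sum_(i <- s) c i *: e i).1 by rewrite -zE.
by rewrite big_seq big1 // => i /c0 ->; rewrite scale0r.
Qed.

Hypothesis gen : forall y, exists n f, sym n y f.

(** Subtracting a combination of the [e i] with the same symbol leaves an element of lower degree,
    by [sym_eq0]. *)
Lemma sym_span (I : Type) (P : I -> Prop) (e : I -> A) (q : I -> pfun) (d : I -> nat) :
    (forall i, P i -> sym (d i) (e i) (q i)) ->
    (forall n f, hpol predT n f -> lspan (fun x => exists2 i, P i /\ d i = n & x = q i) f) ->
  forall y, lspan (fun x => exists2 i, P i & x = e i) y.
Proof.
move=> he sp y; have [n [f]] := gen y; elim/ltn_ind: n y f => n IH y f hy.
have [z sz] : exists2 z, lspan (fun x => exists2 i, P i & x = e i) z & sym n z f.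
  elim: (sp n f (sym_hpol hy)) => [|a _ g [i [Pi di] ->] _ [z sz hz]].
    by exists 0; [apply: lspan0 | apply: sym0].
  exists (a *: e i + z); first by apply: lspanC => //; exists i.
  by apply: symD => //; apply: symZ; rewrite -di; apply: he.
move=> hz; have := symB hy hz; rewrite subrr => /sym_eq0 lyz.
rewrite -[y](subrK z); apply: lspanD => //.
case: n lyz IH {hy hz} => [-> _|n [g hg] IH]; first exact: lspan0.
exact: IH hg.
Qed.

Hypothesis pbw : forall n f, sym n 0 f -> f = 0.

(** In the largest degree that carries a nonzero coefficient the relation passes to the symbols,
    where [pbw] forces the symbol of 0 to vanish. *)
Lemma sym_indep (I : eqType) (P : I -> Prop) (e : I -> A) (q : I -> pfun) (d : I -> nat) :
    (forall i, P i -> sym (d i) (e i) (q i)) ->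
    (forall (r : seq I) (c : I -> k), uniq r -> (forall i, i \in r -> P i) ->
       \sum_(i <- r) c i *: q i = 0 -> forall i, i \in r -> c i = 0) ->
  forall (r : seq I) (c : I -> k), uniq r -> (forall i, i \in r -> P i) ->
    \sum_(i <- r) c i *: e i = 0 -> forall i, i \in r -> c i = 0.
Proof.
move=> he ind r c ur rP S0; suff: forall N, (forall i, i \in r -> c i != 0 -> (d i < N)%N) ->
    forall i, i \in r -> c i = 0.
  move=> /(_ (\max_(i <- r) d i).+1); apply => i ri _.
  by rewrite ltnS; apply: (@leq_bigmax_seq _ _ xpredT d).
elim=> [|N IH] hN; first by move=> i ri; apply: contrapT => /eqP /(hN _ ri).
apply: IH => i ri ci; have := hN i ri ci; rewrite ltnS leq_eqVlt => /orP[/eqP di|//].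
suff c0 : c i = 0 by rewrite c0 eqxx in ci.
apply: (ind [seq j <- r | d j == N] c) => //.
- exact: filter_uniq.
- by move=> j; rewrite mem_filter => /andP[_ /rP].
- rewrite big_filter; apply: (pbw (n := N)); rewrite -[X in sym _ X _]S0.
  rewrite (bigID (fun j => d j == N)) /= -[X in sym _ _ X]addr0; apply: symD.
    rewrite big_seq_cond [X in sym _ _ X]big_seq_cond; apply: sym_sum => j /andP[/rP Pj /eqP <-].
    exact: symZ (he j Pj).
  rewrite big_seq_cond [X in sym _ _ X](_ : _ = \sum_(i <- r | (i \in r) && (d i != N)) (0 : pfun)); last first.
    by rewrite big1.
  apply: sym_sum => j /andP[rj dj]; have [->|cj] := eqVneq (c j) 0.
    by rewrite scale0r; apply: sym0.
  apply: sym_low; apply: lowZ; apply: low_lt (he j (rP j rj)).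
  by have := hN j rj cj; rewrite ltnS leq_eqVlt (negPf dj).
- by rewrite mem_filter di eqxx.
Qed.

End Symbols.

(** * Presented algebras *)

Section Words.
Variables (X : choiceType) (R : nzRingType) (h : X -> R).

Definition word_val (m : {fmonom X}) : R := \prod_(x <- (m : seq X)) h x.

Fact word_val_mmorphism : mmorphism word_val.
Proof.
split=> [m1 m2|]; first by rewrite /word_val fmM big_cat.
by rewrite /word_val fm1 big_nil.
Qed.
HB.instance Definition _ := isMultiplicative.Build _ _ word_val word_val_mmorphism.

End Words.

Section PresentedMap.
Variables (k : comNzRingType) (X : choiceType) (S : set {free k[X]}).
Local Notation pi := (presented_pi S).

Lemma presented_piZ a x : pi (a *: x) = a *: pi x.
Proof. exact/esym/presented_scaleE. Qed.

(** Words arise from 1 by left multiplication with generators, so no closure under general products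
    is asked of [P]. *)
Lemma presented_ind (P : presented S -> Prop) : P 0 -> P 1 ->
    (forall x y, P x -> P y -> P (x + y)) -> (forall a x, P x -> P (a *: x)) ->
    (forall g x, P x -> P (pi << fmu g >> * x)) ->
  forall x, P x.
Proof.
move=> P0 P1 PD PZ PX x; have [F ->] := presented_repr x.
rewrite [F]monalgE raddf_sum; elim/big_ind: _ => //= m _.
have -> : << F@_m *g m >> = F@_m *: << m >> :> {free k[X]}.
  by apply/malgP => m'; rewrite mcoeffZ mcoeffU mcoeffU1 mulrnAr mulr1.
rewrite presented_piZ; apply: PZ; case: m => s.
elim: s => [|g s IH].
  by rewrite (_ : FMonom [::] = mone) ?[pi _]/(1 : presented S) // [RHS]fmoneE.
have -> : << FMonom (g :: s) >> = << fmu g >> * << FMonom s >> :> {free k[X]}.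
  rewrite malgM_def fgmulUU mulr1; congr << _ >>.
  by rewrite /mmul /= fmmulE fmuE.
by rewrite rmorphM; apply: PX.
Qed.

Variables (A : algType k) (h : X -> A).

Definition free_map : {free k[X]} -> A := mmap (in_alg A) (word_val h).

Lemma free_mapB : {morph free_map : x y / x - y}.
Proof. exact: raddfB. Qed.

Lemma free_mapD : {morph free_map : x y / x + y}.
Proof. exact: raddfD. Qed.

Lemma free_mapM : {morph free_map : x y / x * y}.
Proof.
have [] := @commr_mmap_is_multiplicative _ _ _ (in_alg A) (word_val h) => //.
by move=> g m m'; rewrite /GRing.comm mulr_algl mulr_algr.
Qed.

Lemma free_map1 : free_map 1 = 1.
Proof. exact: mmap1. Qed.

Lemma free_mapZ a x : free_map (a *: x) = a *: free_map x.
Proof. by rewrite /free_map mmapZ mulr_algl. Qed.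

Lemma free_map_gen g : free_map << fmu g >> = h g.
Proof. by rewrite /free_map mmapU /= scale1r mul1r /word_val fmU big_seq1. Qed.

Hypothesis relS : forall s, S s -> free_map s = 0.

Lemma free_map_ideal x : x \in ideal_gen S -> free_map x = 0.
Proof.
move=> /asboolP /(_ [pred x | free_map x == 0]) H; apply/eqP; apply: H.
  split; first split=> [|u v]; rewrite ?inE /=; first by apply/eqP; exact: raddf0.
    by move=> /eqP u0 /eqP v0; rewrite free_mapB u0 v0 subrr.
  by move=> a b u; rewrite !inE /= => /eqP u0; rewrite !free_mapM u0 mulr0 mul0r.
by move=> s Ss; rewrite inE /= relS.
Qed.

Definition presented_map (x : presented S) : A := free_map (repr x).

Lemma presented_mapE x : presented_map (pi x) = free_map x.
Proof.
by apply/eqP; rewrite -subr_eq0 -free_mapB free_map_ideal // presented_piK.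
Qed.

Lemma presented_mapD : {morph presented_map : x y / x + y}.
Proof.
move=> x y; have [x' ->] := presented_repr x; have [y' ->] := presented_repr y.
by rewrite -raddfD !presented_mapE free_mapD.
Qed.

Lemma presented_mapM : {morph presented_map : x y / x * y}.
Proof.
move=> x y; have [x' ->] := presented_repr x; have [y' ->] := presented_repr y.
by rewrite -rmorphM !presented_mapE free_mapM.
Qed.

Lemma presented_map1 : presented_map 1 = 1.
Proof. by rewrite -[1](rmorph1 pi) presented_mapE free_map1. Qed.

Lemma presented_mapZ a x : presented_map (a *: x) = a *: presented_map x.
Proof.
by have [x' ->] := presented_repr x; rewrite -presented_piZ !presented_mapE free_mapZ.
Qed.

End PresentedMap.

(** * Linear operators on polynomial-valued functions *)

Section Endomorphisms.
Variables (k : closedFieldType).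

(** The coordinate [c m] is the one moved by the operators of the [m]-th linear factor; the values
    are polynomials so that ['X] can record the degree of an operator. *)
Definition lattice_fun : Type := (nat -> k) -> {poly k}.
HB.instance Definition _ := GRing.Lmodule.on lattice_fun.

Implicit Types (f : lattice_fun).

Record endo : Type := Endo {
  efun :> lattice_fun -> lattice_fun;
  _ : forall a f g, efun (a *: f + g) = a *: efun f + efun g }.

HB.instance Definition _ := gen_eqMixin endo.
HB.instance Definition _ := gen_choiceMixin endo.

Lemma endo_lin (o : endo) a f g : o (a *: f + g) = a *: o f + o g.
Proof. by case: o. Qed.

Lemma endo_add (o : endo) f g : o (f + g) = o f + o g.
Proof. by rewrite -[f]scale1r endo_lin !scale1r. Qed.

Lemma endo_0 (o : endo) : o 0 = 0.
Proof. by apply: (addIr (o 0)); rewrite -endo_add !add0r. Qed.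

Lemma endo_scale (o : endo) a f : o (a *: f) = a *: o f.
Proof. by rewrite -[a *: f]addr0 endo_lin endo_0 addr0. Qed.

Lemma endoP (o p : endo) : (forall f, o f = p f) -> o = p.
Proof.
case: o p => [o ho] [p hp] /= /funext op; rewrite {}op in ho *.
by rewrite (Prop_irrelevance ho hp).
Qed.

Program Definition endo_zero := @Endo (fun=> 0) _.
Next Obligation. by rewrite scaler0 addr0. Qed.
Program Definition endo_opp (o : endo) := @Endo (fun f => - o f) _.
Next Obligation. by rewrite endo_lin opprD scalerN. Qed.
Program Definition endo_plus (o p : endo) := @Endo (fun f => o f + p f) _.
Next Obligation. by rewrite !endo_lin scalerDr addrACA. Qed.
Program Definition endo_one := @Endo (fun f => f) _.
Program Definition endo_mul (o p : endo) := @Endo (fun f => o (p f)) _.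
Next Obligation. by rewrite !endo_lin. Qed.
Program Definition endo_scal a (o : endo) := @Endo (fun f => a *: o f) _.
Next Obligation. by rewrite endo_lin scalerDr !scalerA [a * _]mulrC. Qed.

Fact endo_plusA : associative endo_plus.
Proof. by move=> o p q; apply: endoP => f /=; rewrite addrA. Qed.
Fact endo_plusC : commutative endo_plus.
Proof. by move=> o p; apply: endoP => f /=; rewrite addrC. Qed.
Fact endo_plus0 : left_id endo_zero endo_plus.
Proof. by move=> o; apply: endoP => f /=; rewrite add0r. Qed.
Fact endo_plusN : left_inverse endo_zero endo_opp endo_plus.
Proof. by move=> o; apply: endoP => f /=; rewrite addNr. Qed.
HB.instance Definition _ := GRing.isZmodule.Build endo
  endo_plusA endo_plusC endo_plus0 endo_plusN.

Fact endo_mulA : associative endo_mul.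
Proof. by move=> o p q; apply: endoP. Qed.
Fact endo_mul1 : left_id endo_one endo_mul.
Proof. by move=> o; apply: endoP. Qed.
Fact endo_mulr1 : right_id endo_one endo_mul.
Proof. by move=> o; apply: endoP. Qed.
Fact endo_mulDl : left_distributive endo_mul +%R.
Proof. by move=> o p q; apply: endoP. Qed.
Fact endo_mulDr : right_distributive endo_mul +%R.
Proof. by move=> o p q; apply: endoP => f; rewrite /= endo_add. Qed.
Fact endo_1neq0 : endo_one != 0 :> endo.
Proof.
apply/eqP => /(congr1 (fun o : endo => o (fun=> 1) (fun=> 0))) /eqP.
by rewrite /= oner_eq0.
Qed.
HB.instance Definition _ := GRing.Zmodule_isNzRing.Build endo
  endo_mulA endo_mul1 endo_mulr1 endo_mulDl endo_mulDr endo_1neq0.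

Fact endo_scalA a b o : endo_scal a (endo_scal b o) = endo_scal (a * b) o.
Proof. by apply: endoP => f; rewrite /= scalerA. Qed.
Fact endo_scal1 : left_id 1 endo_scal.
Proof. by move=> o; apply: endoP => f; rewrite /= scale1r. Qed.
Fact endo_scalDr : right_distributive endo_scal +%R.
Proof. by move=> a o p; apply: endoP => f; rewrite /= scalerDr. Qed.
Fact endo_scalDl o : {morph endo_scal^~ o : a b / a + b}.
Proof. by move=> a b; apply: endoP => f; rewrite /= scalerDl. Qed.
HB.instance Definition _ := GRing.Zmodule_isLmodule.Build k endo
  endo_scalA endo_scal1 endo_scalDr endo_scalDl.

Fact endo_scalAl a (o p : endo) : a *: (o * p) = (a *: o) * p.
Proof. by apply: endoP. Qed.
HB.instance Definition _ := GRing.Lmodule_isLalgebra.Build k endo endo_scalAl.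
Fact endo_scalAr a (o p : endo) : a *: (o * p) = o * (a *: p).
Proof. by apply: endoP => f; rewrite /= -endo_scale. Qed.
HB.instance Definition _ := GRing.Lalgebra_isAlgebra.Build k endo endo_scalAr.

Lemma endoM (o p : endo) f : (o * p) f = o (p f). Proof. by []. Qed.
Lemma endoD (o p : endo) f : (o + p) f = o f + p f. Proof. by []. Qed.
Lemma endoN (o : endo) f : (- o) f = - o f. Proof. by []. Qed.
Lemma endoZ a (o : endo) f : (a *: o) f = a *: o f. Proof. by []. Qed.

End Endomorphisms.

(** * The RTT relation *)

(** Replacing [u] by [z * u] and subtracting [z ^+ n] times the original relation removes the top
    term. With [z != 0] and [z ^+ i != z ^+ n] for [i < n], the other coefficients are only rescaled
    by nonzero scalars. *)
Lemma poly_coef_eq0 (k : closedFieldType) (V : lmodType k) n (a : nat -> V) :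
    (forall u : k, u != 0 -> \sum_(i < n) u ^+ i *: a i = 0) ->
  forall i, (i < n)%N -> a i = 0.
Proof.
elim: n a => // n IH a h.
have qN0 : 'X * \prod_(i < n) ('X^n - 'X^i) != 0 :> {poly k}.
  rewrite mulf_neq0 ?polyX_eq0 //; apply/prodf_neq0 => i _; apply/eqP.
  move=> /(congr1 (fun q : {poly k} => q`_n)); rewrite coefB !coefXn eqxx coef0.
  by rewrite eq_sym (ltn_eqF (ltn_ord i)) subr0 => /eqP; rewrite oner_eq0.
have /closed_nonrootP[z] := qN0; rewrite /root hornerM hornerX horner_prod mulf_eq0 negb_or.
move=> /andP[z0 /prodf_neq0 zn].
have ai i : (i < n)%N -> a i = 0.
  move=> lin; have := IH (fun i => (z ^+ i - z ^+ n) *: a i) _ i lin.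
  have := zn (Ordinal lin) isT; rewrite !hornerE /= => zi.
  move=> H; have {}H : (z ^+ i - z ^+ n) *: a i = 0.
    apply: H => u u0; have := h (z * u) (mulf_neq0 z0 u0); have := h u u0.
    rewrite !big_ord_recr /= => /eqP; rewrite addr_eq0 => /eqP S0 /eqP.
    rewrite addr_eq0 => /eqP S1.
    rewrite (eq_bigr (fun i : 'I_n => (z * u) ^+ i *: a i - z ^+ n *: (u ^+ i *: a i))).
      by rewrite sumrB -scaler_sumr S0 S1 exprMn scalerN scalerA subrr.
    by move=> j _; rewrite scalerBl scalerBr exprMn !scalerA mulrC [u ^+ j * z ^+ n]mulrC.
  by apply: (scalerI (a := z ^+ i - z ^+ n)); rewrite ?scaler0 // -opprB oppr_eq0.
move=> i; rewrite ltnS leq_eqVlt => /orP[/eqP ->|]; last exact: ai.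
have := h 1 (oner_neq0 _); rewrite big_ord_recr /= expr1n scale1r big1 ?add0r //.
by move=> j _; rewrite ai ?scaler0.
Qed.

Lemma shift_coef (k : closedFieldType) (V : lmodType k) N (X Y : nat -> V) :
    (forall u : k, u != 0 -> \sum_(r < N) u ^+ r *: X r = \sum_(r < N) u ^+ r.+1 *: Y r) ->
  forall r, (r.+1 < N)%N -> X r.+1 = Y r.
Proof.
move=> h r rN; pose a r := (if (r < N)%N then X r else 0) - (if r is r'.+1 then Y r' else 0).
have := @poly_coef_eq0 _ _ N.+1 a _ r.+1 (ltnW rN).
rewrite /a rN => H; apply/eqP; rewrite -subr_eq0; apply/eqP/H => u u0 {H}.
rewrite (eq_bigr _ (fun i _ => scalerBr _ _ _)) sumrB big_ord_recr big_ord_recl /= ltnn.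
rewrite !scaler0 addr0 add0r; apply/eqP; rewrite subr_eq0; apply/eqP.
by rewrite -h //; apply: eq_bigr => i _; rewrite ltn_ord.
Qed.

Lemma sub_swap (V : zmodType) (p q r t : V) : p - r = q - t -> p - q = r - t.
Proof.
by move/eqP; rewrite subr_eq => /eqP ->; rewrite [q - t + r]addrC -addrA (addrAC q) subrr sub0r.
Qed.

Lemma scaler_swap (R : comPzRingType) (V : lmodType R) (a b : R) (x : V) :
  a *: (b *: x) = b *: (a *: x).
Proof. by rewrite !scalerA mulrC. Qed.

Section Monodromy.
Variables (k : closedFieldType) (A : algType k).
Implicit Types (T L : k -> 'I_2 -> 'I_2 -> A) (i j l m : 'I_2) (u v : k).

(* The RTT relation for the R-matrix [al u v - be u v * P]. *)
Definition RTT (al be : k -> k -> k) T : Prop := forall u v i j l m,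
  al u v *: (T u i j * T v l m) - be u v *: (T u l j * T v i m) =
  al u v *: (T v l m * T u i j) - be u v *: (T v l j * T u i m).

Definition tmul T L : k -> 'I_2 -> 'I_2 -> A := fun u i j => \sum_a T u i a * L u a j.

(** The relation for [T] exchanges the left factors, the one for [L] the right factors, and entries
    of [T] and [L] pass each other freely. Between the two uses, the summation indices of the terms
    with [be] are swapped. *)
Lemma RTT_mul al be T L : RTT al be T -> RTT al be L ->
    (forall u v i j l m, T u i j * L v l m = L v l m * T u i j) ->
  RTT al be (tmul T L).
Proof.
move=> rT rL TL u v i j l m.
have swap (T1 T2 L1 L2 : 'I_2 -> A) : (forall a b, T2 b * L1 a = L1 a * T2 b) ->
    (\sum_(a < 2) T1 a * L1 a) * (\sum_(b < 2) T2 b * L2 b) =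
    \sum_(a < 2) \sum_(b < 2) (T1 a * T2 b) * (L1 a * L2 b) :> A.
  move=> c; rewrite mulr_suml; apply: eq_bigr => a _; rewrite mulr_sumr.
  by apply: eq_bigr => b _; rewrite !mulrA; congr (_ * _); rewrite -!mulrA c.
rewrite /tmul !swap //.
transitivity (\sum_a \sum_b
   (al u v *: (T v l b * T u i a) - be u v *: (T v l a * T u i b)) * (L u a j * L v b m)).
  rewrite 2!scaler_sumr -sumrB; apply: eq_bigr => a _.
  rewrite 2!scaler_sumr -sumrB; apply: eq_bigr => b _.
  by rewrite -rT mulrBl !scalerAl.
transitivity (\sum_a \sum_b
   (T v l b * T u i a) * (al u v *: (L v b m * L u a j) - be u v *: (L v b j * L u a m))).
  transitivity (\sum_a \sum_b
     (T v l b * T u i a) * (al u v *: (L u a j * L v b m) - be u v *: (L u b j * L v a m))).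
    pose F a b := be u v *: ((T v l a * T u i b) * (L u a j * L v b m)).
    transitivity (\sum_a \sum_b al u v *: (T v l b * T u i a * (L u a j * L v b m)) -
                  \sum_a \sum_b F a b).
      rewrite -sumrB; apply: eq_bigr => a _; rewrite -sumrB; apply: eq_bigr => b _.
      by rewrite mulrBl -!scalerAl.
    rewrite [X in _ - X = _]exchange_big -sumrB; apply: eq_bigr => a _.
    rewrite -sumrB; apply: eq_bigr => b _.
    by rewrite mulrBr -!scalerAr.
  by apply: eq_bigr => a _; apply: eq_bigr => b _; rewrite rL.
rewrite [X in _ = _ *: X - _]exchange_big [X in _ = _ - _ *: X]exchange_big.
rewrite 2!scaler_sumr -sumrB; apply: eq_bigr => a _.
rewrite 2!scaler_sumr -sumrB; apply: eq_bigr => b _.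
by rewrite mulrBr -!scalerAr.
Qed.

(** The quantum determinant evaluated at the scalar [u]. *)
Definition qminor T u : A :=
  T u ix1 ix1 * T (u - 1) ix2 ix2 - T u ix2 ix1 * T (u - 1) ix1 ix2.

(** At [v = u - 1] both coefficients of the relation equal 1 and it turns into symmetries: two
    entries of one column may be exchanged ([col]), and the minor changes sign with its columns
    ([row]). The expansion then collapses as in the Cauchy-Binet formula. *)
Lemma qminor_mul T L : RTT (fun u v => u - v) (fun _ _ => 1) T ->
    (forall u v i j l m, T u i j * L v l m = L v l m * T u i j) ->
  forall u, qminor (tmul T L) u = qminor T u * qminor L u.
Proof.
move=> rT TL u.
have uw : u - (u - 1) = 1 by rewrite opprB addrC subrK.
have col i l j : T u i j * T (u - 1) l j = T u l j * T (u - 1) i j.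
  have := rT u (u - 1) i j l j; rewrite uw !scale1r subrr.
  by move/eqP; rewrite subr_eq0 => /eqP.
rewrite {1}/qminor /tmul !big_ord_recl !big_ord0 !addr0.
rewrite (_ : lift ord0 ord0 = ix2); last exact: val_inj.
set w := u - 1 in col uw *; rewrite !mulrDl !mulrDr.
have sw i j l m a b c d : T u i j * L u l m * (T w a b * L w c d) =
    T u i j * T w a b * (L u l m * L w c d).
  by rewrite !mulrA; congr (_ * _); rewrite -!mulrA TL.
have row : T u ix1 ix2 * T w ix2 ix1 - T u ix2 ix2 * T w ix1 ix1 =
    - (T u ix1 ix1 * T w ix2 ix2 - T u ix2 ix1 * T w ix1 ix2).
  have := rT u w ix1 ix1 ix2 ix2; have := rT u w ix1 ix2 ix2 ix1.
  by rewrite uw !scale1r => -> ->; rewrite opprB.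
rewrite !sw (col ix2 ix1 ix1) (col ix2 ix1 ix2) /qminor -/w.
have abel (V : zmodType) (a b c d e f : V) :
    a + b + (c + d) - (a + e + (f + d)) = (b - e) + (c - f).
  by rewrite opprD addrACA [a + b]addrC [f + d]addrC !addrKA.
by rewrite abel -!mulrBl row mulNr -mulrBr mulrDl !mulrDr.
Qed.

(** Covers two normalizations: [a u = u], [b = 1] is the monic factor [u + E] used for the
    determinant, and [a = 1], [b u = u] is the reversed factor [1 + u E], whose coefficients are
    compared in [RTT_coef]. *)
Lemma RTT_linear (al be : k -> k -> k) (a b : k -> k) (E : 'I_2 -> 'I_2 -> A) :
    (forall u v, al u v * (b u * b v) = be u v * (a u * b v - a v * b u)) ->
    (forall i j l m, E i j * E l m - E l m * E i j =
       (l == j)%:R *: E i m - (i == m)%:R *: E l j) ->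
  RTT al be (fun u i j => (a u * (i == j)%:R)%:A + b u *: E i j).
Proof.
move=> hab hE u v i j l m.
have expand (x y z t : k) (X Y : A) : (x%:A + y *: X) * (z%:A + t *: Y) =
    (x * z)%:A + (x * t) *: Y + ((z * y) *: X + (y * t) *: (X * Y)).
  by rewrite mulrDl !mulrDr !mulr_algl !mulr_algr !scalerA -scalerAl -scalerAr !scalerA.
have abel1 (V : zmodType) (x y z p q : V) : x + y + (z + p) - (x + z + (y + q)) = p - q.
  by rewrite addrACA [x + z + (y + p)]addrC addrKA [y + p]addrC addrKA.
have abel2 (V : zmodType) (x y z p y' z' : V) :
    x + y + (z + p) - (x + y' + (z' + p)) = (y - y') + (z - z').
  by rewrite opprD addrACA [x + y]addrC addrKA [z' + p]addrC addrKA.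
apply: sub_swap; rewrite -!scalerBr !expand.
rewrite [a v * _ * (a u * _)]mulrC [b v * b u]mulrC abel1 -scalerBr hE scalerA hab.
rewrite (_ : a v * (l == j)%:R * (a u * (i == m)%:R) =
             a u * (l == j)%:R * (a v * (i == m)%:R)); last by ring.
rewrite abel2 -!scalerBl -scalerA; congr (_ *: _); rewrite scalerBr !scalerA.
by rewrite -scaleNr; congr (_ *: _ + _ *: _); ring.
Qed.

End Monodromy.

(** * From the RTT relation to commutators of coefficients *)

Section Coefficients.
Variables (k : closedFieldType) (A : algType k) (t : 'I_2 -> 'I_2 -> nat -> A) (p : nat).
Hypothesis t0 : forall i j, t i j 0 = (i == j)%:R%:A.
Hypothesis tp : forall i j r, (p < r)%N -> t i j r = 0.

(** This is the coefficient of [u^(r+1) v^(s+1)] in the relation. The bound [N] exceeds all indices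
    in play, so that every sum runs over the same range. *)
Lemma RTT_coef_shift i j l m r s :
    RTT (fun u v => v - u) (fun u v => u * v) (fun u i j => \sum_(r < p.+1) u ^+ r *: t i j r) ->
  (t i j r.+1 * t l m s - t l m s * t i j r.+1) -
  (t i j r * t l m s.+1 - t l m s.+1 * t i j r) =
  t l j r * t i m s - t l j s * t i m r.
Proof.
move=> rT.
pose c r s := t i j r * t l m s - t l m s * t i j r.
pose g r s := t l j r * t i m s - t l j s * t i m r.
pose N := (maxn p (maxn r s)).+2.
have Tsum u i' j' : \sum_(r < p.+1) u ^+ r *: t i' j' r = \sum_(r < N) u ^+ r *: t i' j' r.
  rewrite (big_ord_widen N (fun r => u ^+ r *: t i' j' r)); last by rewrite /N; lia.
  rewrite big_mkcond; apply: eq_bigr => r' _; case: ltnP => // pr.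
  by rewrite tp ?scaler0.
have prodE u v (X Y : nat -> A) : (\sum_(r < N) u ^+ r *: X r) * (\sum_(s < N) v ^+ s *: Y s) =
    \sum_(r < N) u ^+ r *: \sum_(s < N) v ^+ s *: (X r * Y s).
  rewrite mulr_suml; apply: eq_bigr => r' _; rewrite mulr_sumr scaler_sumr.
  by apply: eq_bigr => s' _; rewrite -scalerAl -scalerAr.
have prodE' u v (X Y : nat -> A) : (\sum_(s < N) v ^+ s *: Y s) * (\sum_(r < N) u ^+ r *: X r) =
    \sum_(r < N) u ^+ r *: \sum_(s < N) v ^+ s *: (Y s * X r).
  rewrite mulr_sumr; apply: eq_bigr => r' _; rewrite mulr_suml scaler_sumr.
  by apply: eq_bigr => s' _; rewrite -scalerAl -scalerAr [u ^+ _ *: (v ^+ _ *: _)]scalerA mulrC -scalerA.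
have key u v : \sum_(r < N) u ^+ r *: (v *: \sum_(s < N) v ^+ s *: c r s) =
    \sum_(r < N) u ^+ r.+1 *: \sum_(s < N) v ^+ s *: (c r s + v *: g r s).
  have := rT u v i j l m; rewrite !Tsum !(prodE u v) !(prodE' u v) => /sub_swap.
  rewrite -!scalerBr -!sumrB => E.
  have {E} : v *: \sum_(r < N) u ^+ r *: (\sum_(s < N) v ^+ s *: c r s) =
    u *: \sum_(r < N) u ^+ r *: (\sum_(s < N) v ^+ s *: (c r s + v *: g r s)).
    have {E} : (v - u) *: \sum_(r < N) u ^+ r *: (\sum_(s < N) v ^+ s *: c r s) =
         (u * v) *: \sum_(r < N) u ^+ r *: (\sum_(s < N) v ^+ s *: g r s).
      move: E; congr (_ *: _ = _ *: _); apply: eq_bigr => r' _; rewrite -scalerBr -sumrB;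
        congr (_ *: _); apply: eq_bigr => s' _; rewrite -scalerBr //.
    rewrite scalerBl => /eqP; rewrite subr_eq => /eqP ->; rewrite -scalerA -scalerDr; congr (_ *: _).
    rewrite scaler_sumr -big_split; apply: eq_bigr => r' _ /=.
    rewrite scalerA mulrC -scalerA -scalerDr scaler_sumr -big_split /=; congr (_ *: _).
    by apply: eq_bigr => s' _; rewrite scalerA mulrC -scalerA -scalerDr addrC.
  rewrite !scaler_sumr => E; rewrite (eq_bigr _ (fun r' _ => scaler_swap _ _ _)) E.
  by apply: eq_bigr => r' _; rewrite scalerA exprS.
have rN : (r.+1 < N)%N by rewrite /N; lia.
have sN : (s.+1 < N)%N by rewrite /N; lia.
have key2 v : v != 0 -> \sum_(s < N) v ^+ s *: c r s = \sum_(s < N) v ^+ s.+1 *: (c r.+1 s - g r s).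
  move=> v0; have := shift_coef (X := fun r => v *: \sum_(s < N) v ^+ s *: c r s)
    (Y := fun r => \sum_(s < N) v ^+ s *: (c r s + v *: g r s)) (fun u _ => key u v) rN.
  have -> : \sum_(s < N) v ^+ s *: (c r s + v *: g r s) =
      \sum_(s < N) v ^+ s *: c r s + v *: \sum_(s < N) v ^+ s *: g r s.
    rewrite scaler_sumr -big_split; apply: eq_bigr => s' _.
    by rewrite scalerDr scaler_swap.
  move=> /eqP; rewrite -subr_eq -scalerBr -sumrB => /eqP <-.
  by rewrite scaler_sumr; apply: eq_bigr => s' _; rewrite -scalerBr scalerA -exprS.
have := shift_coef (X := c r) (Y := fun s => c r.+1 s - g r s) key2 sN.
rewrite -/(c r.+1 s) -/(c r s.+1) => ->.
by rewrite opprB addrC subrK.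
Qed.

(** The shift relation is telescoped in [r] down to [t^(0)], which is scalar. The sum stops at
    [minn r s] because the summand [g] is antisymmetric: if [s < r] the extra term cancels against
    its transpose, if [r = s] it vanishes. *)
Lemma RTT_coef i j l m r s :
    RTT (fun u v => v - u) (fun u v => u * v) (fun u i j => \sum_(r < p.+1) u ^+ r *: t i j r) ->
  t i j r * t l m s - t l m s * t i j r =
  \sum_(1 <= a < (minn r s).+1)
      (t l j a.-1 * t i m (r + s - a)%N - t l j (r + s - a)%N * t i m a.-1).
Proof.
move=> rT.
pose g a b := t l j a * t i m b - t l j b * t i m a.
have t00 i' j' i1 j1 n : t i' j' 0 * t i1 j1 n - t i1 j1 n * t i' j' 0 = 0.
  by rewrite t0 mulr_algl mulr_algr subrr.
elim: r s => [|r IH] s; first by rewrite min0n big_geq // t00.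
have := RTT_coef_shift i j l m r s rT => /eqP; rewrite subr_eq => /eqP ->; rewrite IH.
rewrite -/(g r s).
have gN a b : g a b = - g b a by rewrite /g opprB.
have -> : (r + s.+1 = r.+1 + s)%N by rewrite addnS.
rewrite -!/(g _ _).
have [sr|rs|sr] := ltngtP s r.
- have -> : minn r s.+1 = s.+1 by lia.
  have -> : minn r.+1 s = s by lia.
  rewrite [in LHS]big_nat_recr //=.
  have -> : (r.+1 + s - s.+1 = r)%N by lia.
  by rewrite addrCA /g -[RHS]addr0; congr (_ + _); rewrite addrA subrK subrr.
- have -> : minn r s.+1 = r by lia.
  have -> : minn r.+1 s = r.+1 by lia.
  rewrite [in RHS]big_nat_recr //= addrC; congr (_ + _).
  by have -> : (r.+1 + s - r.+1 = s)%N by lia.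
- rewrite sr; have -> : minn r r.+1 = r by lia.
  have -> : minn r.+1 r = r by lia.
  by rewrite /g subrr add0r.
Qed.

End Coefficients.

(** * Representation by difference operators *)

Lemma ord2P (P : 'I_2 -> Prop) : P ix1 -> P ix2 -> forall i, P i.
Proof.
by move=> P1 P2 [[|[|//]] h]; [move: P1 | move: P2]; congr (P _); apply: val_inj.
Qed.

Lemma sum_ord2 (V : nmodType) (F : 'I_2 -> V) : \sum_a F a = F ix1 + F ix2.
Proof. by rewrite !big_ord_recl big_ord0 addr0; congr (_ + F _); apply: val_inj. Qed.

Section ShiftOperators.
Variable k : closedFieldType.
Implicit Types (c : nat -> k) (q : k -> {poly k}) (m n : nat).

Definition csh m (a : k) c : nat -> k := fun i => if i == m then c i + a else c i.

Lemma csh_at m a c : csh m a c m = c m + a.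
Proof. by rewrite /csh eqxx. Qed.

Lemma csh_ne m n a c : n != m -> csh m a c n = c n.
Proof. by rewrite /csh => /negPf ->. Qed.

Lemma csh_csh m a b c : csh m a (csh m b c) = csh m (b + a) c.
Proof. by apply: funext => i; rewrite /csh; case: eqP => // _; rewrite addrA. Qed.

Lemma csh0 m c : csh m 0 c = c.
Proof. by apply: funext => i; rewrite /csh addr0 if_same. Qed.

Lemma csh_comm m n a b c : m != n -> csh m a (csh n b c) = csh n b (csh m a c).
Proof.
move=> mn; apply: funext => i; rewrite /csh; case: (eqVneq i m) => [->|//].
by rewrite (negPf mn).
Qed.

Program Definition dop m q (s : k) : endo k :=
  @Endo k (fun f c => q (c m) * f (csh m s c)) _.
Next Obligation. by apply: funext => c; rewrite mulrDr -scalerAr. Qed.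

Lemma dopE m q s (f : lattice_fun k) c : dop m q s f c = q (c m) * f (csh m s c).
Proof. by []. Qed.

Lemma dopM m q s q' s' : dop m q s * dop m q' s' =
  dop m (fun z => q z * q' (z + s)) (s + s').
Proof.
by apply: endoP => f; apply: funext => c; rewrite endoM !dopE csh_at csh_csh mulrA.
Qed.

Lemma dop_comm m n q s q' s' : m != n -> dop m q s * dop n q' s' = dop n q' s' * dop m q s.
Proof.
move=> mn; apply: endoP => f; apply: funext => c.
have nm : n != m by rewrite eq_sym.
by rewrite !endoM !dopE (csh_ne _ _ nm) (csh_ne _ _ mn) (csh_comm _ _ _ mn) mulrCA.
Qed.

Lemma dopD m q q' s : dop m q s + dop m q' s = dop m (fun z => q z + q' z) s.
Proof. by apply: endoP => f; apply: funext => c; rewrite endoD dopE mulrDl. Qed.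

Lemma dopB m q q' s : dop m q s - dop m q' s = dop m (fun z => q z - q' z) s.
Proof. by apply: endoP => f; apply: funext => c; rewrite endoD endoN dopE mulrBl. Qed.

Lemma dopZ m a q s : a *: dop m q s = dop m (fun z => a *: q z) s.
Proof. by apply: endoP => f; apply: funext => c; rewrite endoZ !dopE -scalerAl. Qed.

Variables (x w w' y : nat -> k).
Hypothesis y0 : forall m, y m != 0.

Definition gl_sym1 m (i j : 'I_2) : k :=
  if i == ix1 then if j == ix1 then x m - w m - w' m else - w' m
  else if j == ix1 then w m else x m.

Definition gl_const (i j : 'I_2) : k := if i == ix1 then -1 else 1.

(** An action of gl_2 in the style of a weight basis, with [z = c m] as the weight parameter: the
    diagonal units multiply by functions of [z], while [E_12] and [E_21] shift [z] by 1 and -1 with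
    coefficients linear in [z]. *)
Definition glE1 m (i j : 'I_2) : endo k :=
  dop m (fun z => (gl_sym1 m i j)%:P * 'X + (gl_const i j)%:P * z%:P) ((j : nat)%:R - (i : nat)%:R).

Lemma dop_ext m q q' s s' : (forall z, q z = q' z) -> s = s' -> dop m q s = dop m q' s'.
Proof. by move=> /funext -> ->. Qed.

Lemma dop_eq0 m q s : (forall z, q z = 0) -> dop m q s = 0.
Proof.
move=> q0; apply: endoP => f; apply: funext => c.
by rewrite dopE q0 mul0r.
Qed.

Lemma glE1_rel m i j a b : glE1 m i j * glE1 m a b - glE1 m a b * glE1 m i j =
  (a == j)%:R *: glE1 m i b - (i == b)%:R *: glE1 m a j.
Proof.
rewrite /glE1 !dopM [_ - _ + (_ - (i : nat)%:R)]addrC dopB.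
have polyCB1 (u v : k) : (u - v)%:P = u%:P - v%:P by rewrite rmorphB.
have polyCD1 (u v : k) : (u + v)%:P = u%:P + v%:P by rewrite rmorphD.
elim/ord2P: i; elim/ord2P: j; elim/ord2P: a; elim/ord2P: b; rewrite /gl_sym1 /gl_const /=
  ?scale1r ?scale0r ?subrr ?subr0 ?sub0r -?scaleN1r ?dopZ ?dopD; first
  [ by apply: dop_eq0 => z; rewrite ?polyCD1 ?polyCB1; ring
  | by apply: dop_ext => [z|]; rewrite -?mul_polyC ?polyCB1 ?polyCD1 ?polyCB1; ring
  | idtac ].
Qed.

(** Conjugation by [diag(1, y)]: it rescales the two off-diagonal entries inversely, the freedom
    still needed in [gl_sym_surj]. *)
Definition gl_wt m (i : 'I_2) : k := if i == ix1 then 1 else y m.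
Definition gl_sym m i j : k := gl_wt m i / gl_wt m j * gl_sym1 m i j.

(* A representation of [gl_2] by difference operators in which the matrix units
   have degree one in ['X], with leading coefficients [gl_sym m i j]. *)
Definition glE m (i j : 'I_2) : endo k := (gl_wt m i / gl_wt m j) *: glE1 m i j.

Lemma gl_wt_neq0 m i : gl_wt m i != 0.
Proof. by rewrite /gl_wt; case: ifP; rewrite ?oner_neq0. Qed.

Lemma glE_comm m n i j a b : m != n -> glE m i j * glE n a b = glE n a b * glE m i j.
Proof.
move=> mn; rewrite /glE -!scalerAl -!scalerAr scaler_swap; congr (_ *: (_ *: _)).
exact: dop_comm.
Qed.

Lemma glE_rel m i j a b : glE m i j * glE m a b - glE m a b * glE m i j =
  (a == j)%:R *: glE m i b - (i == b)%:R *: glE m a j.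
Proof.
have g0 := gl_wt_neq0 m.
rewrite /glE -!scalerAl -!scalerAr [in X in _ - X]scaler_swap -!scalerBr glE1_rel.
rewrite !scalerBr !scalerA; congr (_ *: _ - _ *: _).
  by case: eqP => [->|]; rewrite ?mulr0 ?mul0r // mulr1 mul1r mulrA divfK.
case: eqP => [->|]; rewrite ?mulr0 ?mul0r // mulr1 mul1r mulrC mulrA divfK //.
Qed.

(** The coefficient [a] is the same at every point [c], hence shift operators do not see it. *)
Definition nice n (a : k) (f : lattice_fun k) : Prop :=
  forall c, (size (f c) <= n.+1)%N /\ (f c)`_n = a.

(** The symbol on the side of operators: degree [r] in ['X] with scalar leading coefficient [s]. *)
Definition opdeg r (s : k) (o : endo k) : Prop :=
  forall n a f, nice n a f -> nice (r + n) (s * a) (o f).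

Lemma niceD n a b f g : nice n a f -> nice n b g -> nice n (a + b) (f + g).
Proof.
move=> nf ng c; have [[sf <-] [sg <-]] := (nf c, ng c); split; last exact: coefD.
by rewrite (leq_trans (size_polyD _ _)) // geq_max sf sg.
Qed.

Lemma niceZ n a b f : nice n a f -> nice n (b * a) (b *: f).
Proof.
move=> nf c; have [sf <-] := nf c; split; last exact: coefZ.
exact: leq_trans (size_scale_leq _ _) sf.
Qed.

Lemma nice0 n : nice n 0 0.
Proof. by move=> c; rewrite size_poly0 coef0. Qed.

Lemma niceW n a f : nice n a f -> nice n.+1 0 f.
Proof.
move=> nf c; have [sf _] := nf c; split; first exact: leqW.
by rewrite nth_default.
Qed.

Lemma opdegM r r' s s' o o' : opdeg r s o -> opdeg r' s' o' ->
  opdeg (r + r') (s * s') (o * o').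
Proof. by move=> ho ho' n a f nf; rewrite -addnA -mulrA; apply/ho/ho'. Qed.

Lemma opdegD r s s' o o' : opdeg r s o -> opdeg r s' o' -> opdeg r (s + s') (o + o').
Proof. by move=> ho ho' n a f nf; rewrite mulrDl; apply: niceD; [apply: ho | apply: ho']. Qed.

Lemma opdeg0 r : opdeg r 0 0.
Proof. by move=> n a f nf; rewrite mul0r; apply: nice0. Qed.

Lemma opdeg_scalar b : opdeg 0 b b%:A.
Proof. by move=> n a f nf; apply: niceZ. Qed.

Lemma opdeg_glE m i j : opdeg 1 (gl_sym m i j) (glE m i j).
Proof.
move=> n a f nf; rewrite -mulrA; apply: niceZ => c; rewrite /glE1 dopE.
set q := _ + _; have [sf <-] := nf (csh m (j%:R - i%:R) c).
set g := f _ in sf *.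
have sq : (size q <= 2)%N.
  rewrite (leq_trans (size_polyD _ _)) // geq_max -polyCM (leq_trans (size_polyC_leq1 _)) //.
  by rewrite andbT mul_polyC (leq_trans (size_scale_leq _ _)) // size_polyX.
split.
  rewrite (leq_trans (size_polyMleq _ _)) // -subn1 leq_subLR.
  by rewrite (leq_trans (leq_add sq sf)) // add1n addSnnS.
rewrite /q -polyCM mulrDl -mulrA coefD !coefCM coefXM /=.
by rewrite [g`_n.+1]nth_default // mulr0 addr0.
Qed.

End ShiftOperators.

(** * Products of linear factors of difference operators *)

Section Monodromy.
Variables (k : closedFieldType) (x w w' y : nat -> k).
Hypothesis y0 : forall m, y m != 0.
Local Notation E := (glE x w w' y).

(** Coefficient of [u^-r] in [(1 + E_0 / u) ... (1 + E_(n-1) / u)]; [tau] is the same expression for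
    scalar matrices. *)
Fixpoint tc n (i j : 'I_2) (r : nat) : endo k :=
  if n is n'.+1 then
    tc n' i j r + (if r is r'.+1 then \sum_a tc n' i a r' * E n' a j else 0)
  else if r is 0 then (i == j)%:R%:A else 0.

Fixpoint tau (N : nat -> 'I_2 -> 'I_2 -> k) n (i j : 'I_2) (r : nat) : k :=
  if n is n'.+1 then
    tau N n' i j r + (if r is r'.+1 then \sum_a tau N n' i a r' * N n' a j else 0)
  else if r is 0 then (i == j)%:R else 0.

Lemma tc0 n i j : tc n i j 0 = (i == j)%:R%:A.
Proof. by elim: n => //= n ->; rewrite addr0. Qed.

Lemma tc_gt n i j r : (n < r)%N -> tc n i j r = 0.
Proof.
elim: n i j r => [|n IH] i j [|r] //= nr; rewrite IH ?add0r; last exact: ltnW.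
by rewrite big1 // => a _; rewrite IH ?mul0r.
Qed.

Lemma opdeg_tc n i j r : opdeg r (tau (gl_sym x w w' y) n i j r) (tc n i j r).
Proof.
elim: n i j r => [|n IH] i j [|r] /=; try exact: opdeg_scalar; try exact: opdeg0.
  by rewrite !addr0; apply: IH.
apply: opdegD => //; rewrite !sum_ord2 -addn1.
by apply: opdegD; apply: opdegM => //; apply: opdeg_glE.
Qed.

Lemma tc_comm_glE n m i j r a b : (n <= m)%N -> tc n i j r * E m a b = E m a b * tc n i j r.
Proof.
elim: n i j r => [|n IH] i j r nm /=.
  by case: r => [|r]; rewrite ?mul0r ?mulr0 // mulr_algl mulr_algr.
rewrite mulrDl mulrDr IH ?(ltnW nm) //; congr (_ + _).
case: r => [|r]; first by rewrite mul0r mulr0.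
rewrite mulr_suml mulr_sumr; apply: eq_bigr => e _.
by rewrite -mulrA [E n _ _ * _]glE_comm ?(ltn_eqF nm) // !mulrA IH // ltnW.
Qed.

Definition Lmon (al be : k -> k) n : k -> 'I_2 -> 'I_2 -> endo k :=
  fun u i j => (al u * (i == j)%:R)%:A + be u *: E n i j.

Fixpoint Tmon (al be : k -> k) n : k -> 'I_2 -> 'I_2 -> endo k :=
  if n is n'.+1 then tmul (Tmon al be n') (Lmon al be n')
  else fun _ i j => (i == j)%:R%:A.

Lemma TmonE al be n u i j :
  Tmon al be n u i j = \sum_(r < n.+1) (al u ^+ (n - r) * be u ^+ r) *: tc n i j r.
Proof.
elim: n i j => [|n IH] i j; first by rewrite big_ord1 /= mulr1 scale1r.
rewrite /= /tmul (eq_bigr (fun a => (al u * (a == j)%:R) *: Tmon al be n u i a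
    + be u *: (Tmon al be n u i a * E n a j))); last first.
  by move=> a _; rewrite /Lmon mulrDr mulr_algr -scalerAr.
rewrite big_split /=.
rewrite (bigD1 j) //= big1 ?addr0 => [|a /negPf aj]; last by rewrite aj mulr0 scale0r.
rewrite eqxx mulr1 IH scaler_sumr.
under [RHS]eq_bigr => r _ do rewrite scalerDr.
rewrite big_split /=; congr (_ + _).
  rewrite [in RHS]big_ord_recr /= (tc_gt _ _ (ltnSn n)) scaler0 addr0; apply: eq_bigr => r _.
  by rewrite scalerA (subSn (leq_ord r)) exprS mulrA.
rewrite [in RHS]big_ord_recl /= scaler0 add0r; transitivity
  (\sum_a \sum_(r < n.+1) (al u ^+ (n - r) * be u ^+ r.+1) *: (tc n i a r * E n a j)).
  apply: eq_bigr => a _; rewrite IH mulr_suml scaler_sumr; apply: eq_bigr => r _.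
  by rewrite -scalerAl scalerA; congr (_ *: _); rewrite exprS; ring.
rewrite exchange_big; apply: eq_bigr => r _ /=.
by rewrite scaler_sumr /bump add1n subSS.
Qed.

Lemma Tmon_comm_Lmon al be n u v i j a b :
  Tmon al be n u i j * Lmon al be n v a b = Lmon al be n v a b * Tmon al be n u i j.
Proof.
rewrite TmonE mulr_suml mulr_sumr; apply: eq_bigr => r _.
rewrite -scalerAl -scalerAr; congr (_ *: _).
by rewrite /Lmon mulrDl mulrDr mulr_algl mulr_algr -scalerAl -scalerAr tc_comm_glE.
Qed.

Lemma Tmon_RTT (al be : k -> k) (a b : k -> k -> k) n :
    (forall u v, a u v * (be u * be v) = b u v * (al u * be v - al v * be u)) ->
  RTT a b (Tmon al be n).
Proof.
move=> hab; elim: n => [|n IH].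
  move=> u v i j l m; rewrite /= !mulr_algl !scalerA; apply: sub_swap.
  by rewrite mulrAC subrr subrr.
apply: RTT_mul => //; last by move=> *; apply: Tmon_comm_Lmon.
by apply: RTT_linear => // *; apply: glE_rel.
Qed.

Lemma tc_rel n i j l m r s :
  tc n i j r * tc n l m s - tc n l m s * tc n i j r =
  \sum_(1 <= a < (minn r s).+1)
      (tc n l j a.-1 * tc n i m (r + s - a)%N - tc n l j (r + s - a)%N * tc n i m a.-1).
Proof.
apply: (@RTT_coef _ _ (tc n) n); [exact: tc0 | exact: tc_gt|].
have := @Tmon_RTT (fun=> 1) (fun u => u) (fun u v => v - u) (fun u v => u * v) n.
rewrite (_ : Tmon _ _ n = fun u i j => \sum_(r < n.+1) u ^+ r *: tc n i j r); last first.
  apply: funext => u; apply: funext => i'; apply: funext => j'; rewrite TmonE.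
  by apply: eq_bigr => r' _; rewrite expr1n mul1r.
by apply => u v; ring.
Qed.

(** The polynomial does not depend on the point [c], so these operators commute with all [tc];
    centrality of the determinant is read off from this. *)
Program Definition mulc (q : {poly k}) : endo k := @Endo k (fun f c => q * f c) _.
Next Obligation. by apply: funext => c; rewrite mulrDr -scalerAr. Qed.

Lemma mulcE q (f : lattice_fun k) c : mulc q f c = q * f c.
Proof. by []. Qed.

Lemma mulc_glE q m i j : mulc q * E m i j = E m i j * mulc q.
Proof.
rewrite /glE -scalerAl -scalerAr; congr (_ *: _).
by apply: endoP => f; apply: funext => c; rewrite !endoM /glE1 !(mulcE, dopE) mulrCA.
Qed.

Lemma mulc_tc q n i j r : mulc q * tc n i j r = tc n i j r * mulc q.
Proof.
elim: n i j r => [|n IH] i j [|r] /=; rewrite ?mulr0 ?mul0r ?mulr_algl ?mulr_algr ?addr0 //.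
rewrite mulrDl mulrDr IH; congr (_ + _); rewrite mulr_suml mulr_sumr; apply: eq_bigr => a _.
by rewrite mulrA IH -!mulrA mulc_glE.
Qed.

Lemma mulc_dop m q : mulc q = dop m (fun=> q) 0.
Proof. by apply: endoP => f; apply: funext => c; rewrite mulcE dopE csh0. Qed.

Lemma scalar_dop m a : a%:A = dop m (fun=> a%:P) 0 :> endo k.
Proof. by apply: endoP => f; apply: funext => c; rewrite dopE csh0 mul_polyC. Qed.

(** The shifts of [E_21] and [E_12] cancel, and so do all terms in [z]; what is left factors as in
    the witness. *)
Lemma qminor_Lmon n u : exists q, qminor (Lmon (fun u => u) (fun=> 1) n) u = mulc q.
Proof.
exists ((u%:P + (x n - w' n)%:P * 'X) * (u%:P - 1 + (x n - w n)%:P * 'X)).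
have polyCB1 (a b : k) : (a - b)%:P = a%:P - b%:P by rewrite rmorphB.
have polyCD1 (a b : k) : (a + b)%:P = a%:P + b%:P by rewrite rmorphD.
have L11 v : Lmon (fun u => u) (fun=> 1) n v ix1 ix1 =
    dop n (fun z => v%:P + ((x n - w n - w' n)%:P * 'X - z%:P)) 0.
  rewrite /Lmon eqxx mulr1 scale1r /glE divff ?gl_wt_neq0 // scale1r (scalar_dop n) /glE1 subrr.
  by rewrite dopD; apply: dop_ext => // z; rewrite /gl_sym1 /gl_const /= polyCN mulN1r.
have L22 v : Lmon (fun u => u) (fun=> 1) n v ix2 ix2 =
    dop n (fun z => v%:P + ((x n)%:P * 'X + z%:P)) 0.
  rewrite /Lmon eqxx mulr1 scale1r /glE divff ?gl_wt_neq0 // scale1r (scalar_dop n) /glE1 subrr.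
  by rewrite dopD; apply: dop_ext => // z; rewrite /gl_sym1 /gl_const /= mul1r.
have L21 v v' : Lmon (fun u => u) (fun=> 1) n v ix2 ix1 *
    Lmon (fun u => u) (fun=> 1) n v' ix1 ix2 =
    dop n (fun z => ((w n)%:P * 'X + z%:P) * (- (w' n)%:P * 'X - (z - 1)%:P)) 0.
  rewrite /Lmon /= !mulr0 !scale0r !add0r !scale1r /glE -scalerAl -scalerAr scalerA mulrA.
  rewrite divfK ?gl_wt_neq0 // divff ?gl_wt_neq0 // scale1r /glE1 dopM.
  apply: dop_ext => [z|]; last by rewrite /= subr0 sub0r addNr.
  by rewrite /gl_sym1 /gl_const /= mul1r !polyCN mulN1r sub0r.
rewrite /qminor L11 L22 L21 dopM addr0 dopB (mulc_dop n).
by apply: dop_ext => // z; rewrite addr0 !polyCB1; ring.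
Qed.

Lemma qminor_Tmon n u : exists q, qminor (Tmon (fun u => u) (fun=> 1) n) u = mulc q.
Proof.
elim: n => [|n [q IH]].
  exists 1; rewrite /qminor /= !scale1r scale0r mul1r mul0r subr0.
  by apply: endoP => f; apply: funext => c; rewrite mulcE mul1r.
have [q' hq'] := qminor_Lmon n u; exists (q * q').
rewrite /= qminor_mul; first 1 last.
- by apply: Tmon_RTT => a b; ring.
- by move=> *; apply: Tmon_comm_Lmon.
by rewrite IH hq'; apply: endoP => f; apply: funext => c; rewrite endoM !mulcE mulrA.
Qed.

End Monodromy.

(** * Factorization of matrix polynomials *)

Section PolyComp.
Variables (k : closedFieldType) (G H : eqType) (wt : G -> nat) (wt' : H -> nat).

Lemma pol_cst (W : pred H) (a : k) : pol wt' W (fun=> a).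
Proof.
have -> : (fun=> a) = a *: (1 : pfun k H) by apply: pfunP => t; rewrite pfunZ mulr1.
by apply: lspanZ; apply: hpol_pol; apply: hpol1.
Qed.

Lemma pol_var (W : pred H) v : W v -> pol wt' W (@pvar k H v).
Proof. by move=> Wv; apply: (@hpol_pol _ _ _ _ (wt' v)); apply: hpol_var. Qed.

Definition pfcomp (phi : G -> pfun k H) (f : pfun k G) : pfun k H :=
  fun t => f (fun v => phi v t).

Lemma pfcompD phi f g : pfcomp phi (f + g) = pfcomp phi f + pfcomp phi g. Proof. by []. Qed.
Lemma pfcompZ phi a f : pfcomp phi (a *: f) = a *: pfcomp phi f. Proof. by []. Qed.
Lemma pfcompM phi f g : pfcomp phi (f * g) = pfcomp phi f * pfcomp phi g. Proof. by []. Qed.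

Lemma pol_comp (W : pred G) (W' : pred H) (phi : G -> pfun k H) (f : pfun k G) :
    (forall v, W v -> pol wt' W' (phi v)) -> pol wt W f -> pol wt' W' (pfcomp phi f).
Proof.
move=> hphi; elim=> [|a g h [n hg] _ IH]; first exact: lspan0.
rewrite pfcompD pfcompZ; apply: lspanD => //; apply: lspanZ.
elim: hg {IH} => {n g} [n||n f1 f2 _ h1 _ h2|n b f1 _ h1|n v f1 Wv _ h1].
- exact: lspan0.
- by apply: (@hpol_pol _ _ _ _ 0%N); apply: hpol1.
- by rewrite pfcompD; apply: lspanD.
- by rewrite pfcompZ; apply: lspanZ.
- by rewrite pfcompM; apply: polM => //; apply: hphi.
Qed.

Lemma pol_ext (W : pred G) (f : pfun k G) t t' : pol wt W f -> {in W, t =1 t'} -> f t = f t'.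
Proof.
move=> hf tt'; elim: hf => [|a g h [n hg] _ IH] //.
by rewrite !pfunD !pfunZ IH (hpol_ext hg tt').
Qed.

End PolyComp.

Lemma pfun_neq0 (k : closedFieldType) (G : eqType) (f : pfun k G) :
  f <> 0 -> exists t, f t != 0.
Proof.
move=> fN0; apply: contrapT => /forallNP f0; apply/fN0/pfunP => t; apply/eqP.
by have /negP := f0 t; rewrite negbK.
Qed.

Lemma hpol_homog (k : closedFieldType) (G : eqType) (W : pred G) n (f : pfun k G) z t :
  hpol (fun=> 1%N) W n f -> f (fun v => z * t v) = z ^+ n * f t.
Proof.
elim=> {n f} [n||n f g _ hf _ hg|n a f _ hf|n v f Wv _ hf].
- by rewrite mulr0.
- by rewrite expr0 mul1r.
- by rewrite !pfunD mulrDr hf hg.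
- by rewrite !pfunZ hf mulrCA.
- by rewrite !pfunM /pvar hf add1n exprS mulrACA.
Qed.

Lemma pol_top (k : closedFieldType) (G : eqType) (W : pred G) (f : pfun k G) :
    pol (fun=> 1%N) W f -> f <> 0 ->
  exists d (F : nat -> pfun k G),
    [/\ f = \sum_(e < d.+1) F e, forall e, hpol (fun=> 1%N) W e (F e) & F d <> 0].
Proof.
move=> pf f0; have {pf} [d [F [fE hF]]] : exists d (F : nat -> pfun k G),
    f = \sum_(e < d) F e /\ forall e, hpol (fun=> 1%N) W e (F e).
  elim: pf {f0} => [|a g h [n hg] _ [d [F [-> hF]]]].
    by exists 0%N, (fun=> 0); split; [rewrite big_ord0 | move=> e; apply: hpol0].
  exists (maxn d n.+1), (fun e => (if (e < d)%N then F e else 0) + (if e == n then a *: g else 0)).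
  split; last first.
    move=> e; apply: hpolD; first by case: ifP => _; [apply: hF | apply: hpol0].
    by case: eqP => [->|_]; [apply: hpolZ | apply: hpol0].
  rewrite big_split addrC; congr (_ + _).
    by rewrite (big_ord_widen (maxn d n.+1) F) ?leq_maxl // big_mkcond.
  have nd : (n < maxn d n.+1)%N by rewrite leq_max ltnSn orbT.
  rewrite (bigD1 (Ordinal nd)) //= eqxx big1 ?addr0 // => e en.
  by case: eqP => // E; move: en; rewrite -val_eqE /= E eqxx.
elim: d f f0 fE => [|d IH] f f0 fE; first by rewrite fE big_ord0 in f0.
have [Fd|Fd] := pselect (F d = 0); last by exists d, F.
by apply: IH => //; rewrite fE big_ord_recr /= Fd addr0.
Qed.

Section Dominance.
Variables (k : closedFieldType).

(* [(r, i, j)] stands for the entry [(i, j)] of the coefficient of [u^-r] in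
   the normalized monic matrix polynomial. *)
Local Notation var := (nat * 'I_2 * 'I_2)%type.
Definition vlt (p : nat) : pred var := fun v => (0 < v.1.1 <= p)%N.
Local Notation polv := (@pol k var (fun=> 1%N)).

Definition tpoint (t : 'I_2 -> 'I_2 -> nat -> k) : var -> k := fun v => t v.1.2 v.2 v.1.1.

Lemma tau0 (N : nat -> 'I_2 -> 'I_2 -> k) n i j : tau N n i j 0 = (i == j)%:R.
Proof. by elim: n => //= n ->; rewrite addr0. Qed.

Lemma tau_gt (N : nat -> 'I_2 -> 'I_2 -> k) n i j r : (n < r)%N -> tau N n i j r = 0.
Proof.
elim: n i j r => [|n IH] i j [|r] //= nr; rewrite IH ?add0r; last exact: ltnW.
by rewrite big1 // => a _; rewrite IH ?mul0r.
Qed.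

Lemma eq_tau (N N' : nat -> 'I_2 -> 'I_2 -> k) n i j r :
  (forall m a b, (m < n)%N -> N m a b = N' m a b) -> tau N n i j r = tau N' n i j r.
Proof.
elim: n i j r => //= n IH i j r NN; have NN' m a b : (m < n)%N -> N m a b = N' m a b.
  by move=> mn; apply: NN; apply: ltnW.
rewrite IH //; congr (_ + _); case: r => // r.
by apply: eq_bigr => a _; rewrite IH // NN.
Qed.

(* A generic monic matrix polynomial is a product of linear factors: letting
   the last factor tend to infinity reduces to the factorization of its
   top-degree part, which is explicit. *)
Lemma tau_dominant p (f : pfun k var) : polv (vlt p) f -> f <> 0 ->
  exists N : nat -> 'I_2 -> 'I_2 -> k,
    (forall m, N m ix1 ix2 != 0 /\ N m ix2 ix1 != 0) /\ f (tpoint (tau N p)) != 0.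
Proof.
elim: p f => [|p IH] f hf f0.
  have [t ft] := pfun_neq0 f0; exists (fun _ _ _ => 1); split; first by rewrite oner_neq0.
  rewrite (pol_ext (t' := t) hf) // => v; rewrite unfold_in => /andP[v0 v1].
  by have := leq_trans v0 v1.
have [d [F [fE hF Fd]]] := pol_top hf f0.
pose X i j : pfun k var := @pvar k var (1%N, i, j).
have pX i j : polv (vlt p.+1) (X i j) by apply: pol_var.
have X0 i j : X i j <> 0 by apply: pvar_neq0.
pose dt := X ix1 ix1 * X ix2 ix2 - X ix1 ix2 * X ix2 ix1.
have pdt : polv (vlt p.+1) dt by apply: lspanB; apply: polM.
have dt0 : dt <> 0.
  move=> /(congr1 (fun g : pfun k var => g (fun v => (v.1.2 == v.2)%:R))) /eqP.
  by rewrite /dt pfunD pfunN !pfunM /X /pvar /= mulr0 subr0 mulr1 oner_eq0.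
have pFd : polv (vlt p.+1) (F d) := hpol_pol (hF d).
(* A point where the top-degree part of [f] is nonzero and where the coefficient of [u^-1] has
   nonzero determinant and nonzero off-diagonal entries. *)
have [t0 ht0] : exists t, (F d * (dt * (X ix1 ix2 * X ix2 ix1))) t != 0.
  apply: pfun_neq0 => E; have E1 := pol_domain pFd _ E Fd.
  have E2 := pol_domain pdt _ (E1 _) dt0.
  have p2 : polv (vlt p.+1) (X ix1 ix2 * X ix2 ix1) by apply: polM.
  have E3 := pol_domain (pX ix1 ix2) (pX ix2 ix1) (E2 p2 (polM pdt p2)) (X0 _ _).
  exact: X0 E3.
move: ht0; rewrite !pfunM !mulf_eq0 !negb_or => /andP[Ft /andP[dtt /andP[X12 X21]]].
pose N i j := t0 (1%N, i, j).
pose dN := N ix1 ix1 * N ix2 ix2 - N ix1 ix2 * N ix2 ix1.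
have dN0 : dN != 0 by move: dtt.
(* the inverse matrix of [N] *)
pose M i j := (if i == j then N (rev_ord i) (rev_ord j) else - N i j) / dN.
have r1 : rev_ord ix1 = ix2 by apply: val_inj.
have r2 : rev_ord ix2 = ix1 by apply: val_inj.
have MN i j : \sum_a M i a * N a j = (i == j)%:R.
  have -> : \sum_a M i a * N a j =
      (\sum_a (if i == a then N (rev_ord i) (rev_ord a) else - N i a) * N a j) / dN.
    by rewrite mulr_suml; apply: eq_bigr => a _; rewrite /M mulrAC.
  apply: (canLR (mulfK dN0)); rewrite sum_ord2 /dN.
  by elim/ord2P: i; elim/ord2P: j; rewrite /= ?r1 ?r2; ring.
(* The left factor, with [ta_0 = 1] and [ta_r = t0_(r+1) M], so that [t0_(r+1) = ta_r N]. *)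
pose ta (v : var) := if (v.1.1 == 0)%N then (v.1.2 == v.2)%:R else
   if (v.1.1 <= p)%N then \sum_a t0 (v.1.1.+1, v.1.2, a) * M a v.2 else 0.
have tN r i j : (r <= p)%N -> t0 (r.+1, i, j) = \sum_a ta (r, i, a) * N a j.
  case: r => [|r] rp; rewrite /ta /=.
    rewrite sum_ord2; elim/ord2P: i => /=; by rewrite !(mul1r, mul0r, addr0, add0r).
  rewrite rp; under eq_bigr => a _ do rewrite mulr_suml.
  rewrite exchange_big /=; under eq_bigr => b _ do
    [under eq_bigr => a _ do rewrite -mulrA; rewrite -mulr_sumr MN].
  rewrite (bigD1 j) //= big1 ?addr0 ?eqxx ?mulr1 // => b /negPf bj.
  by rewrite bj mulr0.
(* For [z != 0], [P] takes the value [z^d] times that of [f] at [z^-1 t0 + ta]; at 0 it is the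
   top-degree part of [f] at [t0], hence nonzero. *)
have [P hP] : exists P : {poly k}, forall z,
    P.[z] = \sum_(e < d.+1) z ^+ (d - e) * F e (fun v => t0 v + z * ta v).
  elim: d.+1 => [|n [P hP]]; first by exists 0 => z; rewrite horner0 big_ord0.
  have [Q hQ] := pol_line t0 ta (hpol_pol (hF n)).
  exists (P + 'X^(d - n) * Q) => z.
  by rewrite big_ord_recr /= !hornerE hP hQ.
have P0 : P != 0.
  apply/eqP => P0; have := hP 0; rewrite P0 horner0 big_ord_recr /= big1 => [|e _]; last first.
    by rewrite expr0n subn_eq0 leqNgt ltn_ord mul0r.
  rewrite add0r subnn expr0 mul1r => /esym/eqP; apply/negP.
  by move: Ft; congr (F d _ != 0); apply: funext => v; rewrite mul0r addr0.
have /closed_nonrootP[z] : P * 'X != 0 by rewrite mulf_neq0 ?polyX_eq0.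
rewrite /root hornerM hornerX mulf_eq0 negb_or => /andP[Pz z0].
(* In positive degree, the coefficients of the product of [ta] with the last factor
   [1 + z^-1 N / u]. *)
pose pt (v : var) := z^-1 * t0 v + ta v.
have fpt : f pt != 0.
  apply: contra_neq Pz; rewrite hP => f_pt; apply: (mulfI (expf_neq0 d (invr_neq0 z0))).
  rewrite mulr0 -[RHS]f_pt fE fct_sumE mulr_sumr; apply: eq_bigr => e _.
  have -> : pt = fun v => z^-1 * (t0 v + z * ta v).
    by apply: funext => v; rewrite mulrDr mulrA mulVf // mul1r.
  rewrite (hpol_homog _ _ (hF e)) mulrA; congr (_ * _).
  have ed : (e <= d)%N := leq_ord e.
  have -> : z^-1 ^+ d = z^-1 ^+ e * z^-1 ^+ (d - e) by rewrite -exprD subnKC.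
  by rewrite -mulrA -exprMn mulVf // expr1n mulr1.
(* Right multiplication by that factor, acting on the coefficients of a generic monic polynomial of
   degree [p]. The pullback of [f] along it does not vanish at [ta]. *)
pose phi (v : var) : pfun k var := (if (v.1.1 <= p)%N then @pvar k var v else 0) +
   \sum_a (z^-1 * N a v.2) *: (if (v.1.1.-1 == 0)%N then (fun=> (v.1.2 == a)%:R) else
     @pvar k var (v.1.1.-1, v.1.2, a)).
have phiE t v : phi v t = (if (v.1.1 <= p)%N then t v else 0) +
    \sum_a z^-1 * N a v.2 * (if (v.1.1.-1 == 0)%N then (v.1.2 == a)%:R else t (v.1.1.-1, v.1.2, a)).
  rewrite /phi pfunD fct_sumE; congr (_ + _); first by case: ifP.
  by apply: eq_bigr => a _; case: ifP.
have [|fphi|N' [N'0 fN']] := IH (pfcomp phi f).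
- apply: pol_comp hf => v /andP[v0 v1]; apply: lspanD.
    by case: ifP => vp; [apply: pol_var; rewrite /vlt v0 vp | apply: lspan0].
  apply: lspan_sum => a _; apply: lspanZ; case: ifP => vp; first exact: pol_cst.
  by apply: pol_var; rewrite /vlt /= lt0n vp /=; move: v1; case: (v.1.1).
- move/eqP: fpt; apply; rewrite -[RHS](congr1 (fun g : pfun k var => g ta) fphi).
  rewrite /pfcomp; apply: (pol_ext hf) => -[[r i] j]; rewrite unfold_in => /= /andP[r0 rp].
  case: r r0 rp => // r _ rp.
  rewrite phiE /= /pt addrC; congr (_ + _); first by rewrite /ta /=; case: ifP.
  rewrite tN // mulr_sumr; apply: eq_bigr => a _.
  by rewrite /= mulrA mulrAC; congr (_ * _); rewrite /ta /=; case: r rp.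
exists (fun m => if m == p then fun i j => z^-1 * N i j else N' m); split.
  by move=> m; case: ifP => _ //; rewrite !mulf_neq0 ?invr_eq0.
move: fN'; rewrite /pfcomp; congr (_ != 0); apply: (pol_ext hf) => -[[r i] j].
rewrite unfold_in => /= /andP[r0 rp]; rewrite phiE /tpoint /=.
case: r r0 rp => // r _ rp /=.
have tE n a b : tau (fun m => if m == p then fun i j => z^-1 * N i j else N' m) p a b n = tau N' p a b n.
  by apply: eq_tau => m ? ? mp; rewrite (ltn_eqF mp).
rewrite tE eqxx; congr (_ + _); first by case: ltnP => // pr; rewrite tau_gt.
apply: eq_bigr => a _; rewrite tE mulrC; congr (_ * _).
by case: r rp => [|r] _ //=; rewrite tau0.
Qed.

(** Comparing entries, [w + w' = N_22 - N_11] and [w w' = - N_12 N_21], so [w] and [w'] are the two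
    roots of a quadratic polynomial. Nonzero off-diagonal entries make [w] nonzero, and [y] is then
    fixed by [N_21 = y w]. *)
Lemma gl_sym_surj (N : nat -> 'I_2 -> 'I_2 -> k) :
    (forall m, N m ix1 ix2 != 0 /\ N m ix2 ix1 != 0) ->
  exists x w w' y, (forall m : nat, y m != 0) /\ gl_sym x w w' y = N.
Proof.
move=> hN.
have root m : exists z, z ^+ 2 = (N m ix2 ix2 - N m ix1 ix1) * z + N m ix1 ix2 * N m ix2 ix1.
  have [z hz] := @solve_monicpoly k 2 (fun i => if i == 0%N then
    N m ix1 ix2 * N m ix2 ix1 else N m ix2 ix2 - N m ix1 ix1) isT.
  by exists z; rewrite hz !big_ord_recl big_ord0 /= expr0 mulr1 addr0 addrC expr1.
have /choice[w hw] := root.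
have w0 m : w m != 0.
  apply/eqP => w0; have := hw m; rewrite w0 mulr0 add0r expr0n /= => /esym/eqP.
  by rewrite mulf_eq0; have [/negPf -> /negPf ->] := hN m.
exists (fun m => N m ix2 ix2), w, (fun m => N m ix2 ix2 - N m ix1 ix1 - w m),
  (fun m => N m ix2 ix1 / w m); split.
  by move=> m; rewrite mulf_neq0 ?invr_eq0 //; have [] := hN m.
apply: funext => m; apply: funext => i; apply: funext => j.
have [n12 n21] := hN m.
elim/ord2P: i; elim/ord2P: j; rewrite /gl_sym /gl_sym1 /gl_wt /=.
- by rewrite divr1 mul1r; ring.
- rewrite div1r invf_div; apply: (mulIf n21).
  rewrite [_ * _ * N _ _ _]mulrAC divfK //; apply/eqP; rewrite -subr_eq0; apply/eqP.
  have := hw m; rewrite expr2 => E; transitivity (w m * w m - ((N m ix2 ix2 - N m ix1 ix1) * w m + N m ix1 ix2 * N m ix2 ix1)); first by ring.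
  by rewrite E subrr.
- by rewrite divr1 divfK.
- by rewrite divff ?mul1r // mulf_neq0 ?invr_eq0.
Qed.

End Dominance.

(** * The PBW theorem for the Yangian *)

Definition yrelator (R : pzRingType) (t : 'I_2 -> 'I_2 -> nat -> R) i j l m r s : R :=
  t i j r * t l m s - t l m s * t i j r
  - \sum_(1 <= a < (minn r s).+1)
      (t l j a.-1 * t i m (r + s - a)%N - t l j (r + s - a)%N * t i m a.-1).

Lemma yrelator_map (R S : pzRingType) (f : R -> S) (t : 'I_2 -> 'I_2 -> nat -> R) i j l m r s :
    (forall x y, f (x - y) = f x - f y) -> (forall x y, f (x * y) = f x * f y) ->
  f (yrelator t i j l m r s) = yrelator (fun i j r => f (t i j r)) i j l m r s.
Proof.
move=> fB fM; have f0 : f 0 = 0 by rewrite -(subrr 0) fB subrr.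
have fD x y : f (x + y) = f x + f y by rewrite -[y]opprK fB -[in RHS](sub0r (- y)) fB f0 sub0r.
rewrite /yrelator !fB !fM (big_morph f fD f0); congr (_ - _).
by apply: eq_bigr => a _; rewrite fB !fM.
Qed.

(* The properties of the Yangian used below; working with an abstract algebra
   keeps conversion from unfolding the presentation. *)
Record yangian_like (k : closedFieldType) (p : nat) (A : algType k)
    (t : 'I_2 -> 'I_2 -> nat -> A) : Prop := YangianLike {
  yl_t0 : forall i j, t i j 0 = (i == j)%:R;
  yl_gt : forall i j r, (p < r)%N -> t i j r = 0;
  yl_rel : forall i j l m r s, (0 < r <= p)%N -> (0 < s <= p)%N -> yrelator t i j l m r s = 0;
  yl_ind : forall P : A -> Prop, P 0 -> P 1 ->
    (forall a b, P a -> P b -> P (a + b)) -> (forall a b, P b -> P (a *: b)) ->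
    (forall i j r a, (0 < r <= p)%N -> P a -> P (t i j r * a)) ->
    forall a, P a;
  yl_rho : forall x w w' y, (forall m : nat, y m != 0) -> exists rho : A -> endo k,
    [/\ {morph rho : a b / a + b}, {morph rho : a b / a * b},
        forall a, {morph rho : b / a *: b}, rho 1 = 1
      & forall i j r, rho (t i j r) = tc x w w' y p i j r] }.

Section ConcreteYangian.
Variables (k : closedFieldType) (p : nat).
Local Notation Y := (yangian k p).
Local Notation G := (yangian_gen p).
Local Notation yt := (yt k p).
Local Notation rels := (@yangian_relators k p).

Definition ypi (x : {free k[G]}) : Y := presented_pi rels x.

Lemma ypiB x z : ypi (x - z) = ypi x - ypi z. Proof. exact: presented_piB. Qed.
Lemma ypiM x z : ypi (x * z) = ypi x * ypi z. Proof. exact/esym/presented_mulE. Qed.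

Lemma yangian_rel i j l m r s : (0 < r <= p)%N -> (0 < s <= p)%N ->
  yrelator yt i j l m r s = 0.
Proof.
move=> hr hs; transitivity (ypi (yrelator (@ft k p) i j l m r s)).
  by rewrite (yrelator_map _ _ _ _ _ _ _ ypiB ypiM).
rewrite -[RHS](raddf0 (presented_pi rels)).
apply/presented_eq; rewrite subr0; apply: sub_ideal_gen.
by exists i, j, l, m, r, s.
Qed.

Section Representation.
Variables (x w w' y : nat -> k).
Hypothesis y0 : forall m, y m != 0.
Local Notation tc := (tc x w w' y).

Definition rho_gen (g : G) : endo k := tc p g.1.1 g.1.2 g.2.+1.

Lemma free_map_ft i j r : free_map rho_gen (@ft k p i j r) = tc p i j r.
Proof.
case: r => [|r] /=.
  rewrite tc0; case: (i == j); first by rewrite free_map1 scale1r.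
  by rewrite scale0r; exact: raddf0.
case: insubP => [s _ sr|rp]; first by rewrite free_map_gen /rho_gen /= sr.
by rewrite tc_gt; [exact: raddf0 | rewrite ltnS leqNgt].
Qed.

Lemma rho_rel s : rels s -> free_map rho_gen s = 0.
Proof.
move=> [i [j [l [m [r [q [_ _ ->]]]]]]].
transitivity (free_map rho_gen (yrelator (@ft k p) i j l m r q)) => //.
rewrite (yrelator_map _ _ _ _ _ _ _ (@free_mapB _ _ _ _) (@free_mapM _ _ _ _)).
have -> : (fun i j r => free_map rho_gen (@ft k p i j r)) = tc p.
  by apply: funext => i'; apply: funext => j'; apply: funext => r'; rewrite free_map_ft.
by rewrite /yrelator tc_rel // subrr.
Qed.

End Representation.

Lemma yangian_yangian_like : @yangian_like k p Y yt.
Proof.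
split.
- by move=> i j; exact: (rmorph_nat (presented_pi rels)).
- move=> i j [//|r] pr; rewrite /Defs.yt /= insubF; last by rewrite ltnNge -ltnS pr.
  exact: raddf0.
- exact: yangian_rel.
- move=> P P0 P1 PD PZ PX; apply: presented_ind => // -[[i j] s] a Pa.
  have := PX i j s.+1 a _ Pa; rewrite /Defs.yt /= valK ltn_ord => H; exact: H isT.
- move=> x w w' y y0; exists (@presented_map k G rels (endo k) (rho_gen x w w' y)).
  split.
  + exact: presented_mapD (rho_rel x w w' y0).
  + exact: presented_mapM (rho_rel x w w' y0).
  + exact: presented_mapZ (rho_rel x w w' y0).
  + exact: presented_map1 (rho_rel x w w' y0).
  + by move=> i j r; rewrite -free_map_ft; exact: presented_mapE (rho_rel x w w' y0) _.
Qed.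

End ConcreteYangian.

Section YangianPBW.
Variables (k : closedFieldType) (p : nat) (A : algType k) (t : 'I_2 -> 'I_2 -> nat -> A).
Hypothesis tY : yangian_like p t.
Local Notation G := (yangian_gen p).
Local Notation pfun := (pfun k G).

Definition ywt (g : G) : nat := g.2.+1.
Definition ygen (g : G) : A := t g.1.1 g.1.2 (ywt g).

Lemma ywt_gt0 g : (0 < ywt g)%N. Proof. by []. Qed.

Local Notation sym := (@sym k G ywt A ygen).
Local Notation low := (@low k G ywt A ygen).

Definition xt (i j : 'I_2) (r : nat) : pfun :=
  if r is s.+1 then if insub s is Some s' then @pvar k G (i, j, s') else 0
  else (i == j)%:R.

Lemma sym_yt i j r : sym r (t i j r) (xt i j r).
Proof.
case: r => [|r].
  rewrite (yl_t0 tY) /=; case: (i == j); [exact: sym1 | exact: sym0].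
rewrite /xt; case: insubP => [s _ sr|rp]; last first.
  by rewrite (yl_gt tY); [apply: sym0 | rewrite ltnS leqNgt].
have -> : r.+1 = ywt (i, j, s) by rewrite /ywt /= sr.
exact: (sym_gen ywt ygen (i, j, s)).
Qed.

Lemma yl_commutator i j l m r s : (0 < r <= p)%N -> (0 < s <= p)%N ->
  t i j r * t l m s - t l m s * t i j r =
  \sum_(1 <= a < (minn r s).+1)
      (t l j a.-1 * t i m (r + s - a)%N - t l j (r + s - a)%N * t i m a.-1).
Proof. by move=> hr hs; apply/eqP; rewrite -subr_eq0; apply/eqP/(yl_rel tY). Qed.

(** Every product in the commutator has total degree [r + s - 1]. *)
Lemma comm_low u v : low (ywt u + ywt v) (ygen u * ygen v - ygen v * ygen u).
Proof.
have bound (g : G) : (0 < ywt g <= p)%N by rewrite /ywt /= ltn_ord.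
rewrite yl_commutator //; set r := ywt u; set s := ywt v.
rewrite big_nat_cond; elim/big_ind: _ => [|? ? ? ?|a]; [exact: low0 | exact: lowD|].
rewrite andbT ltnS leq_min => /and3P[a0 ar sa].
apply: lowD; last rewrite -scaleN1r; last apply: lowZ.
  apply: (low_lt (n := (a.-1 + (r + s - a))%N)); first by lia.
  by apply: symM; apply: sym_yt.
apply: (low_lt (n := ((r + s - a) + a.-1)%N)); first by lia.
by apply: symM; apply: sym_yt.
Qed.

Lemma yangian_gen_sym (y : A) : exists n f, sym n y f.
Proof.
have raise n m z f : sym n z f -> exists g, sym (n + m) z g.
  case: m => [|m] h; first by exists f; rewrite addn0.
  by exists 0; apply: sym_raise h.
move: y; apply: (yl_ind tY).
- by exists 0%N, 0; apply: sym0.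
- by exists 0%N, 1; apply: sym1.
- move=> x y [n [f hf]] [m [g hg]].
  have [f' hf'] := raise n m x f hf; have [g' hg'] := raise m n y g hg.
  by exists (n + m)%N, (f' + g'); apply: symD => //; rewrite addnC.
- by move=> a x [n [f hf]]; exists n, (a *: f); apply: symZ.
- by move=> i j r x _ [n [f hf]]; exists (r + n)%N, (xt i j r * f); apply: symM => //; apply: sym_yt.
Qed.

(** Acting on the constant function 1 turns a symbol into a number, its value at the point given by
    [tau]. *)
Lemma sym_nice x w w' y (rho : A -> endo k) n z f :
    [/\ {morph rho : a b / a + b}, {morph rho : a b / a * b},
        forall a, {morph rho : b / a *: b}, rho 1 = 1
      & forall i j r, rho (t i j r) = tc x w w' y p i j r] -> sym n z f ->
  nice n (f (fun g => tau (gl_sym x w w' y) p g.1.1 g.1.2 g.2.+1)) (rho z (fun=> 1)).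
Proof.
move=> [rhoD rhoM rhoZ rho1 rhot]; have rho0 : rho 0 = 0.
  by rewrite -(scale0r (0 : A)) rhoZ scale0r.
elim=> {n z f} [n||n z z' f f' _ hf _ hf'|n a z f _ hf|n g z f _ hf|n z f _ hf].
- by rewrite rho0; apply: nice0.
- by rewrite rho1 => c; rewrite size_poly1 coefC.
- by rewrite rhoD endoD pfunD; apply: niceD.
- by rewrite rhoZ endoZ pfunZ; apply: niceZ.
- rewrite rhoM endoM pfunM rhot.
  exact: (@opdeg_tc k x w w' y p g.1.1 g.1.2 (ywt g) n).
- exact: niceW hf.
Qed.

(** For a nonzero symbol, [tau_dominant] finds a product of linear factors where it does not vanish,
    and [gl_sym_surj] a representation with these leading terms. Assuming that the representations
    kill [z], rather than [z = 0], makes it yield faithfulness as well as PBW. *)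
Lemma rho_sym_eq0 z n f :
    (forall x w w' y (rho : A -> endo k), (forall m : nat, y m != 0) ->
      [/\ {morph rho : a b / a + b}, {morph rho : a b / a * b},
        forall a, {morph rho : b / a *: b}, rho 1 = 1
      & forall i j r, rho (t i j r) = tc x w w' y p i j r] -> rho z = 0) ->
  sym n z f -> f = 0.
Proof.
move=> hz h; apply: contrapT => f0.
pose phi (g : G) := @pvar k _ (ywt g, g.1.1, g.1.2).
have [u fu] := pfun_neq0 f0.
have pf : pol (fun=> 1%N) (vlt p) (pfcomp phi f).
  apply: pol_comp (hpol_pol (sym_hpol h)) => g _; apply: pol_var.
  by rewrite /vlt /ywt /= ltn_ord.
have [|N [N0 fN]] := tau_dominant pf.
  (* The point [u] is extended by 0 to the larger index set of [tau_dominant]. *)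
  move=> /(congr1 (fun F => F (fun v => if insub v.1.1.-1 is Some s then u (v.1.2, v.2, s) else 0))).
  move/eqP: fu; rewrite /pfcomp => fu E; apply: fu; rewrite -[RHS]E.
  by congr (f _); apply: funext => -[[i j] s]; rewrite /phi /pvar /= valK.
have [x [w [w' [y [y0 gN]]]]] := gl_sym_surj N0.
have [rho hrho] := yl_rho tY x w w' y0.
have [_] := sym_nice hrho h (fun=> 0).
rewrite (hz _ _ _ _ _ y0 hrho) coef0 gN => /esym E; move/eqP: fN; apply; exact: E.
Qed.

Lemma yangian_pbw n f : sym n 0 f -> f = 0.
Proof.
apply: rho_sym_eq0 => x w w' y rho _ [_ _ rhoZ _ _].
by rewrite -(scale0r (0 : A)) rhoZ scale0r.
Qed.

Lemma rho_faithful (z : A) :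
    (forall x w w' y (rho : A -> endo k), (forall m : nat, y m != 0) ->
      [/\ {morph rho : a b / a + b}, {morph rho : a b / a * b},
        forall a, {morph rho : b / a *: b}, rho 1 = 1
      & forall i j r, rho (t i j r) = tc x w w' y p i j r] -> rho z = 0) ->
  z = 0.
Proof.
move=> hz; have [n [f]] := yangian_gen_sym z.
elim: n f => [|n IH] f h; have f0 := rho_sym_eq0 hz h; rewrite {}f0 in h.
  exact (sym_eq0 ywt_gt0 comm_low h).
by have [g hg] := sym_eq0 ywt_gt0 comm_low h; apply: IH hg.
Qed.

(** In a representation the relation holds for all [r] and [s], and it writes the commutator as a
    sum of commutators of the same kind with smaller [minn r s]. *)
Lemma yt_diag_comm i r s : t i i r * t i i s = t i i s * t i i r.
Proof.
apply/eqP; rewrite -subr_eq0; apply/eqP; apply: rho_faithful => x w w' y rho y0.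
move=> [rhoD rhoM rhoZ rho1 rhot].
rewrite -scaleN1r rhoD rhoZ scaleN1r !rhoM !rhot.
have [m mrs] := ubnP (minn r s); elim: m => // m IH in r s mrs *.
rewrite tc_rel // big_nat big1 // => a /andP[a0]; rewrite ltnS => ars.
apply/eqP; rewrite subr_eq0 -subr_eq0; apply/eqP; apply: IH; lia.
Qed.

End YangianPBW.

(** * The quantum determinant *)

Section QuantumDeterminant.
Variables (k : closedFieldType) (p : nat) (A : algType k) (t : 'I_2 -> 'I_2 -> nat -> A).
Hypothesis tY : yangian_like p t.
Local Notation G := (yangian_gen p).
Local Notation pfun := (pfun k G).
Local Notation xt := (@xt k p).
Local Notation sym := (@sym k G (@ywt p) A (ygen t)).

Definition qT (i j : 'I_2) : {poly A} :=
  (i == j)%:R *: 'X^p + \sum_(1 <= r < p.+1) t i j r *: 'X^(p - r).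

Definition qdetp : {poly A} :=
  qT ix1 ix1 * (qT ix2 ix2 \Po ('X - 1)) - qT ix2 ix1 * (qT ix1 ix2 \Po ('X - 1)).

Definition qdetc (m : nat) : A := qdetp`_(2 * p - m).

(** Coefficient of the commutative determinant: the shift of the argument by 1 changes only terms of
    lower degree. *)
Definition dsym (m : nat) : pfun :=
  \sum_(a < m.+1) (xt ix1 ix1 a * xt ix2 ix2 (m - a) - xt ix2 ix1 a * xt ix1 ix2 (m - a)).

Lemma qTE i j : qT i j = \sum_(r < p.+1) t i j r *: 'X^(p - r).
Proof.
rewrite /qT big_ord_recl subn0 (yl_t0 tY) big_add1 big_mkord; congr (_ + _).
Qed.

Definition bsh n j : k := (('X - 1) ^+ n : {poly k})`_j.

Lemma bsh_gt n j : (n < j)%N -> bsh n j = 0.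
Proof. by move=> nj; rewrite /bsh nth_default // size_exp_XsubC. Qed.

Lemma bsh_diag n : bsh n n = 1.
Proof.
have := monicP (monic_exp n (monicXsubC (1 : k))).
by rewrite lead_coefE size_exp_XsubC /bsh.
Qed.

Lemma coef_XsubC_exp n j : ((('X - 1) ^+ n : {poly A})`_j) = (bsh n j)%:A.
Proof.
have -> : ('X - 1 : {poly A}) = map_poly (in_alg A) ('X - 1).
  by rewrite rmorphB /= map_polyX rmorph1.
by rewrite -rmorphXn coef_map.
Qed.

(** Coefficient of [u^(p - b)] in [T_ij(u - 1)]: [t_ij^(b)] plus a combination of the [t_ij^(r)]
    with [r < b]. *)
Definition ys i j b : A := \sum_(r < p.+1) bsh (p - r) (p - b) *: t i j r.

Lemma coef_qTs i j b : (b <= p)%N ->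
  (qT i j \Po ('X - 1))`_(p - b) = ys i j b.
Proof.
move=> bp; rewrite qTE raddf_sum /= coef_sum; apply: eq_bigr => r _.
have -> : (t i j r *: 'X^(p - r)) \Po ('X - 1) = t i j r *: (('X - 1) ^+ (p - r) : {poly A}).
  by rewrite comp_polyZ comp_Xn_poly.
by rewrite coefZ coef_XsubC_exp mulr_algr.
Qed.

Lemma size_qT i j : (size (qT i j) <= p.+1)%N.
Proof.
rewrite qTE (leq_trans (size_sum _ _ _)) //; apply/bigmax_leqP => r _.
by rewrite (leq_trans (size_scale_leq _ _)) // size_polyXn ltnS leq_subr.
Qed.

Lemma size_qTs i j : (size (qT i j \Po ('X - 1)) <= p.+1)%N.
Proof.
rewrite qTE raddf_sum (leq_trans (size_sum _ _ _)) //=; apply/bigmax_leqP => r _.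
rewrite comp_polyZ comp_Xn_poly (leq_trans (size_scale_leq _ _)) //.
by rewrite size_exp_XsubC ltnS leq_subr.
Qed.

(** Coefficients are counted from the top degree [2n]. The conditionals are there because truncated
    subtraction would read [n - a] as 0 when [a > n]. *)
Lemma coefM_rev (R : nzRingType) (P Q : {poly R}) n m : (m <= 2 * n)%N ->
    (size P <= n.+1)%N -> (size Q <= n.+1)%N ->
  (P * Q)`_(2 * n - m) = \sum_(a < m.+1)
    (if (a <= n)%N then P`_(n - a) else 0) * (if (m - a <= n)%N then Q`_(n - (m - a)) else 0).
Proof.
move=> mn sP sQ; rewrite coefM.
transitivity (\sum_(i < n.+1) \sum_(j < n.+1 | (i + j == 2 * n - m)%N) P`_i * Q`_j).
  transitivity (\sum_(i < (2 * n - m).+1) \sum_(j < n.+1 | (i + j == 2 * n - m)%N) P`_i * Q`_j).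
    apply: eq_bigr => i _; have := leq_ord i => ile.
    have [jn|jn] := leqP (2 * n - m - i) n; last first.
      rewrite [Q`__]nth_default ?mulr0 ?big1 //; first by move=> j /eqP; have := leq_ord j; lia.
      exact: leq_trans sQ _.
    rewrite (big_pred1 (Ordinal (n := n.+1) (m := (2 * n - m - i)%N) jn)) //= => j.
    by rewrite /pred1 /=; apply/eqP/eqP => [E|->]; [apply: val_inj|]; rewrite /=; lia.
  pose F i := \sum_(j < n.+1 | (i + j == 2 * n - m)%N) P`_i * Q`_j.
  rewrite -(big_mkord xpredT F) -[RHS](big_mkord xpredT F).
  have F0 i : (n < i)%N || (2 * n - m < i)%N -> F i = 0.
    move=> hi; rewrite /F big1 // => j /eqP ij; case/orP: hi => hi; last by lia.
    by rewrite [P`_i]nth_default ?mul0r // (leq_trans sP).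
  have [le|le] := leqP (2 * n - m) n.
    rewrite [RHS](big_cat_nat (n := (2 * n - m).+1)) //= [X in _ + X]big_nat [X in _ + X]big1 ?addr0 //.
    by move=> i /andP[i1 _]; rewrite F0 // i1 orbT.
  rewrite (big_cat_nat (n := n.+1)) //=; last by rewrite ltnS ltnW.
  rewrite [X in _ + X]big_nat [X in _ + X]big1 ?addr0 //.
  by move=> i /andP[i1 _]; rewrite F0 // i1.
rewrite (reindex_inj rev_ord_inj) /=.
transitivity (\sum_(a < n.+1) if (a <= m)%N then P`_(n - a) *
    (if (m - a <= n)%N then Q`_(n - (m - a)) else 0) else 0).
  apply: eq_bigr => a _; rewrite subSS; have an := leq_ord a.
  have [am|am] := leqP a m; last first.
    by rewrite big1 // => j /eqP; have := leq_ord j; lia.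
  have [jn|jn] := leqP (m - a) n; last first.
    by rewrite mulr0 big1 // => j /eqP; lia.
  have jn' : (n - (m - a) < n.+1)%N by lia.
  rewrite (big_pred1 (Ordinal jn')) //= => j.
  by rewrite /pred1 /=; apply/eqP/eqP => [E|->]; [apply: val_inj|]; rewrite /=; have := leq_ord j; lia.
pose F a := (if (a <= n)%N && (a <= m)%N then P`_(n - a) * (if (m - a <= n)%N then Q`_(n - (m - a)) else 0) else 0).
transitivity (\sum_(a < n.+1) F a).
  by apply: eq_bigr => a _; rewrite /F (leq_ord a).
transitivity (\sum_(a < m.+1) F a); last first.
  by apply: eq_bigr => a _; rewrite /F (leq_ord a) andbT; case: ifP => // _; rewrite mul0r.
rewrite -(big_mkord xpredT F) -[RHS](big_mkord xpredT F).
have [le|le] := leqP n m.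
  rewrite [RHS](big_cat_nat (n := n.+1)) //= [X in _ + X]big_nat [X in _ + X]big1 ?addr0 //.
  by move=> i /andP[i1 _]; rewrite /F leqNgt i1.
rewrite (big_cat_nat (n := m.+1)) //=; last by rewrite ltnS ltnW.
rewrite [X in _ + X]big_nat [X in _ + X]big1 ?addr0 //.
by move=> i /andP[i1 _]; rewrite /F [(i <= m)%N]leqNgt i1 andbF.
Qed.

Lemma qdetcE m : (m <= 2 * p)%N -> qdetc m =
  \sum_(a < m.+1) (t ix1 ix1 a * (if (m - a <= p)%N then ys ix2 ix2 (m - a) else 0)
                  - t ix2 ix1 a * (if (m - a <= p)%N then ys ix1 ix2 (m - a) else 0)).
Proof.
move=> mp; have coefT i j a : (if (a <= p)%N then (qT i j)`_(p - a) else 0) = t i j a.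
  case: leqP => ap; last by rewrite (yl_gt tY).
  rewrite qTE coef_sum (bigD1 (Ordinal (n := p.+1) (m := a) ap)) //= coefZ coefXn eqxx mulr1.
  rewrite big1 ?addr0 // => r ra; rewrite coefZ coefXn; case: eqP => [E|]; rewrite ?mulr0 //.
  by case/eqP: ra; apply: val_inj => /=; have := leq_ord r; lia.
rewrite /qdetc /qdetp coefB.
rewrite (coefM_rev mp (size_qT ix1 ix1) (size_qTs ix2 ix2)).
rewrite (coefM_rev mp (size_qT ix2 ix1) (size_qTs ix1 ix2)) -sumrB.
apply: eq_bigr => a _; rewrite !coefT; congr (_ * _ - _ * _).
  by case: leqP => // h; rewrite coef_qTs.
by case: leqP => // h; rewrite coef_qTs.
Qed.

Lemma sym_ys i j b : (b <= p)%N -> sym b (ys i j b) (xt i j b).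
Proof.
move=> bp; rewrite /ys (bigD1 (Ordinal (n := p.+1) (m := b) bp)) //= bsh_diag scale1r.
rewrite -[X in sym _ _ X]addr0; apply: symD; first exact: (sym_yt tY).
rewrite [X in sym _ _ X](_ : 0 = \sum_(r < p.+1 | r != Ordinal (n := p.+1) (m := b) bp) 0); last first.
  by rewrite big1.
apply: sym_sum => r rb; have [rltb|br] := ltnP r b.
  by apply: sym_low; apply: lowZ; apply: low_lt (sym_yt tY _ _ r).
rewrite bsh_gt ?scale0r; first exact: sym0.
by move: rb; rewrite -val_eqE /=; have := leq_ord r; lia.
Qed.

Lemma sym_qdet m : (m <= 2 * p)%N -> sym m (qdetc m) (dsym m).
Proof.
move=> mp; rewrite qdetcE //; apply: sym_sum => a _.
have am : (a + (m - a))%N = m by rewrite subnKC // leq_ord.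
rewrite -{1}am; case: leqP => h; first by apply: symB; apply: symM; try exact: (sym_yt tY); apply: sym_ys.
have x0 i j : xt i j (m - a) = 0.
  by case: (m - a)%N h => // s ps; rewrite /= insubF // ltnNge -ltnS ps.
by rewrite !x0 !mulr0 !subrr; apply: sym0.
Qed.

Definition pev (P : {poly A}) (u : k) : A := \sum_(i < size P) u ^+ i *: P`_i.

Lemma pev_horner (P : {poly A}) u : pev P u = P.[u%:A : A].
Proof.
rewrite horner_coef; apply: eq_bigr => i _.
rewrite -mulr_algr; congr (_ * _); elim: (nat_of_ord i) => [|n IH]; first by rewrite !expr0 scale1r.
by rewrite !exprS -IH -scalerAl mul1r scalerA.
Qed.

Lemma horner_algM (P Q : {poly A}) (u : k) : (P * Q).[u%:A : A] = P.[u%:A : A] * Q.[u%:A : A].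
Proof. by apply: hornerM_comm; rewrite /comm_poly mulr_algl mulr_algr. Qed.

Lemma horner_shift (P : {poly A}) (u : k) : (P \Po ('X - 1)).[u%:A : A] = P.[(u - 1)%:A : A].
Proof.
have X1 : ('X - 1 : {poly A}).[u%:A : A] = (u - 1)%:A :> A.
  by rewrite hornerD hornerN hornerX hornerC scalerBl scale1r.
rewrite comp_polyE horner_sum [RHS]horner_coef; apply: eq_bigr => i _ /=.
rewrite hornerZ; congr (_ * _); rewrite -X1; elim: (nat_of_ord i) => [|n IH].
  by rewrite !expr0 hornerC.
by rewrite !exprS horner_algM IH.
Qed.

Lemma qT_horner i j u : (qT i j).[u%:A : A] = \sum_(r < p.+1) u ^+ (p - r) *: t i j r.
Proof.
rewrite -pev_horner /pev; pose F l := u ^+ l *: (qT i j)`_l.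
rewrite (big_ord_widen p.+1 F) ?size_qT // big_mkcond (reindex_inj rev_ord_inj) /=.
apply: eq_bigr => r _; rewrite subSS /F; have rp := leq_ord r.
have <- : (qT i j)`_(p - r) = t i j r.
  rewrite qTE coef_sum (bigD1 r) //= coefZ coefXn eqxx mulr1.
  rewrite big1 ?addr0 // => s rs; rewrite coefZ coefXn; case: eqP => [E|]; rewrite ?mulr0 //.
  by case/eqP: rs; apply: val_inj => /=; have := leq_ord s; lia.
by case: ltnP => // h; rewrite nth_default // scaler0.
Qed.

(** In each representation the determinant at a scalar [u] is some [mulc q], which commutes with the
    [tc]; [poly_coef_eq0] then separates the coefficients, and faithfulness concludes. *)
Lemma qdetc_central_gen m i j r : qdetc m * t i j r = t i j r * qdetc m.
Proof.
apply/eqP; rewrite -subr_eq0; apply/eqP; apply: (rho_faithful tY) => x w w' y rho y0.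
move=> [rhoD rhoM rhoZ rho1 rhot].
have rho0 : rho 0 = 0 by rewrite -(scale0r (0 : A)) rhoZ scale0r.
have rhoB a b : rho (a - b) = rho a - rho b by rewrite -scaleN1r rhoD rhoZ scaleN1r.
have rhoS (I : Type) (s : seq I) (F : I -> A) : rho (\sum_(i <- s) F i) = \sum_(i <- s) rho (F i).
  exact: (big_morph rho rhoD rho0).
pose T := Tmon x w w' y (fun u => u) (fun=> 1) p.
have rhoT i' j' u : rho (qT i' j').[u%:A : A] = T u i' j'.
  rewrite qT_horner rhoS /T TmonE; apply: eq_bigr => a _.
  by rewrite rhoZ rhot expr1n mulr1.
have rhoq u : rho (qdetp.[u%:A : A]) = qminor T u.
  rewrite /qdetp hornerD hornerN !horner_algM !horner_shift rhoB !rhoM.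
  by rewrite !rhoT.
pose a l := rho qdetp`_l * tc x w w' y p i j r - tc x w w' y p i j r * rho qdetp`_l.
have [lt|le] := ltnP (2 * p - m) (size qdetp); last by rewrite /qdetc nth_default // mul0r mulr0 subrr.
rewrite rhoB !rhoM !rhot /qdetc; apply: (@poly_coef_eq0 _ _ (size qdetp) a _ _ lt) => u _.
have [q hq] := qminor_Tmon x w w' y0 p u.
have := mulc_tc x w w' y q p i j r; rewrite -hq -rhoq -pev_horner /pev rhoS.
rewrite mulr_suml mulr_sumr => /eqP; rewrite -subr_eq0 -sumrB => /eqP E.
rewrite -[RHS]E; apply: eq_bigr => l _.
by rewrite rhoZ -scalerAl -scalerAr -scalerBr.
Qed.

Lemma qdetc_central m a : qdetc m * a = a * qdetc m.
Proof.
move: a; apply: (yl_ind tY).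
- by rewrite mulr0 mul0r.
- by rewrite mulr1 mul1r.
- by move=> a b ha hb; rewrite mulrDl mulrDr ha hb.
- by move=> a b hb; rewrite -scalerAl -scalerAr hb.
- by move=> i j r a _ ha; rewrite mulrA qdetc_central_gen -!mulrA ha.
Qed.

End QuantumDeterminant.

(** * Bases over the generators of Gamma *)

Section Elimination.
Variables (k : closedFieldType) (G : eqType) (wt : G -> nat).
Hypothesis wt_gt0 : forall v, (0 < wt v)%N.
Local Notation pfun := (pfun k G).
Local Notation hpol := (@hpol k G wt).
Local Notation gfree := (@gfree k G wt).
Local Notation homs := (@homs k G wt).
Local Notation pvar := (@pvar k G).
Implicit Types (W : pred G) (f g : pfun) (s : seq pfun) (w : seq nat) (l : seq G).

Lemma homs_cat W s1 w1 s2 w2 : homs W s1 w1 -> homs W s2 w2 -> homs W (s1 ++ s2) (w1 ++ w2).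
Proof. by elim: s1 w1 => [|x s1 IH] [|d w1] //= [hx h1] h2; split=> //; apply: IH. Qed.

Definition pkill l f : pfun := fun t => f (fun u => if u \in l then 0 else t u).

Lemma pkill_cons v l f : pkill (v :: l) f = pkill l (psub v 0 f).
Proof.
apply: pfunP => t; rewrite /pkill /psub; congr (f _); apply: funext => u.
by rewrite /upd inE; case: (u == v).
Qed.

Lemma gfree_kill l W s w : uniq l -> {subset l <= W} -> homs W s w ->
    gfree (fun u => W u && (u \notin l)) (map (pkill l) s) w ->
  gfree W (map pvar l ++ s) (map wt l ++ w).
Proof.
elim: l W s => [|v l IH] W s /=.
  move=> _ _ _; rewrite (_ : (fun u => _) = W); last by apply: funext => u; rewrite andbT.
  rewrite (_ : map _ s = s) //; rewrite -[RHS]map_id; apply: eq_map => f.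
  by apply: pfunP.
move=> /andP[vl ul] lW hs fr; rewrite -[pvar v]subr0.
have Wv : W v by apply: lW; rewrite mem_head.
have lW' u : u \in l -> W u by move=> lu; apply: lW; rewrite inE lu orbT.
apply: gfree_var => //; first exact: hpol0.
  by apply: homs_cat => //; apply: homs_map => u lu; apply: hpol_var; apply: lW'.
rewrite map_cat -map_comp (_ : map _ l = map pvar l); last first.
  by apply/eq_in_map => u lu /=; rewrite psub_varN //; apply: contraNneq vl => <-.
apply: IH => //.
- by move=> u lu; rewrite unfold_in /wdel lW' //=; apply: contraNneq vl => <-.
- elim: s w hs {fr} => [|f s IH] [|d w] //= [hf hs]; split; last exact: IH.
  apply: hpol_psub hf; first exact: hpol0.
  by rewrite /wdel => u -> ->.
- rewrite -map_comp (_ : (fun u => _) = fun u => W u && (u \notin v :: l)); last first.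
    by apply: funext => u; rewrite /wdel inE negb_or andbA.
  by rewrite (_ : map _ s = map (pkill (v :: l)) s) //; apply: eq_map => f; rewrite pkill_cons.
Qed.

(** The corrections [g v] and the generators [s] involve only [W0], which avoids [l], so eliminating
    one variable leaves all other generators unchanged. *)
Lemma gfree_elim l W W0 (g : G -> pfun) s w : uniq l -> {subset l <= W} ->
    {subset W0 <= W} -> (forall u, u \in l -> ~~ W0 u) ->
    (forall v, v \in l -> hpol W0 (wt v) (g v)) -> homs W0 s w ->
    gfree (fun u => W u && (u \notin l)) s w ->
  gfree W (map (fun v => pvar v - g v) l ++ s) (map wt l ++ w).
Proof.
elim: l W => [|v l IH] W /=.
  move=> _ _ _ _ _ _; rewrite (_ : (fun u => _) = W) //.
  by apply: funext => u; rewrite andbT.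
move=> /andP[vl ul] lW W0W lW0 hg hs fr.
have Wv : W v by apply: lW; rewrite mem_head.
have lW' u : u \in l -> W u by move=> lu; apply: lW; rewrite inE lu orbT.
have W0v : ~~ W0 v by apply: lW0; rewrite mem_head.
have W0d : {subset W0 <= wdel W v}.
  move=> u W0u; rewrite unfold_in /wdel [W u]W0W //=; apply: contraNneq W0v => <-; exact: W0u.
have hg' u : u \in l -> hpol W0 (wt u) (g u) by move=> lu; apply: hg; rewrite inE lu orbT.
apply: gfree_var => //.
- by apply: hpol_sub W0d _; apply: hg; rewrite mem_head.
- apply: homs_cat; last exact: homs_sub hs.
  apply: homs_map => u lu; apply: hpolB; first by apply: hpol_var; apply: lW'.
  by apply: hpol_sub W0W _; apply: hg'.
- rewrite map_cat -map_comp (_ : map _ l = map (fun v => pvar v - g v) l); last first.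
    apply/eq_in_map => u lu /=; rewrite psubD psubN psub_varN.
      by rewrite (psub_id _ (hg' u lu) W0v).
    by apply: contraNneq vl => <-.
  rewrite (_ : map _ s = s); last first.
    elim: s (w) hs {fr IH} => [|f s IHs] [|d w'] //= [hf hs].
    by rewrite (psub_id _ hf W0v) (IHs w').
  apply: IH => //.
  + by move=> u lu; rewrite unfold_in /wdel lW' //=; apply: contraNneq vl => <-.
  + by move=> u lu; apply: lW0; rewrite inE lu orbT.
  + rewrite (_ : (fun u => _) = fun u => W u && (u \notin v :: l)) //.
    by apply: funext => u; rewrite /wdel inE negb_or andbA.
Qed.

End Elimination.

Section SymbolBasis.
Variables (k : closedFieldType) (p : nat).
Hypothesis p_gt0 : (0 < p)%N.
Local Notation G := (yangian_gen p).
Local Notation pfun := (pfun k G).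
Local Notation xt := (@xt k p).
Local Notation dsym := (@dsym k p).
Local Notation hpol := (@hpol k G (@ywt p)).
Local Notation pvar := (@pvar k G).

(** Stands for [t_ij^(s+1)]; beyond the range [insubd] falls back on a default index, which exists
    because [p] is positive. *)
Definition yvar (i j : 'I_2) (s : nat) : G := (i, j, insubd (Ordinal p_gt0) s).

Lemma ywt_yvar i j s : (s < p)%N -> ywt (yvar i j s) = s.+1.
Proof. by move=> sp; rewrite /ywt /= val_insubd sp. Qed.

Lemma yvar_inj i j s s' : (s < p)%N -> (s' < p)%N -> yvar i j s = yvar i j s' -> s = s'.
Proof. by move=> sp sp' [/(congr1 val)]; rewrite !val_insubd sp sp'. Qed.

Lemma xt_yvar i j r : (0 < r <= p)%N -> xt i j r = pvar (yvar i j r.-1).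
Proof.
case: r => // r /= rp; rewrite insubT /=; congr (pvar (_, _)).
by apply: val_inj; rewrite val_insubd rp.
Qed.

Lemma xt_gt i j r : (p < r)%N -> xt i j r = 0.
Proof. by case: r => // s ps; rewrite /(xt _ _ _) insubF // ltnNge -ltnS ps. Qed.

Definition wof (i j : 'I_2) : pred G := fun g => g.1 == (i, j).

Lemma hpol_xt i j r (W : pred G) : {subset wof i j <= W} -> hpol W r (xt i j r).
Proof.
move=> sW; case: (posnP r) => [->|r0].
  by rewrite /=; case: (i == j); [apply: hpol1 | apply: hpol0].
have [rp|pr] := leqP r p; last by rewrite xt_gt //; apply: hpol0.
rewrite xt_yvar ?r0 // -{1}(prednK r0) -(@ywt_yvar i j); last by rewrite prednK.
by apply: hpol_var; apply: (sW (yvar i j r.-1)); rewrite unfold_in /wof.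
Qed.

Definition woff : pred G := fun g => wof ix1 ix2 g || wof ix2 ix1 g.

Definition goff (m : nat) : pfun := \sum_(a < m.+1) xt ix2 ix1 a * xt ix1 ix2 (m - a).

Lemma hpol_goff m : hpol woff m (goff m).
Proof.
rewrite /goff; elim/big_ind: _ => [||a _]; [exact: hpol0 | exact: hpolD|].
have am : (a + (m - a))%N = m by rewrite subnKC // leq_ord.
rewrite -{1}am; apply: hpolM; apply: hpol_xt => g;
  by rewrite !unfold_in /woff /wof => /eqP ->.
Qed.

Definition vars22 : seq G := [seq yvar ix2 ix2 s | s <- iota 0 p].
Definition vars11 : seq G := [seq yvar ix1 ix1 s | s <- iota 0 p].

Lemma mem_vars i j (g : G) : (g \in [seq yvar i j s | s <- iota 0 p]) = (g.1 == (i, j)).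
Proof.
apply/mapP/eqP => [[s _ ->] //|]; case: g => [[i' j'] s] /= [-> ->].
exists (val s); first by rewrite mem_iota /= add0n ltn_ord.
by congr (_, _); apply: val_inj; rewrite val_insubd ltn_ord.
Qed.

Lemma uniq_vars i j : uniq [seq yvar i j s | s <- iota 0 p].
Proof.
rewrite map_inj_in_uniq ?iota_uniq // => s s'; rewrite !mem_iota /= !add0n.
exact: yvar_inj.
Qed.

Lemma pkill_xt i j r : (i, j) != (ix2, ix2) -> pkill vars22 (xt i j r) = xt i j r.
Proof.
move=> ij; case: r => [|r] /=; first by case: (i == j).
case: insubP => // s _ _; apply: pfunP => t; rewrite /pkill /(pvar _) mem_vars /=.
by rewrite (negPf ij).
Qed.

(** Of all the [t_22^(r)] only [t_22^(0) = 1] survives. *)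
Lemma pkill_dsym m : pkill vars22 (dsym m) = xt ix1 ix1 m - goff m.
Proof.
have pk22 r : pkill vars22 (xt ix2 ix2 r) = (r == 0%N)%:R.
  case: r => [|r] //=; case: insubP => // s _ _; apply: pfunP => t.
  by rewrite /pkill /(pvar _) mem_vars eqxx.
have pkS (I : finType) (F : I -> pfun) : pkill vars22 (\sum_a F a) = \sum_a pkill vars22 (F a).
  by apply: pfunP => t; rewrite /pkill !fct_sumE.
rewrite /dsym pkS (eq_bigr (fun a : 'I_m.+1 => xt ix1 ix1 a * (m - a == 0)%N%:R -
   xt ix2 ix1 a * xt ix1 ix2 (m - a))); last first.
  move=> a _; rewrite -pk22 -[in RHS](@pkill_xt ix1 ix1) // -[in X in _ = _ - X](@pkill_xt ix2 ix1) //.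
  by rewrite -[in X in _ = _ - X](@pkill_xt ix1 ix2).
rewrite sumrB big_ord_recr /= subnn mulr1 big1 ?add0r // => a _.
by rewrite subn_eq0 leqNgt ltn_ord mulr0.
Qed.

(** Since [2p - m > p], only the [t_21^(a)] with [p - m <= a <= p] contribute. Counting indices
    downward from [p] makes these [m + 1] products a convolution. *)
Lemma goff_convol m : (m < p)%N -> - goff (2 * p - m) =
  convol (fun i => yvar ix2 ix1 (p - i.+1)) (fun i => yvar ix1 ix2 (p - i.+1)) m :> pfun.
Proof.
move=> mp; rewrite /goff /convol; congr (- _).
pose F a := xt ix2 ix1 a * xt ix1 ix2 (2 * p - m - a).
rewrite -(big_mkord xpredT F).
rewrite (big_cat_nat (n := (p - m)%N)) //=; last by lia.
rewrite big_nat big1 ?add0r; last first.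
  by move=> a /andP[_ ha]; rewrite /F (xt_gt ix1); [rewrite mulr0 | lia].
rewrite (big_cat_nat (n := p.+1)) //=; [|lia|lia].
rewrite [X in _ + X]big_nat [X in _ + X]big1 ?addr0; last first.
  by move=> a /andP[ha _]; rewrite /F xt_gt // mul0r.
rewrite -{1}[(p - m)%N]add0n big_addn.
have -> : (p.+1 - (p - m) = m.+1)%N by lia.
rewrite big_nat_rev /= big_mkord; apply: eq_bigr => i _; have im := leq_ord i.
rewrite /F add0n subSS !xt_yvar; [|lia|lia].
by congr (pvar (yvar _ _ _) * pvar (yvar _ _ _)); lia.
Qed.

(** The upper determinant coefficients are listed downward from [d_2p], the order required by
    [gfree_convol]. *)
Definition gsyms : seq pfun := [seq xt ix2 ix2 r | r <- iota 1 p] ++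
  ([seq dsym m | m <- iota 1 p] ++ [seq dsym (2 * p - m) | m <- iota 0 p]).
Definition gwts : seq nat := iota 1 p ++ (iota 1 p ++ [seq (2 * p - m)%N | m <- iota 0 p]).

Lemma hpol_dsym m : hpol predT m (dsym m).
Proof.
rewrite /dsym; elim/big_ind: _ => [||a _]; [exact: hpol0 | exact: hpolD|].
have am : (a + (m - a))%N = m by rewrite subnKC // leq_ord.
by rewrite -{1}am; apply: hpolB; apply: hpolM; apply: hpol_xt.
Qed.

Lemma iota1 n : iota 1 n = [seq s.+1 | s <- iota 0 n].
Proof. by rewrite -[1%N]addn0 iotaDl. Qed.

(** The [t_22^(r)] are set to 0; each [d_m] with [m <= p] is solved for [t_11^(m)]; for [m > p]
    there is no [t_11^(m)], and the [d_m] are convolutions in the off-diagonal variables alone. *)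
Lemma gsyms_free : gfree (@ywt p) predT gsyms gwts.
Proof.
have lt_iota s : s \in iota 0 p -> (s < p)%N by rewrite mem_iota.
have wvars i j : [seq ywt v | v <- [seq yvar i j s | s <- iota 0 p]] = iota 1 p.
  rewrite iota1 -map_comp; apply/eq_in_map => s /lt_iota sp /=.
  by rewrite ywt_yvar.
have -> : gsyms = map pvar vars22 ++ ([seq dsym m | m <- iota 1 p] ++ [seq dsym (2 * p - m) | m <- iota 0 p]).
  congr (_ ++ _); rewrite /vars22 iota1 -!map_comp; apply/eq_in_map => s /lt_iota sp.
  by rewrite /comp xt_yvar.
have -> : gwts = map (@ywt p) vars22 ++ (map (@ywt p) vars11 ++ [seq (2 * p - m)%N | m <- iota 0 p]).
  by rewrite /vars22 /vars11 !wvars.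
apply: gfree_kill => //.
- exact: uniq_vars.
- rewrite /vars11 wvars -[X in homs _ _ _ (X ++ _)]map_id; apply: homs_cat; apply: homs_map => m _; exact: hpol_dsym.
set w11 := map (@ywt p) vars11; rewrite map_cat -!map_comp.
have -> : map (pkill vars22 \o dsym) (iota 1 p) =
    map (fun v => pvar v - goff (ywt v)) vars11.
  rewrite /vars11 iota1 -!map_comp; apply/eq_in_map => s /lt_iota sp.
  by rewrite /comp pkill_dsym ywt_yvar // xt_yvar.
have -> : map (pkill vars22 \o (fun m => dsym (2 * p - m))) (iota 0 p) =
    map (convol (fun i => yvar ix2 ix1 (p - i.+1)) (fun i => yvar ix1 ix2 (p - i.+1))) (iota 0 p).
  apply/eq_in_map => m /lt_iota mp; rewrite /comp pkill_dsym xt_gt; last by lia.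
  by rewrite sub0r goff_convol.
rewrite /w11; apply: (@gfree_elim _ _ (@ywt p) (fun=> isT) vars11 _ woff (fun v => goff (ywt v))) => //.
- exact: uniq_vars.
- by move=> g; rewrite mem_vars unfold_in /vars22 mem_vars => /eqP ->.
- by move=> g; rewrite unfold_in /woff /wof unfold_in mem_vars => /orP[] /eqP ->.
- by move=> g; rewrite mem_vars /woff /wof => /eqP ->.
- by move=> g _; apply: hpol_goff.
- set c := convol _ _; have -> : map c (iota 0 p) = map (fun m => - goff (2 * p - m)) (iota 0 p).
    by apply/eq_in_map => m /lt_iota mp; rewrite goff_convol.
  by apply: homs_map => m _; apply: hpolN; apply: hpol_goff.
- apply: (@gfree_convol k G (@ywt p) (fun=> isT) p (enum {: G}) _ (fun i => yvar ix2 ix1 (p - i.+1))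
    (fun i => yvar ix1 ix2 (p - i.+1)) (fun m => 2 * p - m)%N) => //.
  + by move=> g _; rewrite mem_enum.
  + by move=> i ip; rewrite !mem_vars.
  + by move=> i j ip jp /yvar_inj; lia.
  + by move=> i j ip jp /yvar_inj; lia.
  + by move=> i j ij; rewrite !ywt_yvar; lia.
Qed.

End SymbolBasis.

(** * Lifting the basis of symbols *)

Section YangianBasis.
Variables (k : closedFieldType) (p : nat) (A : algType k) (t : 'I_2 -> 'I_2 -> nat -> A).
Hypotheses (p_gt0 : (0 < p)%N) (tY : yangian_like p t).
Local Notation G := (yangian_gen p).
Local Notation sym := (@sym k G (@ywt p) A (ygen t)).
Local Notation qdetc := (qdetc p t).

Definition ggens : seq A := [seq t ix2 ix2 r | r <- iota 1 p] ++
  ([seq qdetc m | m <- iota 1 p] ++ [seq qdetc (2 * p - m) | m <- iota 0 p]).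

Lemma ggens_comm x y : x \in ggens -> y \in ggens -> x * y = y * x.
Proof.
have central z : z \in [seq qdetc m | m <- iota 1 p] ++ [seq qdetc (2 * p - m) | m <- iota 0 p] ->
    forall a, z * a = a * z.
  by rewrite mem_cat => /orP[] /mapP[m _ ->] a; apply: (qdetc_central tY).
rewrite /ggens !(mem_cat _ (map _ (iota 1 p)) (_ ++ _)) => /orP[/mapP[r _ ->]|/central hx _]; last exact: hx.
by case/orP=> [/mapP[s _ ->]|/central ->] //; apply: (yt_diag_comm tY).
Qed.

Lemma syms_ggens : syms (@ywt p) (ygen t) ggens (gsyms k p) (gwts p).
Proof.
rewrite /gwts -[X in syms _ _ _ _ (X ++ _)]map_id -[X in syms _ _ _ _ (_ ++ (X ++ _))]map_id.
apply: syms_cat; last apply: syms_cat; apply: syms_map => m.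
- by move=> _; apply: sym_yt.
- by rewrite mem_iota => hm; apply: sym_qdet => //; lia.
- by rewrite mem_iota => hm; apply: sym_qdet => //; lia.
Qed.

Definition gfam (J : Type) (e : seq nat * J -> A) : Prop :=
  (forall y, lspan (fun x => exists2 i, size i.1 = size ggens & x = e i) y).

Definition gfam_indep (J : eqType) (e : seq nat * J -> A) : Prop :=
  forall (r : seq (seq nat * J)) (c : seq nat * J -> k), uniq r ->
    (forall i, i \in r -> size i.1 = size ggens) ->
    \sum_(i <- r) c i *: e i = 0 -> forall i, i \in r -> c i = 0.

(** Symbols commute, so a monomial times [b j] and [b j] times the monomial have the same symbol,
    and one choice of lifts serves both sides. *)
Theorem yangian_basis : exists (J : choiceType) (b : J -> A) (j0 : J),
  [/\ b j0 = 1,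
      gfam (fun i => mexp ggens i.1 * b i.2), gfam_indep (fun i => mexp ggens i.1 * b i.2),
      gfam (fun i => b i.2 * mexp ggens i.1) & gfam_indep (fun i => b i.2 * mexp ggens i.1)].
Proof.
have [J [be [d [[j0 bj0 dj0] hb sp ind]]]] := gsyms_free k p_gt0.
have lift j : exists y, sym (d j) y (be j) by have := hpol_sym (ygen t) (hb j).
have [b [bj hbs]] : exists b : J -> A, b j0 = 1 /\ forall j, sym (d j) (b j) (be j).
  (* The basis element 1 is lifted to 1 itself, so that its multiples are exactly Gamma. *)
  have /choice[b hbs] := lift; exists (fun j => if j == j0 then 1 else b j).
  rewrite eqxx; split=> // j; case: eqP => [->|_]; last exact: hbs.
  by rewrite bj0 dj0; apply: sym1.
have sz : size (gsyms k p) = size ggens by rewrite !size_cat !size_map.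
pose P (i : seq nat * J) := size i.1 = size ggens.
pose q (i : seq nat * J) := mexp (gsyms k p) i.1 * be i.2.
pose dd (i : seq nat * J) := (wdeg (gwts p) i.1 + d i.2)%N.
have hL i : P i -> sym (dd i) (mexp ggens i.1 * b i.2) (q i).
  by move=> _; apply: symM => //; apply: sym_mexp syms_ggens.
have hR i : P i -> sym (dd i) (b i.2 * mexp ggens i.1) (q i).
  by move=> _; rewrite /dd /q addnC mulrC; apply: symM => //; apply: sym_mexp syms_ggens.
have sp' n f : hpol (@ywt p) predT n f -> lspan (fun x => exists2 i, P i /\ dd i = n & x = q i) f.
  move=> /sp; apply: lspan_sub => _ [a [j [sa wa ->]]]; exists (a, j) => //.
  by split=> //; rewrite /P /= -sz.
have ind' (r : seq (seq nat * J)) (c : seq nat * J -> k) : uniq r -> (forall i, i \in r -> P i) ->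
    \sum_(i <- r) c i *: q i = 0 -> forall i, i \in r -> c i = 0.
  by move=> ur rP; apply: ind => // i /rP; rewrite sz.
have span := sym_span (@ywt_gt0 p) (comm_low tY) (yangian_gen_sym tY).
have indep := sym_indep (@yangian_pbw _ _ _ _ tY).
exists J, b, j0; split=> //.
- exact: span hL sp'.
- exact: indep hL ind'.
- exact: span hR sp'.
- exact: indep hR ind'.
Qed.

End YangianBasis.

(** * Module bases *)

Section ModuleBasis.
Variables (R : nzRingType) (M : lmodType R) (J : choiceType) (b : J -> M).

Definition mod_basis : Prop :=
  (forall x, lspan (fun y => exists2 j, True & y = b j) x) /\
  forall (s : seq J) (c : J -> R), uniq s ->
    \sum_(j <- s) c j *: b j = 0 -> forall j, j \in s -> c j = 0.

Hypothesis basis_b : mod_basis.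

Lemma msupp_sum (c : {malg R[J]}) (s : seq J) : uniq s -> {subset msupp c <= s} ->
  \sum_(j <- msupp c) c@_j *: b j = \sum_(j <- s) c@_j *: b j.
Proof.
move=> us cs; rewrite [RHS](bigID (fun j => j \in msupp c)) /= [X in _ + X]big1 ?addr0.
  rewrite -[RHS]big_filter; apply: perm_big; apply: uniq_perm; rewrite ?filter_uniq //.
  by move=> j; rewrite mem_filter; case: (boolP (j \in msupp c)) => // /cs ->.
by move=> j /mcoeff_outdom ->; rewrite scale0r.
Qed.

Lemma mod_basis_free : free_module M.
Proof.
have [sp ind] := basis_b; exists J, b.
pose Phi (c : {malg R[J]}) := \sum_(j <- msupp c) c@_j *: b j.
have inj : injective Phi.
  move=> c c' E; apply/malgP => j; apply/eqP; rewrite -subr_eq0; apply/eqP.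
  pose s := undup (msupp c ++ msupp c').
  have us : uniq s by apply: undup_uniq.
  have [js|js] := boolP (j \in s); last first.
    move: js; rewrite mem_undup mem_cat negb_or => /andP[/mcoeff_outdom -> /mcoeff_outdom ->].
    by rewrite subrr.
  apply: (ind s (fun j => c@_j - c'@_j) us _ j js).
  under eq_bigr => i _ do rewrite scalerBl.
  rewrite sumrB -!msupp_sum //; first by apply/eqP; rewrite subr_eq0; apply/eqP.
    by move=> i ci; rewrite mem_undup mem_cat ci orbT.
  by move=> i ci; rewrite mem_undup mem_cat ci.
have surj x : exists c, Phi c = x.
  have [s [c0 [us _ ->]]] := lspan_uniq (sp x).
  pose c : {malg R[J]} := \sum_(j <- s) << c0 j *g j >>.
  have cE j : c@_j = if j \in s then c0 j else 0.
    rewrite /c raddf_sum /=; case: ifP => js.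
      rewrite (bigD1_seq j) //= mcoeffUU big1 ?addr0 // => i /negPf ij.
      by rewrite mcoeffU ij.
    by rewrite big_seq big1 // => i si; rewrite mcoeffU; case: eqP si js => // -> ->.
  exists c; rewrite /Phi (msupp_sum us).
    by apply: eq_big_seq => j js; rewrite cE js.
  by move=> j; rewrite -mcoeff_neq0 cE; case: ifP => //; rewrite eqxx.
have /choice[g gK] := surj.
by exists g => [c|x]; [apply: inj; rewrite gK | apply: gK].
Qed.

Lemma mod_basis_summand (j0 : J) : direct_summand [set x | exists r, x = r *: b j0].
Proof.
have [sp ind] := basis_b; split.
  split=> [|a u v]; rewrite ?inE; first by exists 0; rewrite scale0r.
  by move=> [r ->] [r' ->]; exists (a * r + r'); rewrite scalerDl scalerA.
exists [set x | lspan (fun y => exists2 j, j != j0 & y = b j) x]; split.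
- split=> [|a u v]; rewrite ?inE /=; first exact: lspan0.
  by move=> su sv; apply: lspanD => //; apply: lspanZ.
- apply/seteqP; split=> [x /= [[r xE] /lspan_uniq[s [c [us sP xE']]]]|_ ->]; last first.
    by split; [exists 0; rewrite scale0r | apply: lspan0].
  have j0s : j0 \notin s by apply/negP => /sP; rewrite eqxx.
  rewrite xE; suff -> : r = 0 by rewrite scale0r.
  have := ind (j0 :: s) (fun j => if j == j0 then r else - c j) _ _ j0 (mem_head _ _).
  rewrite eqxx; apply; first by rewrite /= j0s.
  rewrite big_cons eqxx -xE xE' -big_split big_seq big1 // => j js /=.
  by case: eqP js j0s => [-> -> //|_ _ _]; rewrite -scalerDl subrr scale0r.
- move=> x; elim: (sp x) => [|a y z [j _ ->] _ [u [v [[r ->] hv ->]]]].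
    by exists 0, 0; split; [exists 0; rewrite scale0r | apply: lspan0 | rewrite addr0].
  have [->|jj0] := eqVneq j j0.
    exists ((a + r) *: b j0), v; split=> //; first by exists (a + r).
    by rewrite scalerDl addrA.
  exists (r *: b j0), (a *: b j + v); split=> //; first by exists r.
    by apply: lspanC => //; exists j.
  by rewrite addrCA.
Qed.

End ModuleBasis.

Section RegularModules.
Variables (k : closedFieldType) (A : algType k) (R : nzRingType) (f : {rmorphism R -> A}).
Variables (g : seq A) (J : choiceType) (b : J -> A).
Local Notation mono a := (mexp g a).
Local Notation P i := (size i.1 = size g).
Hypothesis f_inj : injective f.
Hypothesis f_mono : forall a c, size a = size g -> exists r, f r = c *: mono a.
Hypothesis f_span : forall r, lspan (fun x => exists2 a, size a = size g & x = mono a) (f r).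

(** Expanding each coefficient in monomials reduces independence over [R] to independence over [k].
    The function [act] stands for multiplication on either side. *)
Lemma coef_split (e : seq nat -> J -> A) (s : seq J) (c : J -> R) (act : R -> J -> A) :
    (forall r j (l : seq (seq nat)) (h : seq nat -> k),
        f r = \sum_(a <- l) h a *: mono a -> act r j = \sum_(a <- l) h a *: e a j) ->
    (forall (r : seq (seq nat * J)) (h : seq nat * J -> k), uniq r ->
      (forall i, i \in r -> P i) ->
      \sum_(i <- r) h i *: e i.1 i.2 = 0 -> forall i, i \in r -> h i = 0) ->
    uniq s -> \sum_(j <- s) act (c j) j = 0 -> forall j, j \in s -> c j = 0.
Proof.
move=> hact ind us S0 j js.
have ex (j' : J) : exists lh : seq (seq nat) * (seq nat -> k),
    [/\ uniq lh.1, forall a, a \in lh.1 -> size a = size g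
      & f (c j') = \sum_(a <- lh.1) lh.2 a *: mono a].
  by have [l [h [ul lP ->]]] := lspan_uniq (f_span (c j')); exists (l, h).
have /choice[lh hlh] := ex.
pose r := [seq (a, j') | j' <- s, a <- (lh j').1].
have ur : uniq r.
  apply: allpairs_uniq_dep => // [j' _|[j1 a1] [j2 a2] _ _ /= [-> ->] //].
  by have [] := hlh j'.
have rP i : i \in r -> P i.
  by move=> /allpairsPdep[j' [a [_ ha ->]]]; have [_ lP _] := hlh j'; apply: lP.
have h0 : forall i, i \in r -> (lh i.2).2 i.1 = 0.
  apply: (ind r (fun i => (lh i.2).2 i.1) ur rP).
  rewrite big_allpairs_dep -[RHS]S0; apply: eq_bigr => j' _ /=.
  by have [_ _ /hact ->] := hlh j'.
apply: f_inj; rewrite rmorph0; have [_ _ ->] := hlh j.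
rewrite big_seq big1 // => a ha; have := h0 (a, j); rewrite /= => ->; rewrite ?scale0r //.
by apply/allpairsPdep; exists j, a.
Qed.

Lemma left_reg_basis :
    (forall y, lspan (fun x => exists2 i, P i & x = mono i.1 * b i.2) y) ->
    (forall (r : seq (seq nat * J)) (h : seq nat * J -> k), uniq r ->
      (forall i, i \in r -> P i) ->
      \sum_(i <- r) h i *: (mono i.1 * b i.2) = 0 -> forall i, i \in r -> h i = 0) ->
  @mod_basis R (left_reg f) J b.
Proof.
move=> sp ind; split=> [x|s c us S0].
  elim: (sp x) => [|a y z [i Pi ->] _ sz]; first exact: lspan0.
  have [r fr] := f_mono a Pi.
  have -> : a *: (mono i.1 * b i.2) + z = (r *: (b i.2 : left_reg f)) + (z : left_reg f).
    by rewrite scalerAl -fr.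
  by apply: lspanC => //; exists i.2.
apply: (coef_split (e := fun a j => mono a * b j) (act := fun r j => f r * b j)) S0 => //.
by move=> r j l h ->; rewrite mulr_suml; apply: eq_bigr => a _; rewrite scalerAl.
Qed.

Lemma right_reg_basis :
    (forall y, lspan (fun x => exists2 i, P i & x = b i.2 * mono i.1) y) ->
    (forall (r : seq (seq nat * J)) (h : seq nat * J -> k), uniq r ->
      (forall i, i \in r -> P i) ->
      \sum_(i <- r) h i *: (b i.2 * mono i.1) = 0 -> forall i, i \in r -> h i = 0) ->
  @mod_basis R^c (right_reg f) J b.
Proof.
move=> sp ind; split=> [x|s c us S0].
  elim: (sp x) => [|a y z [i Pi ->] _ sz]; first exact: lspan0.
  have [r fr] := f_mono a Pi.
  have -> : a *: (b i.2 * mono i.1) + z = ((r : R^c) *: (b i.2 : right_reg f)) + (z : right_reg f).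
    by rewrite scalerAr -fr.
  by apply: lspanC => //; exists i.2.
apply: (coef_split (e := fun a j => b j * mono a) (act := fun r j => b j * f r)) S0 => //.
by move=> r j l h ->; rewrite mulr_sumr; apply: eq_bigr => a _; rewrite scalerAr.
Qed.

End RegularModules.

Section CommutingMonomials.
Variables (k : closedFieldType) (A : algType k).

Lemma mexp_comm (g : seq A) x a : (forall y, y \in g -> x * y = y * x) ->
  x * mexp g a = mexp g a * x.
Proof.
elim: g a => [|y g IH] [|i a] hx /=; rewrite ?mulr1 ?mul1r //.
have xy : GRing.comm x (y ^+ i) by apply: commrX; apply: hx; rewrite mem_head.
rewrite mulrA xy -mulrA IH ?mulrA // => z zg.
by apply: hx; rewrite inE zg orbT.
Qed.

Lemma mexpD (g : seq A) a a' : (forall x y, x \in g -> y \in g -> x * y = y * x) ->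
    size a = size g -> size a' = size g ->
  mexp g a * mexp g a' = mexp g [seq (i.1 + i.2)%N | i <- zip a a'].
Proof.
elim: g a a' => [|y g IH] [|i a] [|i' a'] //= hg; first by rewrite mulr1.
move=> [sa] [sa']; rewrite -IH //; last by move=> u v ug vg; apply: hg; rewrite inE ?ug ?vg orbT.
rewrite exprD !mulrA; congr (_ * _); rewrite -!mulrA; congr (_ * _).
apply/esym/mexp_comm => z zg; apply: commr_sym; apply: commrX; apply: hg.
  by rewrite inE zg orbT.
exact: mem_head.
Qed.

Lemma mexp_gen (g : seq A) x : x \in g ->
  exists2 a, size a = size g & mexp g a = x.
Proof.
elim: g => [|y g IH] //; rewrite inE => /orP[/eqP ->|/IH[a sa ax]].
  exists (1%N :: nseq (size g) 0%N); rewrite /= ?size_nseq // expr1.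
  suff -> : mexp g (nseq (size g) 0%N) = 1 by rewrite mulr1.
  by elim: g {IH} => //= z g ->; rewrite expr0 mulr1.
by exists (0%N :: a); rewrite /= ?sa // expr0 mul1r.
Qed.

Lemma mexp_nil (g : seq A) : exists2 a, size a = size g & mexp g a = 1.
Proof.
exists (nseq (size g) 0%N); first by rewrite size_nseq.
by elim: g => //= z g ->; rewrite expr0 mulr1.
Qed.

Lemma subalg_gen_mono (g : seq A) (S : set A) :
    (forall x y, x \in g -> y \in g -> x * y = y * x) -> (forall x, S x -> x \in g) ->
  forall x, x \in subalg_gen S ->
    lspan (fun x => exists2 a, size a = size g & x = mexp g a) x.
Proof.
move=> hg Sg x /asboolP; pose B : {pred A} := fun x =>
  `[< lspan (fun x => exists2 a, size a = size g & x = mexp g a) x >].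
move=> /(_ B) H; apply/asboolP; apply: H; last first.
  by move=> s /Sg/mexp_gen[a sa ax]; apply/asboolP/lspan_gen; exists a.
split.
- by apply/asboolP/lspan_gen; have [a sa a1] := mexp_nil g; exists a.
- by move=> a u v /asboolP su /asboolP sv; apply/asboolP/lspanD => //; apply: lspanZ.
- move=> u v /asboolP su /asboolP sv; apply/asboolP.
  elim: su => [|a y z [e se ->] _ IH]; first by rewrite mul0r; apply: lspan0.
  rewrite mulrDl; apply: lspanD => //; rewrite -scalerAl; apply: lspanZ.
  elim: sv {IH} => [|a' y' z' [e' se' ->] _ IH]; first by rewrite mulr0; apply: lspan0.
  rewrite mulrDr -scalerAr; apply: lspanC => //.
  rewrite mexpD //; exists [seq (i.1 + i.2)%N | i <- zip e e'] => //.
  by rewrite size_map size_zip se se' minnn.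
Qed.

Lemma mexp_subalg (g : seq A) (S : set A) c a : (forall x, x \in g -> S x) ->
  c *: mexp g a \in subalg_gen S.
Proof.
move=> gS; apply: rpredZ; elim: g a gS => [|x g IH] [|i a] gS /=; rewrite ?rpred1 //.
apply: rpredM; last by apply: IH => y yg; apply: gS; rewrite inE yg orbT.
apply: rpredX; apply/asboolP => B _; apply; apply: gS; exact: mem_head.
Qed.

End CommutingMonomials.

(** * Weight spaces *)

Section Weights.
Variables (k : closedFieldType) (A R : algType k) (f : {rmorphism R -> A}) (M : lmodType A).
Hypothesis mulRC : forall r s : R, r * s = s * r.
Implicit Types (r s : R) (x y u v : M) (m n : set R).

Definition act r x : M := f r *: x.
Local Notation "r .* x" := (act r x) (at level 40).

Lemma actD r x y : r .* (x + y) = r .* x + r .* y. Proof. exact: scalerDr. Qed.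
Lemma actB r x y : r .* (x - y) = r .* x - r .* y. Proof. exact: scalerBr. Qed.
Lemma act0r r : r .* 0 = 0. Proof. exact: scaler0. Qed.
Lemma actDl r s x : (r + s) .* x = r .* x + s .* x.
Proof. by rewrite /act rmorphD scalerDl. Qed.
Lemma actBl r s x : (r - s) .* x = r .* x - s .* x.
Proof. by rewrite /act rmorphB scalerBl. Qed.
Lemma act0l x : 0 .* x = 0. Proof. by rewrite /act rmorph0 scale0r. Qed.
Lemma act1 x : 1 .* x = x. Proof. by rewrite /act rmorph1 scale1r. Qed.
Lemma actM r s x : (r * s) .* x = r .* (s .* x).
Proof. by rewrite /act rmorphM scalerA. Qed.
Lemma actC r s x : r .* (s .* x) = s .* (r .* x).
Proof. by rewrite -!actM mulRC. Qed.
Lemma act_sum (I : Type) (l : seq I) (P : pred I) (F : I -> M) r :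
  r .* (\sum_(i <- l | P i) F i) = \sum_(i <- l | P i) r .* F i.
Proof. exact: scaler_sumr. Qed.
Lemma act_suml (I : Type) (l : seq I) (P : pred I) (F : I -> R) x :
  (\sum_(i <- l | P i) F i) .* x = \sum_(i <- l | P i) F i .* x.
Proof. by rewrite /act rmorph_sum scaler_suml. Qed.

(** [weight_space] for an abstract commutative algebra [R] in place of Gamma. *)
Definition wspace m : set M :=
  [set x | exists e : nat, forall g, ideal_exp m e g -> f g *: x = 0].

Lemma wspace_raise m e d x : (forall g, ideal_exp m e g -> f g *: x = 0) ->
  forall g, ideal_exp m (d + e) g -> f g *: x = 0.
Proof.
move=> hx; elim: d => [|d IH] // g [l [a [b [ab ->]]]].
rewrite -/(act _ _) act_suml big1 // => i _; have [_ /IH bx] := ab i.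
by rewrite actM [b i .* x]bx act0r.
Qed.

Lemma wspaceD m x y : wspace m x -> wspace m y -> wspace m (x + y).
Proof.
move=> [e hx] [d hy]; exists (e + d)%N => g hg; rewrite scalerDr.
have hg' : ideal_exp m (d + e) g by rewrite addnC.
by rewrite (wspace_raise hx hg') (wspace_raise hy hg) addr0.
Qed.

Lemma wspace0 m : wspace m 0.
Proof. by exists 0%N => g _; rewrite scaler0. Qed.

Lemma wspace_act m r x : wspace m x -> wspace m (r .* x).
Proof. by move=> [e hx]; exists e => g hg; rewrite -/(act g _) actC [g .* x]hx // act0r. Qed.

Lemma wspaceB m x y : wspace m x -> wspace m y -> wspace m (x - y).
Proof.
move=> wx wy; apply: wspaceD => //.
have -> : - y = (- 1) .* y by rewrite /act rmorphN1 scaleN1r.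
exact: wspace_act.
Qed.

Lemma wspace_sum m (I : Type) (l : seq I) (P : pred I) (F : I -> M) :
  (forall i, P i -> wspace m (F i)) -> wspace m (\sum_(i <- l | P i) F i).
Proof. by move=> h; elim/big_ind: _ => //; [apply: wspace0 | apply: wspaceD]. Qed.

Lemma ideal_exp_pow m r e : m r -> ideal_exp m e (r ^+ e).
Proof.
move=> mr; elim: e => [|e IH] //; exists 1%N, (fun=> r), (fun=> r ^+ e); split=> //.
by rewrite big_ord1 exprS.
Qed.

(** Otherwise [m + R r] would be a proper ideal, hence equal to [m], and would contain [r]. *)
Lemma maximal_unit m r : maximal_ideal m -> ~ m r -> exists s, m (1 - s * r).
Proof.
move=> [[m0 m1 mD] mmax] mr; apply: contrapT => /forallNP hs.
pose J : set R := [set x | exists s, m (x - s * r)].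
have JE : J = m.
  apply: mmax; last first.
    by move=> x mx; exists 0; rewrite mul0r subr0.
  split; rewrite ?inE /=; first by exists 0; rewrite mul0r subr0; move: m0; rewrite inE.
    by apply/negP; rewrite inE => -[s hs']; apply: (hs s).
  move=> a u v; rewrite !inE => -[s us] [s' vs']; exists (a * s + s').
  have -> : a * u + v - (a * s + s') * r = a * (u - s * r) + (v - s' * r).
    by rewrite mulrBr mulrDl opprD addrACA mulrA.
  by have := mD a (u - s * r) (v - s' * r); rewrite !inE; apply.
by apply: mr; rewrite -JE; exists 1; rewrite mul1r subrr; move: m0; rewrite inE.
Qed.

Lemma act_unit_eq0 r s e e' x : r ^+ e .* x = 0 -> (1 - s * r) ^+ e' .* x = 0 -> x = 0.
Proof.
move=> rx sx; elim: e rx => [|e IH] rx; first by rewrite -[x]act1 -rx expr0.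
apply: IH; set y := r ^+ e .* x.
have ry : r .* y = 0 by rewrite /y -actM -exprS.
have {sx} : (1 - s * r) ^+ e' .* y = 0 by rewrite /y actC sx act0r.
elim: e' => [|e' IH]; first by rewrite expr0 act1.
by rewrite exprSr actM actBl act1 actM ry act0r subr0.
Qed.

Lemma wspace_eq0 m r e x : maximal_ideal m -> ~ m r -> wspace m x -> r ^+ e .* x = 0 -> x = 0.
Proof.
move=> mm mr [d hx] rx; have [s ms] := maximal_unit mm mr.
by apply: act_unit_eq0 rx (hx _ (ideal_exp_pow d ms)).
Qed.

Lemma maximal_sep m n : maximal_ideal m -> maximal_ideal n -> m <> n -> exists2 r, n r & ~ m r.
Proof.
move=> [mI _] [_ nmax] mn; apply: contrapT => h; apply: mn; apply: nmax => // r nr.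
by apply: contrapT => mr; apply: h; exists r.
Qed.

(** An element [r] of [n] outside [m] has a power that kills the component at [n], which shortens
    the relation, while powers of [r] act injectively on the weight space of [m]. *)
Lemma wspace_indep (l : seq (set R)) (F : set R -> M) : uniq l ->
    (forall m, m \in l -> maximal_ideal m /\ wspace m (F m)) ->
    \sum_(m <- l) F m = 0 -> forall m, m \in l -> F m = 0.
Proof.
elim: l F => [|n l IH] F /=; first by [].
move=> /andP[nl ul] hF; rewrite big_cons => S0.
have [nmax [e ne]] := hF n (mem_head _ _).
have F0 m : m \in l -> F m = 0.
  move=> ml; have [mmax mF] : maximal_ideal m /\ wspace m (F m) by apply: hF; rewrite inE ml orbT.
  have [|r nr mr] := maximal_sep mmax nmax; first by move=> E; move: nl; rewrite -E ml.
  apply: (wspace_eq0 (e := e) mmax mr mF).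
  apply: (IH (fun m => r ^+ e .* F m)) ml => //.
    move=> m' ml'; have [] : maximal_ideal m' /\ wspace m' (F m').
      by apply: hF; rewrite inE ml' orbT.
    by move=> ? ?; split=> //; apply: wspace_act.
  have rn : r ^+ e .* F n = 0 by apply/ne/ideal_exp_pow.
  by have := congr1 (act (r ^+ e)) S0; rewrite actD act0r act_sum rn add0r.
move=> m; rewrite inE => /orP[/eqP ->|]; last exact: F0.
by move: S0; rewrite big_seq big1 ?addr0.
Qed.

Variable (gs : seq R).
Hypothesis gs_gen : forall r, lspan (fun w => exists2 a, size a = size gs & w = mexp gs a) r.
Hypothesis gs_neq0 : (0 < size gs)%N.
Local Notation dev g z := (g - z%:A).

(** The inverse of [g - z] is a truncated geometric series in [g - l]. It belongs to [R], so it does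
    not leave the cyclic submodule. *)
Lemma dev_shift (g : R) (z l : k) e x : l != z -> dev g l ^+ e .* x = 0 ->
  exists r, dev g z .* (r .* x) = x.
Proof.
move=> lz; elim: e x => [|e IH] x.
  by rewrite expr0 act1 => ->; exists 0; rewrite !act0r.
rewrite exprSr actM => /IH[r hr]; pose c := (l - z)^-1.
exists (c%:A * (1 - r * dev g l)).
have cz : c%:A * (l - z)%:A = 1 :> R by rewrite mulr_algl scalerA mulVf ?scale1r // subr_eq0.
rewrite actM actC [(1 - _) .* x]actBl act1 actM.
have -> : act (dev g z) (x - r .* (dev g l .* x)) = (l - z)%:A .* x.
  by rewrite actB hr -actBl scalerBl opprB addrC addrA subrK.
by rewrite -actM cz act1.
Qed.

Definition cyc x y : Prop := exists r, y = r .* x.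
Definition primary g x : Prop := exists z e, dev g z ^+ e .* x = 0.
Definition fsum (P : M -> Prop) x : Prop :=
  exists2 l : seq M, (forall y, y \in l -> P y) & x = \sum_(y <- l) y.

Lemma cyc_trans x y z : cyc x y -> cyc y z -> cyc x z.
Proof. by move=> [r ->] [s ->]; exists (s * r); rewrite actM. Qed.

Lemma primary_cyc g x y : primary g x -> cyc x y -> primary g y.
Proof. by move=> [z [e h]] [r ->]; exists z, e; rewrite actC h act0r. Qed.

Lemma fsumD P x y : fsum P x -> fsum P y -> fsum P (x + y).
Proof.
move=> [l hl ->] [l' hl' ->]; exists (l ++ l'); last by rewrite big_cat.
by move=> z; rewrite mem_cat => /orP[/hl|/hl'].
Qed.

Lemma fsum_gen (P : M -> Prop) x : P x -> fsum P x.
Proof. by move=> Px; exists [:: x]; rewrite ?big_seq1 // => y; rewrite inE => /eqP ->. Qed.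

Lemma fsum_bind (P Q : M -> Prop) x : (forall y, P y -> fsum Q y) -> fsum P x -> fsum Q x.
Proof.
move=> PQ [l hl ->]; elim: l hl => [|y l IH] hl; first by exists [::].
rewrite big_cons; apply: fsumD; first by apply/PQ/hl/mem_head.
by apply: IH => z zl; apply: hl; rewrite inE zl orbT.
Qed.

(** Induction on the factors: [(g - z) u] is split already. Its components at eigenvalues other than
    [z] are divided by [g - z] and subtracted from [u]; the remainder is killed by a power of
    [g - z]. *)
Lemma primary_split1 g (zs : seq k) x : (\prod_(z <- zs) dev g z) .* x = 0 ->
  fsum (fun y => cyc x y /\ primary g y) x.
Proof.
have cycB y z : cyc x y -> cyc x z -> cyc x (y - z).
  by move=> [r ->] [s ->]; exists (r - s); rewrite actBl.
suff H zs' u : cyc x u -> (\prod_(z <- zs') dev g z) .* u = 0 ->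
    fsum (fun y => cyc x y /\ primary g y) u.
  by apply: H; exists 1; rewrite act1.
elim: zs' u => [|z zs' IH] u xu; first by rewrite big_nil act1 => ->; exists [::]; rewrite ?big_nil.
rewrite big_cons mulRC actM => /IH.
have xzu : cyc x (dev g z .* u) by apply: cyc_trans xu _; exists (dev g z).
move=> /(_ xzu)[l hl lE].
(* [w] accumulates the components at the eigenvalue [z], starting from 0. *)
have [w [w0 hw]] : exists w : M, w = 0 /\ exists e, dev g z ^+ e .* w = 0.
  by exists 0; split=> //; exists 0%N; rewrite act0r.
have : dev g z .* u = \sum_(y <- l) y + w by rewrite w0 addr0.
elim: l hl u xu w hw {lE IH xzu w0} => [|y l IH] hl u xu w [e hw].
  rewrite big_nil add0r => hu; apply: fsum_gen; split=> //.
  by exists z, e.+1; rewrite exprSr actM hu.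
have hl' v : v \in l -> cyc x v /\ primary g v by move=> vl; apply: hl; rewrite inE vl orbT.
have [xy [z' [e' hy]]] := hl y (mem_head _ _).
rewrite big_cons; have [zz|zz] := eqVneq z' z.
  move=> hu; apply: (IH hl' u xu (y + w)); last by rewrite hu [y + _]addrC -addrA.
  rewrite zz in hy; exists (e' + e)%N; rewrite actD {1}addnC !exprD !actM.
  by rewrite hy hw !act0r addr0.
have [r hr] := dev_shift zz hy; move=> hu.
have xry : cyc x (r .* y) by apply: cyc_trans xy _; exists r.
rewrite -[u](subrK (r .* y)); apply: fsumD.
  apply: (IH hl' _ (cycB _ _ xu xry) w); first by exists e.
  by rewrite actB hu hr -[y + _ + w]addrA [y + _]addrC addrK.
by apply: fsum_gen; split=> //; exists z', e'; rewrite actC hy act0r.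
Qed.

Definition lfinite x : Prop :=
  forall g, g \in gs -> exists zs : seq k, (\prod_(z <- zs) dev g z) .* x = 0.

(** One generator is treated at a time. The pieces stay in the cyclic submodule of the vector they
    come from, so what was achieved for earlier generators persists. *)
Lemma primary_split x : lfinite x -> fsum (fun y => forall g, g \in gs -> primary g y) x.
Proof.
rewrite /lfinite; suff H (l : seq R) : (forall g, g \in l -> exists zs : seq k, (\prod_(z <- zs) dev g z) .* x = 0) ->
    fsum (fun y => cyc x y /\ forall g, g \in l -> primary g y) x.
  by move=> /H; apply: fsum_bind => y [_ ?]; apply: fsum_gen.
elim: l => [|g l IH] hl; first by apply: fsum_gen; split=> //; exists 1; rewrite act1.
have /IH : forall g, g \in l -> exists zs : seq k, (\prod_(z <- zs) dev g z) .* x = 0.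
  by move=> h hin; apply: hl; rewrite inE hin orbT.
apply: fsum_bind => y [xy hy]; have [zs hzs] := hl g (mem_head _ _).
have : (\prod_(z <- zs) dev g z) .* y = 0 by case: xy => r ->; rewrite actC hzs act0r.
move=> /primary_split1; apply: fsum_bind => u [yu gu]; apply: fsum_gen.
split; first exact: cyc_trans yu.
by move=> h; rewrite inE => /orP[/eqP -> //|/hy hp]; apply: primary_cyc yu.
Qed.

(** For each generator in turn, the last power of [g - z g] that does not kill the current vector is
    applied to it. *)
Lemma joint_eigenvector (z : R -> k) (e : R -> nat) x : x <> 0 ->
    (forall g, g \in gs -> dev g (z g) ^+ e g .* x = 0) ->
  exists2 v, v <> 0 & forall g, g \in gs -> dev g (z g) .* v = 0.
Proof.
move=> x0; suff H (l : seq R) : (forall g, g \in l -> dev g (z g) ^+ e g .* x = 0) ->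
    exists2 v, v <> 0 /\ cyc x v & forall g, g \in l -> dev g (z g) .* v = 0.
  by move=> /H[v [v0 _] hv]; exists v.
elim: l => [|g l IH] hl; first by exists x => //; split=> //; exists 1; rewrite act1.
have [|v [v0 xv] hv] := IH; first by move=> h hin; apply: hl; rewrite inE hin orbT.
have : exists d : nat, dev g (z g) ^+ d .* v == 0.
  by exists (e g); case: xv => r ->; rewrite actC hl ?mem_head // act0r.
move=> /ex_minnP[[|d] /eqP hn min].
  by case: v0; rewrite -[v]act1 -hn expr0.
exists (dev g (z g) ^+ d .* v).
  split; last by apply: cyc_trans xv _; exists (dev g (z g) ^+ d).
  by move=> /eqP /min; rewrite ltnn.
move=> h; rewrite inE => /orP[/eqP ->|/hv hh]; first by rewrite -actM -exprS.
by rewrite actC hh act0r.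
Qed.

Definition dev_ideal (z : R -> k) r : Prop :=
  exists s : R -> R, r = \sum_(g <- undup gs) s g * dev g (z g).

Lemma dev_idealD z r s : dev_ideal z r -> dev_ideal z s -> dev_ideal z (r + s).
Proof.
move=> [a ->] [b ->]; exists (fun g => a g + b g); rewrite -big_split.
by apply: eq_bigr => g _; rewrite mulrDl.
Qed.

Lemma dev_idealM z r s : dev_ideal z s -> dev_ideal z (r * s).
Proof.
move=> [a ->]; exists (fun g => r * a g); rewrite mulr_sumr.
by apply: eq_bigr => g _; rewrite mulrA.
Qed.

Lemma dev_ideal0 z : dev_ideal z 0.
Proof. by exists (fun=> 0); rewrite big1 // => g _; rewrite mul0r. Qed.

Lemma dev_ideal_gen z g : g \in gs -> dev_ideal z (dev g (z g)).
Proof.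
move=> gin; exists (fun h => if h == g then 1 else 0).
rewrite (bigD1_seq g) ?mem_undup ?undup_uniq //= eqxx mul1r big1 ?addr0 // => h /negPf ->.
by rewrite mul0r.
Qed.

Lemma dev_ideal_const z r : exists c : k, dev_ideal z (r - c%:A).
Proof.
elim: (gs_gen r) => [|a x y [e se ->] _ [c hc]].
  by exists 0; rewrite scale0r subr0; apply: dev_ideal0.
suff [d hd] : exists d : k, dev_ideal z (mexp gs e - d%:A).
  exists (a * d + c).
  have -> : a *: mexp gs e + y - (a * d + c)%:A = a%:A * (mexp gs e - d%:A) + (y - c%:A).
    by rewrite mulrBr !mulr_algl scalerDl opprD addrACA scalerA.
  by apply: dev_idealD => //; apply: dev_idealM.
have mulI (u v : R) c1 c2 : dev_ideal z (u - c1%:A) -> dev_ideal z (v - c2%:A) ->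
    dev_ideal z (u * v - (c1 * c2)%:A).
  move=> hu hv; have -> : u * v - (c1 * c2)%:A = v * (u - c1%:A) + c1%:A * (v - c2%:A).
    rewrite !mulrBr !mulr_algl !mulr_algr scalerA [v * u]mulRC.
    by rewrite addrA subrK.
  by apply: dev_idealD; apply: dev_idealM.
have one : exists d : k, dev_ideal z (1 - d%:A).
  by exists 1; rewrite scale1r subrr; apply: dev_ideal0.
(* The list in the monomial gets its own name, so that the induction on it leaves the [gs] inside
   [dev_ideal] fixed. *)
have [l [lgs lE]] : exists l : seq R, {subset l <= gs} /\ l = gs by exists gs; split.
rewrite -[X in mexp X]lE.
elim: l e {se lE} lgs => [|g l IH] [|i e] lgs /=; do ?exact: one.
have [d hd] := IH e (fun h hl => lgs h (mem_behead (s := g :: l) hl)).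
exists (z g ^+ i * d); apply: (mulI) => //; elim: i => [|i IHi].
  by rewrite !expr0 scale1r subrr; apply: dev_ideal0.
rewrite !exprS; apply: (mulI) => //; apply: dev_ideal_gen => //.
by apply: lgs; rewrite mem_head.
Qed.

(** [m] is the annihilator of a common eigenvector. It coincides with the ideal generated by all
    [g - z g], and it is maximal because every element of [R] is a scalar modulo that ideal. *)
Lemma wspace_primary x : x <> 0 -> (forall g, g \in gs -> primary g x) ->
  exists2 m, maximal_ideal m & wspace m x.
Proof.
move=> x0 hx; have ex (g : R) : exists ze : k * nat, g \in gs -> dev g ze.1 ^+ ze.2 .* x = 0.
  by case: (boolP (g \in gs)) => [/hx[z [e h]]|_]; [exists (z, e) | exists (0, 0%N)].
have /choice[ze hze] := ex.
pose z g := (ze g).1; pose e g := (ze g).2.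
have [v v0 hv] := joint_eigenvector (z := z) (e := e) x0 hze.
have kill r : dev_ideal z r -> r .* v = 0.
  by move=> [s ->]; rewrite act_suml big_seq big1 // => g; rewrite mem_undup => gin; rewrite actM (hv g gin) act0r.
pose m : set R := [set r | r .* v = 0].
have mdev r : m r -> dev_ideal z r.
  move=> mr; have [c hc] := dev_ideal_const z r.
  have := kill _ hc; rewrite actBl mr sub0r => /eqP; rewrite oppr_eq0 => /eqP cv.
  have [c0|c0] := eqVneq c 0; first by rewrite c0 scale0r subr0 in hc.
  case: v0; have := congr1 (act (c^-1)%:A) cv.
  by rewrite act0r -actM mulr_algl scalerA mulVf // scale1r act1.
have mI : idealr_closed [in m].
  split; rewrite ?inE /=; first exact: act0l.
    by apply/negP; rewrite inE /m /= act1.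
  by move=> a u w; rewrite !inE /m /= => hu hw; rewrite actDl actM hu hw act0r addr0.
exists m.
  split=> // J [J0 J1 JD] mJ; apply/seteqP; split=> // r Jr.
  apply: contrapT => mr; have [c hc] := dev_ideal_const z r.
  have c0 : c != 0.
    by apply/eqP => c0; apply: mr; apply: kill; rewrite c0 scale0r subr0 in hc.
  have Jc : J (r - c%:A) by apply/mJ/kill.
  move/negP: J1; apply; have := JD (- (c^-1)%:A) (r - c%:A) ((c^-1)%:A * r).
  rewrite !inE; have -> : - (c^-1)%:A * (r - c%:A) + (c^-1)%:A * r = 1.
    rewrite mulNr mulrBr opprB [(c^-1)%:A * c%:A]mulr_algl scalerA mulVf // scale1r.
    by rewrite subrK.
  apply=> //; have := JD (c^-1)%:A r 0; rewrite !inE addr0; apply=> //.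
  by move: J0; rewrite inE.
have [g0 g0in] : exists g, g \in gs.
  by case: gs gs_neq0 => // g l _; exists g; apply: mem_head.
(* Each factor from [m] lowers the exponent of one generator in each of its terms; once the total is
   0 the vector itself is 0, because there is at least one generator. *)
have main : forall N (d : R -> nat) u, (forall g, g \in gs -> dev g (z g) ^+ d g .* u = 0) ->
    (\sum_(g <- undup gs) d g <= N)%N -> forall r, ideal_exp m N r -> r .* u = 0.
  elim=> [|N IH] d u hu hd r.
    move: hd; rewrite (bigD1_seq g0) ?mem_undup ?undup_uniq //= leqn0 addn_eq0 => /andP[/eqP d0 _] _.
    by have := hu g0 g0in; rewrite d0 expr0 act1 => ->; apply: act0r.
  move=> [l [a [b [ab ->]]]]; rewrite act_suml big1 // => i _.
  have [/mdev[s ->] mb] := ab i; rewrite actM actC act_suml act_sum big_seq big1 // => g.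
  rewrite mem_undup => gin.
  rewrite [(s g * _) .* u]actM actC; suff -> : b i .* (dev g (z g) .* u) = 0 by rewrite act0r.
  have [d0|d0] := posnP (d g).
    by have := hu g gin; rewrite d0 expr0 act1 => ->; rewrite !act0r.
  apply: (IH (fun h => if h == g then (d g).-1 else d h)) mb.
    move=> h hin; case: eqP => [->|_]; last by rewrite actC hu // act0r.
    by rewrite -actM -exprSr prednK // hu.
  move: hd; rewrite !(bigD1_seq g) ?mem_undup ?undup_uniq //= eqxx => hd.
  rewrite -ltnS; apply: leq_trans hd; rewrite -[X in (_ < X + _)%N](prednK d0) addSn ltnS leq_add2l.
  by apply: eq_leq; apply: eq_bigr => h /negPf ->.
by exists (\sum_(g <- undup gs) e g)%N; apply: (main _ e).
Qed.

(** [mu] assigns a maximal ideal to every nonzero primary summand of [x], and summands with the same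
    ideal are added; uniqueness is [wspace_indep]. *)
Lemma wspace_direct_sum : (forall x, lfinite x) ->
  internal_direct_sum (@maximal_ideal R) wspace.
Proof.
move=> lf x; have [l hl xE] := primary_split (lf x).
have supp_sum (c : {malg M[set R]}) (s : seq (set R)) : uniq s -> {subset msupp c <= s} ->
    \sum_(j <- msupp c) c@_j = \sum_(j <- s) c@_j.
  move=> us cs; rewrite [RHS](bigID (fun j => j \in msupp c)) /= [X in _ + X]big1 ?addr0.
    rewrite -[RHS]big_filter; apply: perm_big; apply: uniq_perm; rewrite ?fset_uniq ?filter_uniq //.
    by move=> j; rewrite mem_filter; case: (boolP (j \in msupp c)) => // /cs ->.
  by move=> j /mcoeff_outdom.
have ex (y : M) : exists m, y \in l -> y <> 0 -> maximal_ideal m /\ wspace m y.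
  case: (boolP (y \in l)) => [/hl hy|_]; last by exists setT.
  have [y0|/eqP y0] := eqVneq y 0; first by exists setT => _ /(_ y0).
  by have [m ? ?] := wspace_primary y0 hy; exists m.
have /choice[mu hmu] := ex.
pose F : {malg M[set R]} := \sum_(y <- l) << y *g mu y >>.
have FE m : F@_m = \sum_(y <- l | mu y == m) y.
  rewrite raddf_sum /= [RHS]big_mkcond; apply: eq_bigr => y _.
  by rewrite mcoeffU; case: eqP.
have hF : forall m, m \in msupp F -> maximal_ideal m /\ wspace m F@_m.
  move=> m; rewrite -mcoeff_neq0 FE => S0; split.
    apply: contrapT => mm; move/eqP: S0; apply; rewrite big_seq_cond big1 // => y /andP[yl /eqP ym].
    by apply: contrapT => y0; apply: mm; rewrite -ym; have [] := hmu y yl y0.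
  rewrite big_seq_cond; apply: wspace_sum => y /andP[yl /eqP ym].
  have [->|/eqP y0] := eqVneq y 0; first exact: wspace0.
  by rewrite -ym; have [] := hmu y yl y0.
have xF : x = \sum_(m <- msupp F) F@_m.
  pose s := undup (map mu l).
  rewrite xE (supp_sum F s) ?undup_uniq //.
    transitivity (\sum_(y <- l) \sum_(m <- s | mu y == m) y).
      apply: eq_big_seq => y yl; rewrite -big_filter.
      rewrite (perm_big [:: mu y]) ?big_seq1 //=.
        apply: uniq_perm; rewrite ?filter_uniq ?undup_uniq // => m.
        rewrite mem_filter inE eq_sym; case: eqP => // ->.
        by rewrite mem_undup map_f.
    rewrite (exchange_big_dep xpredT) //=; apply: eq_bigr => m _.
    by rewrite FE.
  move=> m; rewrite -mcoeff_neq0 FE mem_undup => S0; apply: contrapT => ml.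
  move/eqP: S0; apply; rewrite big_seq_cond big1 // => y /andP[yl /eqP ym].
  by case: ml; rewrite -ym map_f.
exists F; split=> // F' [hF' xE'].
pose s := undup (msupp F ++ msupp F'); have us : uniq s by apply: undup_uniq.
have hw m : m \in s -> [/\ maximal_ideal m, wspace m F@_m & wspace m F'@_m].
  rewrite mem_undup mem_cat => ms; split.
  - by case/orP: ms => [/hF[]|/hF'[]].
  - have [/hF[]|/mcoeff_outdom ->] // := boolP (m \in msupp F); exact: wspace0.
  - have [/hF'[]|/mcoeff_outdom ->] // := boolP (m \in msupp F'); exact: wspace0.
apply/malgP => m; have [ms|] := boolP (m \in s); last first.
  by rewrite mem_undup mem_cat negb_or => /andP[/mcoeff_outdom -> /mcoeff_outdom ->].
apply/eqP; rewrite -subr_eq0; apply/eqP.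
apply: (wspace_indep (F := fun m => F@_m - F'@_m) us) ms.
  by move=> j /hw[? ? ?]; split=> //; apply: wspaceB.
rewrite sumrB -!supp_sum //; first by rewrite -xF -xE' subrr.
  by move=> i ci; rewrite mem_undup mem_cat ci orbT.
by move=> i ci; rewrite mem_undup mem_cat ci.
Qed.

End Weights.

(** * The Nullstellensatz *)

Section Nullstellensatz.
Variable k : closedFieldType.

Record prime_set (D : comNzRingType) (P : D -> Prop) : Prop := PrimeSet {
  ps0 : P 0;
  psD : forall x y, P x -> P y -> P (x + y);
  psM : forall a x, P x -> P (a * x);
  ps1 : ~ P 1;
  ps_prime : forall x y, P (x * y) -> P x \/ P y }.

(** A form of the Nullstellensatz that passes to polynomial rings: over every prime, points with
    values in [k] detect a prescribed element [b]. The freedom in [b] lets the induction keep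
    leading coefficients nonzero. *)
Definition enough_points (D : comNzRingType) (j : {rmorphism k -> D}) : Prop :=
  forall P, prime_set P -> forall b, ~ P b ->
  exists phi : {rmorphism D -> k},
    [/\ forall x, P x -> phi x = 0, phi b <> 0 & forall c, phi (j c) = c].

Section Step.
Variables (D : comNzRingType) (j : {rmorphism k -> D}).
Hypothesis epD : enough_points j.
Variables (Q : {poly D} -> Prop) (Qp : prime_set Q).

Let P a := Q a%:P.
Let Q0 := ps0 Qp.
Let QD := psD Qp.
Let QM := psM Qp.
Let Q1 := ps1 Qp.
Let Qprime := ps_prime Qp.

Lemma psN x : Q x -> Q (- x).
Proof. by move=> Qx; rewrite -mulN1r; apply: QM. Qed.

Lemma psB x y : Q x -> Q y -> Q (x - y).
Proof. by move=> Qx Qy; apply: QD => //; apply: psN. Qed.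

Lemma psX x n : ~ Q x -> ~ Q (x ^+ n).
Proof.
move=> Qx; elim: n => [|n IH]; first exact: Q1.
by rewrite exprS => /Qprime[].
Qed.

Lemma prime_const : prime_set P.
Proof.
split; rewrite /P.
- exact: Q0.
- by move=> x y; rewrite polyCD; apply: QD.
- by move=> a x; rewrite polyCM; apply: QM.
- exact: Q1.
- by move=> x y; rewrite polyCM; apply: Qprime.
Qed.

(** Vanishing modulo [P]. The quotient of [D] by [P] is never formed; [truncate] plays the part of
    taking degrees there. *)
Definition null (g : {poly D}) := forall i, P g`_i.

Lemma null_in g : null g -> Q g.
Proof.
move=> ng; rewrite -[g]coefK poly_def; elim/big_ind: _ => [||i _].
- exact: Q0.
- by move=> *; apply: QD.
- by rewrite -mul_polyC mulrC; apply: QM; apply: ng.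
Qed.

Lemma nullD g h : null g -> null h -> null (g + h).
Proof. by move=> ng nh i; rewrite coefD /P polyCD; apply: QD; [apply: ng | apply: nh]. Qed.

Lemma nullM g h : null g -> null (g * h).
Proof.
move=> ng i; rewrite coefM /P rmorph_sum /=.
elim/big_ind: _ => [||i' _]; [exact: Q0 | by move=> *; apply: QD |].
by rewrite polyCM mulrC; apply: QM; apply: ng.
Qed.

Lemma truncate g : exists g', [/\ null (g - g'), (size g' <= size g)%N
  & g' = 0 \/ ~ P (lead_coef g')].
Proof.
elim: {g}(size g) {-2}g (leqnn (size g)) => [|n IH] g sg.
  have -> : g = 0 by apply/eqP; rewrite -size_poly_leq0.
  by exists 0; split=> //; [move=> i; rewrite subr0 coef0; apply: Q0 | left].
have [Plc|Plc] := pselect (P (lead_coef g)); last first.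
  by exists g; split=> //; [move=> i; rewrite subrr coef0; apply: Q0 | right].
have [|g' [ng' sg' lg']] := IH (take_poly (size g).-1 g).
  by apply: leq_trans (size_take_poly _ _) _; lia.
exists g'; split=> //; last by apply: leq_trans sg' _; apply: leq_trans (size_take_poly _ _) (leq_pred _).
move=> i; have -> : (g - g')`_i = (take_poly (size g).-1 g - g')`_i + (g - take_poly (size g).-1 g)`_i.
  by rewrite !coefB; ring.
rewrite /P polyCD; apply: QD; first exact: ng'.
rewrite coefB coef_take_poly; case: ltnP => hi; first by rewrite subrr; apply: Q0.
rewrite subr0; have [->//|ne] := eqVneq i (size g).-1.
rewrite nth_default; first exact: Q0.
move: hi ne; case: (size _) => [|m] /=; lia.
Qed.

Lemma size_null g n : (forall h, Q h -> (size h < n)%N -> h = 0 \/ P (lead_coef h)) ->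
  Q g -> (size g < n)%N -> null g.
Proof.
move=> hmin Qg sg; have [g' [ng sg' [g0|lg']]] := truncate g.
  by rewrite g0 subr0 in ng.
have Qg' : Q g'.
  have -> : g' = g - (g - g') by ring.
  by apply: psB => //; apply: null_in.
by case: (hmin g' Qg' (leq_ltn_trans sg' sg)) => // g0; rewrite g0 subr0 in ng.
Qed.

Lemma point_extends (phi : {rmorphism D -> k}) (z : k) :
    (forall c, phi (j c) = c) ->
    (forall h, Q h -> (map_poly phi h).[z] = 0) ->
  exists phi' : {rmorphism {poly D} -> k},
    [/\ forall h, Q h -> phi' h = 0, forall h, phi' h = (map_poly phi h).[z]
      & forall c, phi' ((@polyC D \o j) c) = c].
Proof.
move=> phij hz; have cz : commr_rmorph phi z by move=> a; apply: mulrC.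
exists (horner_morph cz); split=> [h|h|c]; rewrite ?/horner_morph //; first exact: hz.
by rewrite /= horner_morphC.
Qed.

(** If [Q] consists of the polynomials with coefficients in [P], a point of [D] is extended by a
    nonroot of the image of [b]. Otherwise pseudo-division by an element [f] of least degree
    controls [Q], and some multiple of [b] is congruent modulo [Q] to a constant [c] outside [P]. A
    point of [D] not killing [c] times the leading coefficient of [f] then extends by a root of the
    image of [f]. *)
Lemma enough_points_step b : ~ Q b ->
  exists phi : {rmorphism {poly D} -> k},
    [/\ forall x, Q x -> phi x = 0, phi b <> 0 & forall c, phi ((@polyC D \o j) c) = c].
Proof.
move=> Qb; have [allnull|] := pselect (forall g, Q g -> null g).
  have /existsNP[i Pi] : ~ null b by move=> /null_in.
  have [phi [phiP phib phij]] := epD prime_const Pi.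
  have : map_poly phi b != 0.
    by apply/eqP => /(congr1 (fun h : {poly k} => h`_i)); rewrite coef_map coef0.
  move=> /closed_nonrootP[z hz].
  have [|phi' [phi'Q phi'E phi'j]] := point_extends (z := z) phij.
    move=> h Qh; rewrite -[map_poly phi h]coefK poly_def big1 ?horner0 // => i' _.
    by rewrite coef_map /= phiP ?scale0r //; apply: allnull.
  by exists phi'; split=> //; rewrite phi'E; apply/eqP.
move=> /existsNP[f0 /not_implyP[Qf0 nf0]].
have : exists n, `[< exists f, [/\ Q f, f <> 0, ~ P (lead_coef f) & size f = n] >].
  have [f [nf sf [f0E|lf]]] := truncate f0; first by rewrite f0E subr0 in nf.
  exists (size f); apply/asboolP; exists f; split=> //.
    have -> : f = f0 - (f0 - f) by ring.
    by apply: psB => //; apply: null_in.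
  by move=> f0E; apply: lf; rewrite f0E lead_coef0; apply: Q0.
move=> /ex_minnP[n /asboolP[f [Qf f0N lf sf]] nmin].
have lown h : Q h -> (size h < n)%N -> null h.
  apply: size_null => g Qg sg; have [g0|/eqP g0] := eqVneq g 0; first by left.
  right; apply: contrapT => lg; have : (n <= size g)%N by apply: nmin; apply/asboolP; exists g.
  by rewrite leqNgt sg.
have Qlf e : ~ Q (lead_coef f ^+ e)%:P by rewrite polyC_exp; apply: psX.
(* w: an element of smallest degree of b {poly D} modulo Q *)
have : exists d, `[< exists w y, [/\ ~ Q w, Q (w - b * y) & size w = d] >].
  by exists (size b); apply/asboolP; exists b, 1; split=> //; rewrite mulr1 subrr; apply: Q0.
move=> /ex_minnP[d /asboolP[w0 [y0 [Qw0 wb0 sw0]]] dmin].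
have dmin' w y : ~ Q w -> Q (w - b * y) -> (d <= size w)%N.
  by move=> Qw wb; apply: dmin; apply/asboolP; exists w, y.
have [w [nw sw lw]] := truncate w0.
have Qw : ~ Q w.
  move=> Qw; apply: Qw0; have -> : w0 = (w0 - w) + w by ring.
  by apply: QD => //; apply: null_in.
have wb : Q (w - b * y0).
  have -> : w - b * y0 = (w0 - b * y0) - (w0 - w) by ring.
  by apply: psB => //; apply: null_in.
have {lw} lw : ~ P (lead_coef w).
  by case: lw => // w0E; case: Qw; rewrite w0E; apply: Q0.
have sw' : size w = d.
  by apply/eqP; rewrite eqn_leq (dmin' w y0) // -sw0 sw.
have w0N : w <> 0 by move=> E; apply: Qw; rewrite E; apply: Q0.
have f0N' : f != 0 by apply/eqP.
(* The pseudo-remainder of [w] by [f] competes with [w] for least degree. *)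
have dn : (d < n)%N.
  have E := Pdiv.ComRing.rdivp_eq f w.
  set r := Pdiv.CommonRing.rmodp w f in E; have sr : (size r < n)%N by rewrite -sf; apply: Pdiv.Ring.ltn_rmodpN0.
  apply: leq_ltn_trans sr; apply: (dmin' _ (y0 * (lead_coef f ^+ Pdiv.CommonRing.rscalp w f)%:P)).
    move=> Qr; have := QD (QM (Pdiv.CommonRing.rdivp w f) Qf) Qr; rewrite -E -mul_polyC.
    by move=> /Qprime[] //; apply: Qlf.
  have -> : r = (lead_coef f ^+ Pdiv.CommonRing.rscalp w f)%:P * w - Pdiv.CommonRing.rdivp w f * f.
    by rewrite mul_polyC E; ring.
  set c := _%:P; have -> : c * w - Pdiv.CommonRing.rdivp w f * f - b * (y0 * c) =
    c * (w - b * y0) - Pdiv.CommonRing.rdivp w f * f by ring.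
  by apply: psB; apply: QM.
(* If [w] were not constant, the pseudo-remainder of [f] by [w] would be in [Q] by minimality, hence
   also [q * w], and [q] since [Q] is prime. Comparing top coefficients of [q * w] and [f] modulo
   [P] rules this out, whether [q] has degree below that of [f] or not. *)
have sw1 : size w = 1%N.
  apply/eqP; rewrite eqn_leq lt0n size_poly_eq0; apply/andP; split; last exact/eqP.
  rewrite leqNgt; apply/negP => w2.
  have E := Pdiv.ComRing.rdivp_eq w f.
  set e := Pdiv.CommonRing.rscalp f w in E; set q := Pdiv.CommonRing.rdivp f w in E.
  set r := Pdiv.CommonRing.rmodp f w in E.
  have sr : (size r < d)%N by rewrite -sw'; apply: Pdiv.Ring.ltn_rmodpN0; apply/eqP.
  have rE : r = (lead_coef w ^+ e)%:P * f - q * w by rewrite mul_polyC E; ring.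
  have Qr : Q r.
    apply: contrapT => Qr; have := dmin' r (- q * y0) Qr; rewrite leqNgt sr.
    have -> : r - b * (- q * y0) = (lead_coef w ^+ e)%:P * f - q * (w - b * y0) by rewrite rE; ring.
    by move=> h; have // : false by apply: h; apply: psB; apply: QM.
  have nr : null r by apply: lown => //; apply: ltn_trans dn.
  have Qq : Q q.
    have : Q (q * w).
      have -> : q * w = (lead_coef w ^+ e)%:P * f - r by rewrite rE; ring.
      by apply: psB => //; apply: QM.
    by move=> /Qprime[].
  have [q' [nq sq' lq']] := truncate q.
  have Qq' : Q q'.
    have -> : q' = q - (q - q') by ring.
    by apply: psB => //; apply: null_in.
  have coefE i : lead_coef w ^+ e * f`_i = (q * w)`_i + r`_i.
    by rewrite -coefD -E coefZ.
  have [nsq|sqn] := leqP n (size q'); last first.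
    have nq' : null q' by apply: lown.
    have : null q.
      have -> : q = (q - q') + q' by ring.
      exact: nullD.
    move=> nullq; have Pn := @nullM _ w nullq n.-1.
    have : P (lead_coef w ^+ e * f`_n.-1).
      by rewrite coefE /P polyCD; apply: QD => //; apply: nr.
    rewrite -sf -/(lead_coef f) => /(ps_prime prime_const)[] //.
    by rewrite /P polyC_exp; apply: psX.
  have {lq'} lq' : ~ P (lead_coef q').
    by case: lq' => // q0; move: nsq dn; rewrite q0 size_poly0; lia.
  have := @nullM _ w nq ((size q' + size w).-2).
  have -> : (q - q') * w = q * w - q' * w by ring.
  have big0 : (q * w)`_(size q' + size w).-2 = 0.
    have := coefE (size q' + size w).-2; rewrite [f`_ _]nth_default; last by rewrite sf; lia.
    by rewrite [r`_ _]nth_default; [rewrite mulr0 addr0 | apply: leq_trans (ltnW sr) _; lia].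
  rewrite coefB big0 sub0r -mul_lead_coef => /(psN (x := _)).
  by rewrite polyCN opprK => /(ps_prime prime_const)[].
have [c c0 wc] : exists2 c, c != 0 & w = c%:P.
  by apply/size_poly1P; rewrite sw1.
have Pc : ~ P (lead_coef f * c).
  by move=> /(ps_prime prime_const)[] //; rewrite /P -wc.
have [phi [phiP phic phij]] := epD prime_const Pc.
have [phil phic'] : phi (lead_coef f) <> 0 /\ phi c <> 0.
  by split=> E; apply: phic; rewrite rmorphM E ?mul0r ?mulr0.
have sphi : size (map_poly phi f) = n by rewrite size_map_poly_id0 //; apply/eqP.
have /closed_rootP[z /eqP rz] : size (map_poly phi f) != 1%N.
  by rewrite sphi; move: dn; rewrite -sw' sw1; case: (n) => [|[]].
have [|phi' [phi'Q phi'E phi'j]] := point_extends (z := z) phij.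
  move=> h Qh; have E := Pdiv.ComRing.rdivp_eq f h.
  set r := Pdiv.CommonRing.rmodp h f in E.
  have Qr : Q r.
    have -> : r = (lead_coef f ^+ Pdiv.CommonRing.rscalp h f)%:P * h - Pdiv.CommonRing.rdivp h f * f.
      by rewrite mul_polyC E; ring.
    by apply: psB; apply: QM.
  have nr : null r by apply: lown => //; rewrite -sf; apply: Pdiv.Ring.ltn_rmodpN0.
  have r0 : map_poly phi r = 0.
    by apply/polyP => i; rewrite coef_map coef0 /= phiP //; apply: nr.
  move: E => /(congr1 (fun q => (map_poly phi q).[z])).
  rewrite -mul_polyC rmorphD !rmorphM /= r0 addr0 !hornerE rz mulr0 map_polyC hornerC /= rmorphXn.
  by move=> /eqP; rewrite mulf_eq0 expf_eq0 => /orP[/andP[_ /eqP]|/eqP].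
exists phi'; split=> // bE; apply: phic'.
have := phi'Q _ wb; rewrite rmorphB rmorphM bE mul0r subr0 wc phi'E.
by rewrite map_polyC hornerC.
Qed.

End Step.

Lemma enough_points_base : enough_points (idfun : {rmorphism k -> k}).
Proof.
move=> P Pp b Pb; exists (idfun : {rmorphism k -> k}); split=> // [x Px /=|/= b0].
  apply/eqP; apply: contrapT => /negP x0; apply: (ps1 Pp).
  by rewrite -(mulVf x0); apply: (psM Pp).
by apply: Pb; rewrite b0; apply: (ps0 Pp).
Qed.

Section Maximal.
Variables (R : algType k).
Hypothesis mulRC : forall r s : R, r * s = s * r.

(** [D] is an iterated polynomial ring over [k] with one variable for each generator. *)
Lemma enough_points_cover (gs : seq R) :
  exists (D : comNzRingType) (j : {rmorphism k -> D}) (psi : {rmorphism D -> R}),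
    [/\ enough_points j, forall c, psi (j c) = c%:A & forall g, g \in gs -> exists d, psi d = g].
Proof.
elim: gs => [|g gs [D [j [psi [ep psij psig]]]]].
  exists k, (idfun : {rmorphism k -> k}), (in_alg R : {rmorphism k -> R}).
  by split=> //; apply: enough_points_base.
have cg : commr_rmorph psi g by move=> a; apply: mulRC.
exists {poly D}, (@polyC D \o j : {rmorphism k -> {poly D}}), (horner_morph cg : {rmorphism {poly D} -> R}).
split=> [Q Qp b Qb|c|h].
- exact: (enough_points_step ep Qp Qb).
- by rewrite /= horner_morphC psij.
- rewrite inE => /orP[/eqP ->|/psig[d <-]]; first by exists 'X; rewrite /= horner_morphX.
  by exists d%:P; rewrite /= horner_morphC.
Qed.

(** [z] is the value of a preimage of [r] at a point of [D] that kills the preimage of [m]. If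
    [r - z] were outside [m] it would be invertible modulo [m], and the point would send an element
    of that preimage to 1. *)
Lemma maximal_point (gs : seq R) (m : set R) :
    (forall r, lspan (fun w => exists2 a, size a = size gs & w = mexp gs a) r) ->
  maximal_ideal m -> forall r, exists z : k, m (r - z%:A).
Proof.
move=> gs_gen mm; have [D [j [psi [ep psij psig]]]] := enough_points_cover gs.
have psiS r : exists d, psi d = r.
  elim: (gs_gen r) => [|a x y [e _ ->] _ [d2 <-]]; first by exists 0; rewrite rmorph0.
  suff [d1 <-] : exists d, psi d = mexp gs e.
    by exists (j a * d1 + d2); rewrite rmorphD rmorphM psij mulr_algl.
  elim: gs e psig {gs_gen} => [|g gs IH] [|i e] psig /=; do ?by exists 1; rewrite rmorph1.
  have [d dg] := psig g (mem_head _ _).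
  have [|d' <-] := IH e; first by move=> h hin; apply: psig; rewrite inE hin orbT.
  by exists (d ^+ i * d'); rewrite rmorphM rmorphXn dg.
have [[m0 m1 mD] _] := mm.
have m0' : m 0 by move: m0; rewrite inE.
have m1' : ~ m 1 by move=> h; move/negP: m1; apply; rewrite inE.
have mD' a u v : m u -> m v -> m (a * u + v).
  by move=> mu mv; have := mD a u v; rewrite !inE; apply.
pose P d := m (psi d).
have mp : prime_set P.
  split; rewrite /P.
  - by rewrite rmorph0.
  - by move=> x y mx my; rewrite rmorphD -[psi x]mul1r; apply: mD'.
  - by move=> a x mx; rewrite rmorphM -[_ * _]addr0; apply: mD'.
  - by rewrite rmorph1.
  - move=> x y; rewrite rmorphM => mxy; have [|nx] := pselect (m (psi x)); first by left.
    right; have [s ms] := maximal_unit mm nx.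
    have -> : psi y = psi y * (1 - s * psi x) + (s * (psi x * psi y) + 0).
      rewrite mulrBr mulr1 [psi y * _]mulRC addr0 mulrA.
      by rewrite subrK.
    by apply: (mD') => //; apply: (mD').
have [phi [phiP _ phij]] := ep P mp 1 (ps1 mp).
move=> r; have [d dr] := psiS r; exists (phi d); apply: contrapT => nm.
have [s ms] := maximal_unit mm nm; have [d' dE] := psiS s.
have /phiP/eqP : P (1 - d' * (d - j (phi d))).
  by rewrite /P rmorphB rmorph1 rmorphM rmorphB psij dr dE.
by rewrite rmorphB rmorph1 rmorphM rmorphB phij subrr mulr0 subr0 oner_eq0.
Qed.

End Maximal.
End Nullstellensatz.

(** * Local finiteness *)

(** A synonym, so that the module structures over [k] and over [A] sit on different types. *)
Definition kmod (k : closedFieldType) (A : algType k) (M : lmodType A) : Type := M.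

Section BaseChange.
Variables (k : closedFieldType) (A : algType k) (M : lmodType A).
Local Notation kmod := (kmod M).
HB.instance Definition _ := GRing.Zmodule.on kmod.
Definition kscale (c : k) (x : kmod) : kmod := c%:A *: (x : M).
Fact kscaleA a b x : kscale a (kscale b x) = kscale (a * b) x.
Proof. by rewrite /kscale scalerA mulr_algl scalerA. Qed.
Fact kscale1 : left_id 1 kscale.
Proof. by move=> x; rewrite /kscale !scale1r. Qed.
Fact kscaleDr : right_distributive kscale +%R.
Proof. by move=> a x y; apply: (scalerDr (a%:A : A) (x : M)). Qed.
Fact kscaleDl x : {morph kscale^~ x : a b / a + b}.
Proof. by move=> a b; rewrite /kscale scalerDl (scalerDl (x : M)). Qed.
HB.instance Definition _ := GRing.Zmodule_isLmodule.Build k kmod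
  kscaleA kscale1 kscaleDr kscaleDl.

Lemma kscaleE c (x : kmod) : c *: x = c%:A *: (x : M). Proof. by []. Qed.

Definition kspan (vs : seq M) (x : M) : Prop := lspan (fun v : kmod => v \in (vs : seq M)) (x : kmod).

Lemma kspan0 vs : kspan vs 0. Proof. exact: lspan0. Qed.
Lemma kspanD vs x y : kspan vs x -> kspan vs y -> kspan vs (x + y).
Proof. exact: lspanD. Qed.
Lemma kspanB vs x y : kspan vs x -> kspan vs y -> kspan vs (x - y).
Proof. exact: lspanB. Qed.
Lemma kspanZ vs c x : kspan vs x -> kspan vs (c%:A *: x).
Proof. exact: (@lspanZ k kmod). Qed.
Lemma kspan_gen (vs : seq M) x : x \in vs -> kspan vs x.
Proof. exact: (@lspan_gen k kmod). Qed.
Lemma kspan_sub vs ws x : {subset vs <= ws} -> kspan vs x -> kspan ws x.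
Proof. by move=> vw; apply: lspan_sub => v /vw. Qed.
Lemma kspan_sum vs (I : Type) (r : seq I) (P : pred I) (F : I -> M) :
  (forall i, P i -> kspan vs (F i)) -> kspan vs (\sum_(i <- r | P i) F i).
Proof. by move=> h; elim/big_ind: _ => //; [apply: kspan0 | apply: kspanD]. Qed.

Lemma kspan_mul (vs ws : seq M) (a : A) x : (forall v, v \in vs -> kspan ws (a *: v)) ->
  kspan vs x -> kspan ws (a *: x).
Proof.
move=> h; elim=> [|c y z yv _ IH]; first by rewrite scaler0; apply: kspan0.
rewrite scalerDr; apply: kspanD => //.
have -> : a *: (c *: y) = c%:A *: (a *: y).
  by rewrite kscaleE !scalerA mulr_algr mulr_algl.
exact/kspanZ/h.
Qed.

End BaseChange.

(** * Annihilating polynomials on finite-dimensional subspaces *)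

Section CayleyHamilton.
Variables (k : closedFieldType) (A : algType k) (M : lmodType A) (a : A).

Definition lcomb n (vs : seq M) (u : 'rV[k]_n) : M := \sum_(j < n) (u 0 j)%:A *: vs`_j.

Lemma lcombP (vs : seq M) x : kspan vs x -> exists u : 'rV_(size vs), x = lcomb vs u.
Proof.
elim=> [|c v y vv _ [u ->]].
  by exists 0; rewrite /lcomb big1 // => j _; rewrite mxE scale0r scale0r.
have iv : (index v vs < size vs)%N by rewrite index_mem.
exists (c *: delta_mx 0 (Ordinal iv) + u); rewrite /lcomb.
under [RHS]eq_bigr => j _ do rewrite !mxE scalerDl (scalerDl vs`_j).
rewrite big_split /= [X in _ = X + _](bigD1 (Ordinal iv)) //= [X in _ = _ + X + _]big1 ?addr0 => [|j /negPf jv].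
  by rewrite eqxx mulr1 nth_index.
by rewrite jv mulr0 scale0r scale0r.
Qed.

(* Cayley-Hamilton for a matrix of a on the spanning family vs. *)
Lemma kspan_annihilator (vs : seq M) x : (forall v, v \in vs -> kspan vs (a *: v)) ->
  kspan vs x -> exists zs : seq k, (\prod_(z <- zs) (a - z%:A)) *: x = 0.
Proof.
(* The empty family is treated apart: square matrices form a nonzero ring only in positive size. *)
case: vs => [|v0 vs'] sv.
  by move=> /lcombP[u ->]; exists [::]; rewrite /lcomb big_ord0 scaler0.
set vs := v0 :: vs' in sv *; pose n := size vs'.
have ex (i : 'I_n.+1) : exists u : 'rV_n.+1, a *: vs`_i = lcomb vs u.
  by have /sv/lcombP : vs`_i \in vs by apply: mem_nth.
have /choice[c hc] := ex; pose C : 'M[k]_n.+1 := \matrix_i c i.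
have actC (u : 'rV_n.+1) : a *: lcomb vs u = lcomb vs (u *m C).
  rewrite /lcomb scaler_sumr.
  under eq_bigr => i _ do rewrite scalerA mulr_algr -mulr_algl -scalerA hc scaler_sumr.
  rewrite exchange_big; apply: eq_bigr => j _ /=.
  rewrite mxE scaler_suml scaler_suml; apply: eq_bigr => i _.
  by rewrite mxE scalerA mulr_algl scalerA.
have actB z (u : 'rV_n.+1) : (a - z%:A) *: lcomb vs u = lcomb vs (u *m (C - z%:M)).
  rewrite scalerBl actC mulmxBr mul_mx_scalar /lcomb scaler_sumr -sumrB.
  apply: eq_bigr => j _; rewrite !mxE scalerBl scalerBl scalerA mulr_algl scalerA.
  by [].
have actP (zs : seq k) (u : 'rV_n.+1) : (\prod_(z <- zs) (a - z%:A)) *: lcomb vs u =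
    lcomb vs (u *m horner_mx C (\prod_(z <- zs) ('X - z%:P))).
  elim: zs => [|z zs IH]; first by rewrite !big_nil scale1r rmorph1 mulmx1.
  rewrite !big_cons -scalerA IH actB mulrC rmorphM /= -mulmxE mulmxA.
  by rewrite rmorphB /= horner_mx_X horner_mx_C.
(* The [zs] are the eigenvalues of [C], with multiplicity. *)
move=> /lcombP[u ->]; have [zs zsE] := closed_field_poly_normal (char_poly C).
exists zs; rewrite actP; have := Cayley_Hamilton C.
rewrite zsE (monicP (char_poly_monic C)) scale1r => ->.
by rewrite mulmx0 /lcomb big1 // => j _; rewrite mxE scale0r scale0r.
Qed.

End CayleyHamilton.

Section LocallyFinite.
Variables (k : closedFieldType) (p : nat) (A : algType k) (t : 'I_2 -> 'I_2 -> nat -> A).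
Hypothesis tY : yangian_like p t.
Variable (M : lmodType A).
Local Notation ggens := (ggens p t).
Local Notation t11 := (t ix1 ix1). Local Notation t12 := (t ix1 ix2).
Local Notation t21 := (t ix2 ix1). Local Notation t22 := (t ix2 ix2).

Definition stable (vs : seq M) : Prop :=
  forall a, a \in ggens -> forall v, v \in vs -> kspan vs (a *: v).

Lemma ggens_cases a : a \in ggens -> (exists2 r, (0 < r <= p)%N & a = t22 r) \/ (forall b, a * b = b * a).
Proof.
rewrite /(ggens) !mem_cat => /or3P[] /mapP[m]; rewrite mem_iota => hm ->.
- by left; exists m => //; lia.
- by right; apply: qdetc_central.
- by right; apply: qdetc_central.
Qed.

Lemma t22_ggens r : (0 < r <= p)%N -> t22 r \in ggens.
Proof.
by move=> hr; rewrite mem_cat map_f ?mem_iota //; lia.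
Qed.

Lemma stable_span vs a x : stable vs -> a \in ggens -> kspan vs x -> kspan vs (a *: x).
Proof. by move=> sv ga; apply: kspan_mul => v; apply: sv. Qed.

Lemma stable_t22 vs r x : stable vs -> kspan vs x -> kspan vs (t22 r *: x).
Proof.
move=> sv sx; case: r => [|r]; first by rewrite (yl_t0 tY) eqxx scale1r.
have [rp|rp] := leqP r.+1 p; first by apply: stable_span => //; apply: t22_ggens.
by rewrite (yl_gt tY) // scale0r; apply: kspan0.
Qed.

Lemma stable_cat vs ws : stable vs -> stable ws -> stable (vs ++ ws).
Proof.
move=> sv sw a ga v; rewrite mem_cat => /orP[/(sv _ ga)|/(sw _ ga)];
  by apply: kspan_sub => u hu; rewrite mem_cat hu ?orbT.
Qed.

Definition timg (i j : 'I_2) (vs : seq M) : seq M := [seq t i j q *: v | q <- iota 1 p, v <- vs].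

Lemma timg_span i j q vs x : (0 < q)%N \/ i != j -> kspan vs x -> kspan (timg i j vs) (t i j q *: x).
Proof.
move=> hq; apply: kspan_mul => v vv; case: q hq => [|q] hq.
  by case: hq => // ij; rewrite (yl_t0 tY) (negPf ij) scale0r; apply: kspan0.
have [rp|rp] := leqP q.+1 p; last by rewrite (yl_gt tY) // scale0r; apply: kspan0.
by apply: kspan_gen; apply: allpairs_f => //; rewrite mem_iota; lia.
Qed.

(** Central generators pass through [t_ij^(q)]. For [t_22^(r)] only the commutator has to be placed
    in the span, which [ws] may enlarge for that purpose. *)
Lemma stable_timg i j vs ws : {subset ws <= timg i j vs ++ ws} -> stable vs -> stable ws ->
    (forall r q u, (0 < r <= p)%N -> (0 < q <= p)%N -> u \in vs ->
       kspan (timg i j vs ++ ws) ((t22 r * t i j q - t i j q * t22 r) *: u)) ->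
  stable (timg i j vs ++ ws).
Proof.
move=> wsub sv sw hcomm a ga v; rewrite mem_cat => /orP[|/(sw _ ga)]; last exact: kspan_sub.
move=> /allpairsP[[q u] /= [qp uv ->]].
have {}qp : (0 < q <= p)%N by move: qp; rewrite mem_iota; lia.
have commu : kspan (timg i j vs ++ ws) (t i j q *: (a *: u)).
  apply: (@kspan_sub _ _ _ (timg i j vs)) => [x hx|]; first by rewrite mem_cat hx.
  by apply: timg_span; [left; case/andP: qp | apply: sv].
case: (ggens_cases ga) => [[r rp aE]|ac]; last by rewrite scalerA ac -scalerA.
have -> : a *: (t i j q *: u) = (a * t i j q - t i j q * a) *: u + t i j q *: (a *: u).
  by rewrite scalerBl !scalerA subrK.
by apply: kspanD => //; rewrite aE; apply: hcomm.
Qed.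

(** The relation for [[t_22, t_12]] writes [t_12] to the left of [t_22], so that [t_22] acts first,
    inside the old span. *)
Lemma stable_t12 vs : stable vs -> stable (timg ix1 ix2 vs).
Proof.
move=> sv; rewrite -[timg _ _ _]cats0; apply: stable_timg => // r q u rp qp uv.
rewrite (yl_commutator tY) // cats0 scaler_suml; apply: kspan_sum => a _.
by rewrite scalerBl -!scalerA; apply: kspanB; apply: timg_span; try (by right);
  apply: stable_t22 => //; apply: kspan_gen.
Qed.

(** The relation is applied to [[t_21, t_22]], the order of the commutator that again leaves [t_22]
    on the right. *)
Lemma stable_t21 vs : stable vs -> stable (timg ix2 ix1 vs).
Proof.
move=> sv; rewrite -[timg _ _ _]cats0; apply: stable_timg => // r q u rp qp uv.
rewrite -opprB (yl_commutator tY) // cats0 -sumrN scaler_suml; apply: kspan_sum => a _.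
by rewrite opprB scalerBl -!scalerA; apply: kspanB; apply: timg_span; try (by right);
  apply: stable_t22 => //; apply: kspan_gen.
Qed.

(** [[t_22, t_11]] is a combination of products [t_12 t_21], whence the second family. *)
Lemma stable_t11 vs : stable vs ->
  stable (timg ix1 ix1 vs ++ timg ix1 ix2 (timg ix2 ix1 vs)).
Proof.
move=> sv; apply: stable_timg => // [x||r q u rp qp uv]; first by rewrite mem_cat orbC => ->.
  by apply/stable_t12/stable_t21.
rewrite (yl_commutator tY) // scaler_suml; apply: kspan_sum => a _.
apply: (@kspan_sub _ _ _ (timg ix1 ix2 (timg ix2 ix1 vs))) => [x|]; first by rewrite mem_cat orbC => ->.
by rewrite scalerBl -!scalerA; apply: kspanB; do 2?[apply: timg_span; try (by right)]; apply: kspan_gen.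
Qed.

Definition locfin x : Prop := exists2 vs, stable vs & kspan vs x.

Lemma locfin0 : locfin 0.
Proof. by exists [::] => //; apply: kspan0. Qed.

Lemma locfin_t i j q x : locfin x -> locfin (t i j q *: x).
Proof.
move=> [vs sv xv]; case: q => [|q].
  by rewrite (yl_t0 tY); case: eqP => _; rewrite ?scale1r ?scale0r; [exists vs | apply: locfin0].
have tspan i' j' : kspan (timg i' j' vs) (t i' j' q.+1 *: x) by apply: timg_span => //; left.
have [/eqP -> {i}|i1] := boolP (i == ix2); have [/eqP -> {j}|j1] := boolP (j == ix2).
- by exists vs => //; apply: stable_t22.
- have -> : j = ix1 by case: j j1 => [[|[]] //= ? _]; apply: val_inj.
  by exists (timg ix2 ix1 vs) => //; apply: stable_t21.
- have -> : i = ix1 by case: i i1 => [[|[]] //= ? _]; apply: val_inj.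
  by exists (timg ix1 ix2 vs) => //; apply: stable_t12.
- have -> : i = ix1 by case: i i1 => [[|[]] //= ? _]; apply: val_inj.
  have -> : j = ix1 by case: j j1 => [[|[]] //= ? _]; apply: val_inj.
  exists (timg ix1 ix1 vs ++ timg ix1 ix2 (timg ix2 ix1 vs)); first exact: stable_t11.
  by apply: kspan_sub (tspan _ _) => v hv; rewrite mem_cat hv.
Qed.

Lemma locfinZ c x : locfin x -> locfin (c%:A *: x).
Proof. by move=> [vs sv xv]; exists vs => //; apply: kspanZ. Qed.

Lemma locfinD x y : locfin x -> locfin y -> locfin (x + y).
Proof.
move=> [vs sv xv] [ws sw yw]; exists (vs ++ ws); first exact: stable_cat.
by apply: kspanD; [apply: kspan_sub xv | apply: kspan_sub yw] => v hv; rewrite mem_cat hv ?orbT.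
Qed.

Lemma locfin_cyclic x0 : (forall a, a \in ggens -> exists z : k, a *: x0 = z%:A *: x0) ->
  forall a : A, locfin (a *: x0).
Proof.
move=> hx0; have lf0 : locfin x0.
  exists [:: x0]; last by apply: kspan_gen; rewrite inE.
  move=> a /hx0[z az] v; rewrite inE => /eqP ->; rewrite az.
  by apply/kspanZ/kspan_gen; rewrite inE.
apply: (yl_ind tY).
- by rewrite scale0r; apply: locfin0.
- by rewrite scale1r.
- by move=> a b la lb; rewrite scalerDl; apply: locfinD.
- by move=> c b lb; rewrite -mulr_algl -scalerA; apply: locfinZ.
- by move=> i j r a _ la; rewrite -scalerA; apply: locfin_t.
Qed.

End LocallyFinite.

(** * Maximal left ideals *)

Section QuotientModule.
Local Open Scope quotient_scope.
Variables (R : nzRingType) (V : lmodType R) (S : set V).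

(** Closed under the module operations for every [S], so the quotient can be formed before [S] is
    known to be a submodule. *)
Definition submod_gen : {pred V} := fun x =>
  `[< forall N : set V, submodule N -> S `<=` N -> N x >].

Lemma submoduleP (N : set V) : submodule N <->
  N 0 /\ forall a u v, N u -> N v -> N (a *: u + v).
Proof.
split=> [[N0 NL]|[N0 NL]].
  split; first by move: N0; rewrite inE.
  by move=> a u v Nu Nv; have := NL a u v; rewrite !inE; apply.
by split=> [|a u v]; rewrite !inE; [|apply: NL].
Qed.

Lemma submod_gen_closed : GRing.submod_closed submod_gen.
Proof.
split=> [|a u v /asboolP hu /asboolP hv]; apply/asboolP => N sN SN.
  by have /submoduleP[] := sN.
by have /submoduleP[_ NL] := sN; apply: NL; [apply: hu | apply: hv].
Qed.

HB.instance Definition _ := GRing.isZmodClosed.Build V submod_gen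
  (GRing.submod_closedB submod_gen_closed).

Lemma submod_genE : submodule S -> forall x, (x \in submod_gen) <-> S x.
Proof.
move=> sS x; split=> [/asboolP|Sx]; first exact.
by apply/asboolP => N _; apply.
Qed.

Definition qmod : Type := Quotient.quot submod_gen.
HB.instance Definition _ := Choice.on qmod.
HB.instance Definition _ := GRing.Zmodule.on qmod.
HB.instance Definition _ := EqQuotient.on qmod.

Definition qpi (x : V) : qmod := \pi_qmod x.

Lemma qpi_eq x y : qpi x = qpi y <-> x - y \in submod_gen.
Proof.
by rewrite (Quotient.idealrBE submod_gen) /qpi; split => [/eqP|/eqP].
Qed.

Lemma qpi_repr (x : qmod) : exists y, x = qpi y.
Proof. by exists (repr x); rewrite /qpi reprK. Qed.

Lemma qpiB x y : qpi (x - y) = qpi x - qpi y.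
Proof. exact: (raddfB (\pi_(Quotient.quot submod_gen))). Qed.

HB.instance Definition _ := GRing.isZmodMorphism.Build _ _ qpi qpiB.

(* locked keeps conversion from unfolding the choice of representatives. *)
Definition qscale (a : R) (x : qmod) : qmod := locked (qpi (a *: repr x)).

Lemma qscaleE a x : qscale a (qpi x) = qpi (a *: x).
Proof.
rewrite /qscale -lock; apply/qpi_eq; rewrite -scalerBr -[_ *: _]addr0.
have [g0 gL] := submod_gen_closed; apply: gL => //.
by apply/qpi_eq; rewrite /qpi reprK.
Qed.

Fact qscaleA a b x : qscale a (qscale b x) = qscale (a * b) x.
Proof. by have [y ->] := qpi_repr x; rewrite !qscaleE scalerA. Qed.
Fact qscale1 : left_id 1 qscale.
Proof. by move=> x; have [y ->] := qpi_repr x; rewrite qscaleE scale1r. Qed.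
Fact qscaleDr : right_distributive qscale +%R.
Proof.
move=> a x y; have [x' ->] := qpi_repr x; have [y' ->] := qpi_repr y.
by rewrite -raddfD !qscaleE scalerDr raddfD.
Qed.
Fact qscaleDl x : {morph qscale^~ x : a b / a + b}.
Proof.
by move=> a b; have [y ->] := qpi_repr x; rewrite !qscaleE scalerDl raddfD.
Qed.

HB.instance Definition _ := GRing.Zmodule_isLmodule.Build R qmod
  qscaleA qscale1 qscaleDr qscaleDl.

Lemma qpiZ a x : a *: qpi x = qpi (a *: x). Proof. exact: qscaleE. Qed.

End QuotientModule.

Section MaximalLeftIdeal.
Variable A : nzRingType.

Lemma maximal_left_ideal (I : set A^o) : submodule I -> ~ I 1 ->
  exists N : set A^o, [/\ submodule N, I `<=` N, ~ N 1 &
    forall J : set A^o, submodule J -> N `<=` J -> ~ J 1 -> J = N].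
Proof.
move=> sI I1; pose good (N : set A^o) := [/\ submodule N, I `<=` N & ~ N 1].
pose P (N : set A^o) := N = set0 \/ good N.
have [F FP Ftot|N [[N0|[sN IN N1]] Nmax]] := @Zorn_bigcup A^o P.
- have [[N0 FN0 gN0]|Fempty] := pselect (exists2 N, F N & good N); last first.
    left; apply/seteqP; split=> // x [N FN Nx].
    by case: (FP N FN) => [N0|gN]; [rewrite N0 in Nx | apply: Fempty; exists N].
  right; have [/submoduleP[N00 _] IN0 _] := gN0; split.
  + apply/submoduleP; split=> [|a u v [N FN Nu] [N' FN' Nv]]; first by exists N0.
    have [N'' [FN'' Nu'' Nv'']] : exists N'', [/\ F N'', N'' u & N'' v].
      by case: (Ftot _ _ FN FN') => h; [exists N' | exists N]; split=> //; apply: h.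
    exists N'' => //; case: (FP _ FN'') => [E|[/submoduleP[_ NL] _ _]]; last exact: NL.
    by rewrite E in Nu''.
  + by move=> x Ix; exists N0 => //; apply: IN0.
  + by move=> [N FN N1]; case: (FP _ FN) => [E|[]] //; rewrite E in N1.
- case: (Nmax I); last by right; split.
  rewrite N0; split=> // h; have /submoduleP[I0 _] := sI; exact: (h 0 I0).
- exists N; split=> // J sJ NJ J1; apply: contrapT => JN.
  apply: (Nmax J); last by right; split=> //; apply: subset_trans NJ.
  by split=> // JN'; apply: JN; apply/seteqP.
Qed.

Lemma qmod_irreducible (N : set A^o) : submodule N -> ~ N 1 ->
    (forall J : set A^o, submodule J -> N `<=` J -> ~ J 1 -> J = N) ->
  irreducible_module (qmod N : lmodType A).
Proof.
move=> sN N1 Nmax; split.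
  exists (qpi N 1); apply/eqP => /eqP; rewrite -(raddf0 (qpi N)) => /eqP/qpi_eq.
  by rewrite subr0 => /(submod_genE sN).
move=> N' /submoduleP[N0 NL]; pose J : set A^o := [set a | N' (qpi N a)].
have sJ : submodule J.
  apply/submoduleP; split; rewrite /J /=; first by rewrite raddf0.
  by move=> a u v hu hv; rewrite raddfD /= -qpiZ; apply: NL.
have [J1|J1] := pselect (J 1).
  right; apply/seteqP; split=> // x _; have [a ->] := qpi_repr x.
  have -> : qpi N a = (a : A) *: qpi N 1 + 0 by rewrite addr0 qpiZ /GRing.scale /= mulr1.
  exact: NL.
have NJ : N `<=` J.
  move=> a Na; rewrite /J /=; suff -> : qpi N a = 0 by [].
  by rewrite -(raddf0 (qpi N)); apply/qpi_eq; rewrite subr0; apply/(submod_genE sN).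
left; apply/seteqP; split=> [x N'x|_ -> //]; have [a aE] := qpi_repr x.
rewrite /= aE -(raddf0 (qpi N)); apply/qpi_eq; rewrite subr0; apply/(submod_genE sN).
by rewrite -(Nmax J sJ NJ J1) /J /= -aE.
Qed.

End MaximalLeftIdeal.

(** * Extension of maximal ideals *)

Section GelfandTsetlin.
Variables (k : closedFieldType) (p : nat) (A : algType k) (t : 'I_2 -> 'I_2 -> nat -> A).
Hypotheses (p_gt0 : (0 < p)%N) (tY : yangian_like p t).
Variables (R : algType k) (f : {rmorphism R -> A}).
Hypotheses (f_inj : injective f) (fZ : forall c r, f (c *: r) = c *: f r).
Local Notation ggens := (ggens p t).
Hypotheses (f_sub : forall r, f r \in subalg_gen [set x | x \in ggens])
  (f_onto : forall a, a \in subalg_gen [set x | x \in ggens] -> exists r, f r = a).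

Lemma f_span (r : R) : lspan (fun x => exists2 a, size a = size ggens & x = mexp ggens a) (f r).
Proof. by apply: subalg_gen_mono (f_sub r) => // x y; apply: ggens_comm. Qed.

Lemma f_mono a c : size a = size ggens -> exists r, f r = c *: mexp ggens a.
Proof. by move=> _; apply/f_onto/mexp_subalg. Qed.

Lemma f_comm (r s : R) : r * s = s * r.
Proof.
have zipC : forall a a' : seq nat, [seq (i.1 + i.2)%N | i <- zip a a'] = [seq (i.1 + i.2)%N | i <- zip a' a].
  by elim=> [|i a IH] [|i' a'] //=; rewrite addnC IH.
apply: f_inj; rewrite !rmorphM.
elim: (f_span r) => [|c x y [a sa ->] _ IH]; first by rewrite mul0r mulr0.
rewrite mulrDl mulrDr IH -scalerAl -scalerAr; congr (_ *: _ + _).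
elim: (f_span s) => [|c' x' y' [a' sa' ->] _ IH']; first by rewrite mul0r mulr0.
rewrite mulrDl mulrDr IH' -scalerAl -scalerAr; congr (_ *: _ + _).
by have gc := ggens_comm tY; rewrite !(mexpD gc) // zipC.
Qed.

Lemma f_gens : exists2 gs : seq R, map f gs = ggens &
  forall r, lspan (fun x => exists2 a, size a = size gs & x = mexp gs a) r.
Proof.
have lift l : {subset l <= ggens} -> exists gs : seq R, map f gs = l.
  elim: l => [|g l IH] hl; first by exists [::].
  have [|gs gsE] := IH; first by move=> h hin; apply: hl; rewrite inE hin orbT.
  have [|r rE] := f_onto (a := g).
    by apply/asboolP => B _; apply; apply: hl; apply: mem_head.
  by exists (r :: gs); rewrite /= rE gsE.
have [gs gsE] := lift ggens (fun x h => h); exists gs => // r.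
have sgs : size gs = size ggens by rewrite -gsE size_map.
have fm a : f (mexp gs a) = mexp ggens a.
  by rewrite -gsE; elim: (gs) a => [|x l IH] [|i a] /=; rewrite ?rmorph1 ?rmorphM ?rmorphXn ?IH.
have [l [c [_ lP E]]] := lspan_uniq (f_span r).
have -> : r = \sum_(a <- l) c a *: mexp gs a.
  by apply: f_inj; rewrite E rmorph_sum; apply: eq_bigr => a _; rewrite fZ fm.
by rewrite big_seq; apply: lspan_sum => a al; apply/lspanZ/lspan_gen; exists a; rewrite // sgs; apply: lP.
Qed.

Lemma reg_modules :
  [/\ @free_module R (left_reg f), @free_module R^c (right_reg f),
      @direct_summand R (left_reg f) (range f) & @direct_summand R^c (right_reg f) (range f)].
Proof.
have [J [b [j0 [bj0 gl il gr ir]]]] := yangian_basis p_gt0 tY.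
have bl := left_reg_basis f_inj f_mono f_span gl il.
have br := right_reg_basis f_inj f_mono f_span gr ir.
split; [exact: mod_basis_free bl | exact: mod_basis_free br | |].
- have := mod_basis_summand bl j0; set S := [set x | _].
  have -> : S = (range f : set A).
    rewrite /S; apply: funext => x; apply: propext; split=> [[r ->]|[r _ <-]]; exists r;
      by rewrite // bj0 /GRing.scale /= /left_reg_scale mulr1.
  exact.
- have := mod_basis_summand br j0; set S := [set x | _].
  have -> : S = (range f : set A).
    rewrite /S; apply: funext => x; apply: propext; split=> [[r ->]|[r _ <-]]; exists r;
      by rewrite // bj0 /GRing.scale /= /right_reg_scale mul1r.
  exact.
Qed.

Section Extension.
Variable m : set R.
Hypothesis mm : maximal_ideal m.

Let m0 : m 0. Proof. by have [[h _ _] _] := mm; move: h; rewrite inE. Qed.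
Let m1 : ~ m 1. Proof. by have [[_ h _] _] := mm; move/negP: h => h ?; apply: h; rewrite inE. Qed.
Let mD a u v : m u -> m v -> m (a * u + v).
Proof. by have [[_ _ h] _] := mm; have := h a u v; rewrite !inE; apply. Qed.

(** The left ideal of [A] generated by the image of [m]. *)
Definition ext_ideal : set A^o :=
  [set x | exists l : seq (A * R), (forall i, i \in l -> m i.2) /\ x = \sum_(i <- l) i.1 * f i.2].

Lemma ext_ideal_submodule : submodule ext_ideal.
Proof.
apply/submoduleP; split; first by exists [::]; rewrite big_nil.
move=> a u v [l [hl ->]] [l' [hl' ->]].
exists ([seq (a * i.1, i.2) | i <- l] ++ l'); split=> [i|].
  by rewrite mem_cat => /orP[/mapP[j jl ->]|il']; [apply: (hl j jl) | apply: hl'].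
rewrite big_cat big_map /GRing.scale /= mulr_sumr; congr (_ + _).
by apply: eq_bigr => i _; rewrite mulrA.
Qed.

(* f R has a complement N in A as a right R-module; projecting 1 = sum a_i f(r_i)
   along N gives 1 = sum u_i r_i in m. *)
Lemma ext_ideal_proper : ~ ext_ideal 1.
Proof.
move=> [l [hl l1]]; have [_ _ _ [_ [N [/submoduleP[N0 NL] fN split1]]]] := reg_modules.
have main (l' : seq (A * R)) : (forall i, i \in l' -> m i.2) ->
    exists2 r, m r & N (\sum_(i <- l') i.1 * f i.2 - f r).
  elim: l' => [|[a r] l' IH] hl'; first by exists 0; rewrite // big_nil rmorph0 subrr.
  have [|s ms Ns] := IH; first by move=> i il; apply: hl'; rewrite inE il orbT.
  have [_ [v [[u _ <-] Nv aE]]] := split1 a.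
  exists (u * r + s); first by apply: mD => //; apply: (hl' (a, r)); apply: mem_head.
  rewrite big_cons /= aE rmorphD rmorphM.
  have -> : (f u + v) * f r + \sum_(i <- l') i.1 * f i.2 - (f u * f r + f s) =
      v * f r + (\sum_(i <- l') i.1 * f i.2 - f s).
    by rewrite mulrDl [_ + v * _]addrC -!addrA opprD; congr (_ + _); rewrite addrCA addNKr.
  exact: NL.
have [r mr] := main l hl; rewrite -l1 => N1.
have : (range f `&` N) (1 - f r) by split=> //; exists (1 - r); rewrite // rmorphB rmorph1.
rewrite fN /= => /eqP; rewrite subr_eq0 -(rmorph1 f) => /eqP/f_inj r1.
by apply: m1; rewrite r1.
Qed.

Theorem maximal_extends : exists M : lmodType A,
  [/\ irreducible_module M, finitely_generated M,
      internal_direct_sum (@maximal_ideal R) (@wspace k A R f M) &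
      exists x : M, x != 0 /\ @wspace k A R f M m x].
Proof.
have [N [sN IN N1 Nmax]] := maximal_left_ideal ext_ideal_submodule ext_ideal_proper.
have irr := qmod_irreducible sN N1 Nmax.
have qpi0 a : N a -> qpi N a = 0.
  by move=> Na; rewrite -(raddf0 (qpi N)); apply/qpi_eq; rewrite subr0; apply/(submod_genE sN).
have mN r : m r -> N (f r).
  move=> mr; apply: IN; exists [:: (1, r)]; split; last by rewrite big_seq1 mul1r.
  by move=> i; rewrite inE => /eqP ->.
pose x0 : qmod N := qpi N 1.
have cyclic (x : qmod N) : exists a : A, x = a *: x0.
  by have [a ->] := qpi_repr x; exists a; rewrite /x0 qpiZ /GRing.scale /= mulr1.
have fx0 r : m r -> f r *: x0 = 0.
  by move=> mr; rewrite /x0 qpiZ /GRing.scale /= mulr1; apply/qpi0/mN.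
have fA c : f c%:A = c%:A by rewrite fZ rmorph1.
have [gs gsE gs_gen] := f_gens.
(* By [maximal_point] each generator differs from a scalar by an element of [m], so it acts on [x0]
   by that scalar; [locfin_cyclic] and Cayley-Hamilton then apply to every [a *: x0]. *)
have lf : forall x : qmod N, lfinite f gs x.
  move=> x; have [a ->] := cyclic x => g gin.
  have eig b : b \in ggens -> exists z : k, b *: x0 = z%:A *: x0.
    rewrite -gsE => /mapP[h _ ->]; have [z hz] := maximal_point f_comm gs_gen mm h.
    exists z; apply/eqP; rewrite -subr_eq0 -scalerBl; apply/eqP.
    by rewrite -fA -rmorphB; apply: fx0.
  have [vs sv av] := locfin_cyclic tY eig a.
  have [|zs hzs] := @kspan_annihilator _ _ _ (f g) vs (a *: x0) _ av.
    by move=> v; apply: sv; rewrite -gsE map_f.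
  exists zs; rewrite /act rmorph_prod -[RHS]hzs; congr (_ *: _).
  by apply: eq_bigr => z _; rewrite rmorphB fA.
have gs0 : (0 < size gs)%N.
  by rewrite -(size_map f) gsE size_cat size_map size_iota; lia.
exists (qmod N : lmodType A); split=> //.
- exists 1%N, (fun=> x0) => x; have [a ->] := cyclic x.
  by exists (fun=> a); rewrite big_ord1.
- refine (@wspace_direct_sum k A R f (qmod N) f_comm gs gs_gen gs0 lf).
- exists x0; split.
    apply/eqP => /eqP; rewrite -(raddf0 (qpi N)) => /eqP/qpi_eq.
    by rewrite subr0 => /(submod_genE sN).
  (* The first power of [m] already kills [x0]. *)
  exists 1%N => g [n [a [b [ab ->]]]]; apply: fx0.
  elim/big_ind: _ => // [x y mx my|i _].
    by rewrite -[x]mul1r; apply: mD.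
  by rewrite f_comm -[_ * _]addr0; apply: mD => //; case: (ab i).
Qed.

End Extension.
End GelfandTsetlin.

(** * Gamma and the Yangian as instances *)

Section Concrete.
Variables (k : closedFieldType) (p : nat).

Lemma qdet_coefE m : qdet_coef k p m = qdetc p (yt k p) m.
Proof. by []. Qed.

Lemma Gamma_gensE : Gamma_gens (k := k) (p := p) = [set x | x \in ggens p (yt k p)].
Proof.
apply: funext => x; apply: propext; split.
  move=> [[r rp ->]|[m mp ->]]; rewrite /= /ggens mem_cat.
    by rewrite map_f // mem_iota; lia.
  rewrite mem_cat qdet_coefE; have [mlep|mgtp] := leqP m p.
    by rewrite (map_f (qdetc p (yt k p))) ?orbT // mem_iota; lia.
  have -> : m = (2 * p - (2 * p - m))%N by lia.
  by rewrite (map_f (fun i => qdetc p (yt k p) (2 * p - i))) ?orbT // mem_iota; lia.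
rewrite /= /ggens !mem_cat => /or3P[] /mapP[m]; rewrite mem_iota => hm ->.
- by left; exists m => //; lia.
- by right; exists m => //; lia.
- by right; exists (2 * p - m)%N => //; lia.
Qed.

Lemma GvalZ c (r : Gamma k p) : Gval (c *: r) = c *: Gval r.
Proof. exact: (linearZ_LR (val : Gamma k p -> yangian k p)). Qed.

Lemma Gval_sub (r : Gamma k p) : Gval r \in subalg_gen [set x | x \in ggens p (yt k p)].
Proof. by rewrite -Gamma_gensE; case: r. Qed.

Lemma Gval_onto (a : yangian k p) : a \in subalg_gen [set x | x \in ggens p (yt k p)] ->
  exists r : Gamma k p, Gval r = a.
Proof. by rewrite -Gamma_gensE => ha; exists (MkGamma ha). Qed.

Lemma Gval_inj : injective (@Gval k p).
Proof. exact: val_inj. Qed.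

End Concrete.

Theorem theorem3p4 (k : closedFieldType) (char0 : [pchar k] =i pred0)
    (p : nat) (p_ge1 : (1 <= p)%N) :
  let YL : lmodType (Gamma k p) := left_reg (@Gval k p) in
  let YR : lmodType (Gamma k p)^c := right_reg (@Gval k p) in
  [/\ free_module YL, free_module YR,
      direct_summand (range (@Gval k p) : set YL) &
      direct_summand (range (@Gval k p) : set YR)] /\
  (forall m : set (Gamma k p), maximal_ideal m ->
     exists M : lmodType (yangian k p),
       [/\ irreducible_module M, harish_chandra M &
           exists x : M, x != 0 /\ weight_space m x]).
Proof.
have tY := @yangian_yangian_like k p.
split; first refine (@reg_modules k p (yangian k p) (yt k p) p_ge1 tY (Gamma k p) (@Gval k p) (@Gval_inj k p) (@Gval_sub k p) (@Gval_onto k p)).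
move=> m mm; have [M [irr fg ds hx]] := maximal_extends p_ge1 tY (@Gval_inj k p) (@GvalZ k p)
  (@Gval_sub k p) (@Gval_onto k p) mm.
by exists M.
Qed.
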